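(* Let $m,n,r$ be integers with $2\le r\le\min(m,n)$, let $A,B$ be generic binary forms of orders $m,n$ and $\mathfrak u_i=(A,B)_i$. For $p=(a,b)\in\Pi(m,n;r)=\{(a,b)\in\mathbf N^2: 2(a+b+1)\le r\}$ and integers $i,j\ge0$ with $i+j\le r$, let $\kappa^{(p)}_{i,j}$ be the scalar by which the endomorphism $\xi=\xi^{(a,b)}_{i,j}$ of $S_{2(m+n-r)}$ (defined in the context) acts. Then $$\kappa^{(p)}_{i,j}=\frac{\mathcal N_1}{\mathcal N_2}\,\Gamma,\qquad \Gamma=(-1)^{n-j}\sum_{(x,y,z)\in\Lambda}(-1)^{x+y+z}\,\frac{\mathbb T_1}{\mathbb T_2},$$ where $$\begin{aligned}\mathcal N_1={}&(m+n-2i+1)!\,(m+n-2j+1)!\,(2m-2a)!\,(2a+1)!\,(m-2a-1)!\,(n-2b-1)!\\&\times(2m-r-2a+2b)!\,(2n-r+2a-2b)!\,(2m+2n-r-2a-2b-1)!,\\ \mathcal N_2={}&j!\,(m-i)!\,(m-j)!\,(m+n-j+1)!\,(m+n-r+i-j)!\,(m+n-r-i+j)!\\&\times(2m+2n-r-i-j+1)!\,(2m-4a-2)!\,(2n-4b-2)!,\end{aligned}$$ $\Lambda$ is the set of integer triples $(x,y,z)$ with $$\begin{aligned}&0\le x\le\min(n-2b-1,\,n-j),\\&\max(0,\,n-r+2a+1-x)\le y\le\min(2a+1,\,2n-r+2a-2b),\\&\max(0,\,r-m-i-x)\le z\le\min(n-i,\,r-i-j,\,n-i+2a+1-y),\end{aligned}$$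 and $$\begin{aligned}\mathbb T_1={}&(n-x)!\,(m-j+x)!\,(n-2b-1+x)!\,(m-2a-1+y)!\,(r-2a-2b-2+y)!\\&\times(m+n-2i-z)!\,(m+n-r+i-j+z)!\,(n-i+2a+1-y-z)!,\\ \mathbb T_2={}&x!\,y!\,z!\,(n-j-x)!\,(n-2b-1-x)!\,(2a+1-y)!\,(2m-4a-1+y)!\\&\times(2n-r+2a-2b-y)!\,(n-i-z)!\,(r-i-j-z)!\,(m+n-i+1-z)!\\&\times(m-r+i+x+z)!\,(-n+r-2a-1+x+y)!.\end{aligned}$$ Consequently, setting $\vartheta^{(p)}_{i,j}=2\kappa^{(p)}_{i,j}$ if $i\ne j$ and $\vartheta^{(p)}_{i,i}=\kappa^{(p)}_{i,i}$, for every $p\in\Pi(m,n;r)$ one has the syzygy $$\sum_{\substack{0\le i\le j\\ i+j\le r}}\vartheta^{(p)}_{i,j}\,(\mathfrak u_i,\mathfrak u_j)_{r-i-j}=0,$$ and moreover $\vartheta^{(0,0)}_{0,r}\neq0$.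
   Context: $\Bbbk$ is a field of characteristic zero; $S_d$ is the space of binary forms of order $d$, with its $SL_2$-action. $\mathbf N=\{0,1,2,\dots\}$. Transvectants: for binary forms $F,G$ of orders $p,q$ in $z_1,z_2$ and $0\le k\le\min(p,q)$, $$(F,G)_k=\frac{(p-k)!(q-k)!}{p!\,q!}\sum_{l=0}^k(-1)^l\binom kl\frac{\partial^kF}{\partial z_1^{k-l}\partial z_2^l}\frac{\partial^kG}{\partial z_1^l\partial z_2^{k-l}}.$$ ''Generic'' forms have independent indeterminate coefficients. Notation: bold letters $\mathbf x,\mathbf y,\mathbf z,\mathbf p,\mathbf q,\mathbf u,\mathbf v$ are pairs of variables, e.g. $\mathbf x=(x_1,x_2)$; $(\mathbf x\,\mathbf y)=x_1y_2-x_2y_1$; $\mathbf y\partial_{\mathbf x}=y_1\frac{\partial}{\partial x_1}+y_2\frac{\partial}{\partial x_2}$; $\Omega_{\mathbf x\mathbf y}=\frac{\partial^2}{\partial x_1\partial y_2}-\frac{\partial^2}{\partial x_2\partial y_1}$; and $\mathsf h(k,l;s)=\dfrac{(k+l-2s+1)!}{(k+l-s+1)!\,s!}$. Definition of $\xi^{(a,b)}_{i,j}:S_{2(m+n-r)}\to S_{2(m+n-r)}$. Starting with a form $f(\mathbf z)$ of order $2(m+n-r)$, apply successively: (1) $f\mapsto g(\mathbf x,\mathbf y)=\dfrac{(\mathbf x\,\mathbf y)^{r-2a-2b-2}}{(2m+2n-2r)!}(\mathbf x\partial_{\mathbf z})^{2m-2a+2b-r}(\mathbf y\partial_{\mathbf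 z})^{2n+2a-2b-r}f(\mathbf z)$; (2) $g\mapsto h(\mathbf p,\mathbf q,\mathbf u,\mathbf v)=\dfrac{(\mathbf p\,\mathbf q)^{2a}(\mathbf u\,\mathbf v)^{2b}}{(2m-4a-2)!\,(2n-4b-2)!}(\mathbf p\partial_{\mathbf x})^{m-2a-1}(\mathbf q\partial_{\mathbf x})^{m-2a-1}(\mathbf u\partial_{\mathbf y})^{n-2b-1}(\mathbf v\partial_{\mathbf y})^{n-2b-1}g$; (3) $h\mapsto P=(\mathbf p\,\mathbf q)(\mathbf u\,\mathbf v)\,h$; (4) $P\mapsto R(\mathbf x,\mathbf y)=\mathsf h(m,n;i)\,\mathsf h(m,n;j)\,[\Omega_{\mathbf p\mathbf u}^i\,\Omega_{\mathbf q\mathbf v}^j\,P]$ followed by the substitutions $\mathbf p,\mathbf u\to\mathbf x$ and $\mathbf q,\mathbf v\to\mathbf y$; (5) $R\mapsto\mathsf h(m+n-2i,m+n-2j;r-i-j)\,[\Omega_{\mathbf x\mathbf y}^{r-i-j}R(\mathbf x,\mathbf y)]_{\mathbf x,\mathbf y\to\mathbf z}$. This is an $SL_2$-equivariant endomorphism of the irreducible representation $S_{2(m+n-r)}$, hence multiplication by a scalar. *)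

(* Defs.v *)
From mathcomp Require Import all_boot all_order all_algebra.
From mathcomp Require Import mpoly.

Set Implicit Arguments.
Unset Strict Implicit.
Unset Printing Implicit Defensive.

Import GRing.Theory.
Local Open Scope ring_scope.

(* A binary form of order d over R is an element of {mpoly R[2]} satisfying
   the predicate d.-homog; the two variables are 'X_z1 and 'X_z2. *)
Definition z1 : 'I_2 := @Ordinal 2 0 isT.
Definition z2 : 'I_2 := @Ordinal 2 1 isT.

(* (F, G)_s for forms F, G of orders p, q with coefficients in a commutative
   k-algebra R; meaningful for s <= minn p q. *)
Definition transvectant (k : fieldType) (R : comAlgType k) (p q s : nat)
    (F G : {mpoly R[2]}) : {mpoly R[2]} :=
  ((((p - s)`! * (q - s)`!)%:R / (p`! * q`!)%:R : k)%:A : R) *: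
  \sum_(l < s.+1)
    ((-1) ^+ l * 'C(s, l)%:R : R) *:
      (F^`M(z1, (s - l)%N)^`M(z2, l) * G^`M(z1, l)^`M(z2, (s - l)%N)).

(* The m.+1 coefficients of A and the n.+1 coefficients of B are the
   distinct indeterminates of the ring below. *)
Definition coefRing (k : fieldType) (m n : nat) := {mpoly k[m.+1 + n.+1]}.

Definition genericA (k : fieldType) (m n : nat) : {mpoly (coefRing k m n)[2]} :=
  \sum_(i < m.+1)
    ('X_(lshift n.+1 i) : coefRing k m n) *: ('X_z1 ^+ (m - i) * 'X_z2 ^+ i).

Definition genericB (k : fieldType) (m n : nat) : {mpoly (coefRing k m n)[2]} :=
  \sum_(i < n.+1)
    ('X_(rshift m.+1 i) : coefRing k m n) *: ('X_z1 ^+ (n - i) * 'X_z2 ^+ i).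

Definition genericTransvectant (k : fieldType) (m n i : nat) :
    {mpoly (coefRing k m n)[2]} :=
  transvectant m n i (genericA k m n) (genericB k m n).

(* The seven pairs of variables x, y, z, p, q, u, v all live in the single ring
   {mpoly k[14]}, where they occupy consecutive positions in this order. *)
Definition varPair := ('I_14 * 'I_14)%type.
Definition vx : varPair := (@Ordinal 14 0 isT, @Ordinal 14 1 isT).
Definition vy : varPair := (@Ordinal 14 2 isT, @Ordinal 14 3 isT).
Definition vz : varPair := (@Ordinal 14 4 isT, @Ordinal 14 5 isT).
Definition vp : varPair := (@Ordinal 14 6 isT, @Ordinal 14 7 isT).
Definition vq : varPair := (@Ordinal 14 8 isT, @Ordinal 14 9 isT).
Definition vu : varPair := (@Ordinal 14 10 isT, @Ordinal 14 11 isT).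
Definition vv : varPair := (@Ordinal 14 12 isT, @Ordinal 14 13 isT).

Section Operators.
Variable k : fieldType.
Implicit Types (f g : {mpoly k[14]}) (s t : varPair).

(* (s t) = s_1 t_2 - s_2 t_1 *)
Definition bracket s t : {mpoly k[14]} :=
  'X_(s.1) * 'X_(t.2) - 'X_(s.2) * 'X_(t.1).

(* t d_s = t_1 d/ds_1 + t_2 d/ds_2 *)
Definition polarize t s f : {mpoly k[14]} :=
  'X_(t.1) * f^`M(s.1) + 'X_(t.2) * f^`M(s.2).

(* Omega_{s t} = d^2/(ds_1 dt_2) - d^2/(ds_2 dt_1) *)
Definition Omega s t f : {mpoly k[14]} :=
  f^`M(s.1)^`M(t.2) - f^`M(s.2)^`M(t.1).

Definition hcoef (p q s : nat) : k :=
  (p + q - 2 * s + 1)`!%:R / ((p + q - s + 1)`! * s`!)%:R.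

Definition toZ (f : {mpoly k[2]}) : {mpoly k[14]} :=
  f \mPo [tuple 'X_(vz.1); 'X_(vz.2)].

(* p, u -> x and q, v -> y *)
Definition substXY (f : {mpoly k[14]}) : {mpoly k[14]} :=
  f \mPo [tuple 'X_(vx.1); 'X_(vx.2); 'X_(vy.1); 'X_(vy.2); 'X_(vz.1); 'X_(vz.2);
                'X_(vx.1); 'X_(vx.2); 'X_(vy.1); 'X_(vy.2);
                'X_(vx.1); 'X_(vx.2); 'X_(vy.1); 'X_(vy.2)].

(* x, y -> z, landing back in binary forms; it is only applied to polynomials
   in x and y, so the images of the other pairs are immaterial. *)
Definition substZ (f : {mpoly k[14]}) : {mpoly k[2]} :=
  f \mPo [tuple 'X_z1; 'X_z2; 'X_z1; 'X_z2; 'X_z1; 'X_z2; 'X_z1; 'X_z2;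
                'X_z1; 'X_z2; 'X_z1; 'X_z2; 'X_z1; 'X_z2].

Definition xiStep1 (m n r a b : nat) (f : {mpoly k[2]}) : {mpoly k[14]} :=
  ((2 * m + 2 * n - 2 * r)`!%:R : k)^-1 *:
    (bracket vx vy ^+ (r - 2 * a - 2 * b - 2) *
     iter (2 * m - 2 * a + 2 * b - r) (polarize vx vz)
       (iter (2 * n + 2 * a - 2 * b - r) (polarize vy vz) (toZ f))).

Definition xiStep2 (m n a b : nat) (g : {mpoly k[14]}) : {mpoly k[14]} :=
  (((2 * m - 4 * a - 2)`! * (2 * n - 4 * b - 2)`!)%:R : k)^-1 *:
    (bracket vp vq ^+ (2 * a) * bracket vu vv ^+ (2 * b) *
     iter (m - 2 * a - 1) (polarize vp vx)
       (iter (m - 2 * a - 1) (polarize vq vx)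
         (iter (n - 2 * b - 1) (polarize vu vy)
           (iter (n - 2 * b - 1) (polarize vv vy) g)))).

Definition xiStep3 (h : {mpoly k[14]}) : {mpoly k[14]} :=
  bracket vp vq * bracket vu vv * h.

Definition xiStep4 (m n i j : nat) (P : {mpoly k[14]}) : {mpoly k[14]} :=
  (hcoef m n i * hcoef m n j) *:
    substXY (iter i (Omega vp vu) (iter j (Omega vq vv) P)).

Definition xiStep5 (m n r i j : nat) (Q : {mpoly k[14]}) : {mpoly k[2]} :=
  hcoef (m + n - 2 * i) (m + n - 2 * j) (r - i - j) *:
    substZ (iter (r - i - j) (Omega vx vy) Q).

Definition xi (m n r a b i j : nat) (f : {mpoly k[2]}) : {mpoly k[2]} :=
  xiStep5 m n r i j
    (xiStep4 m n i j (xiStep3 (xiStep2 m n a b (xiStep1 m n r a b f)))).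

Definition actsByScalar (d : nat) (phi : {mpoly k[2]} -> {mpoly k[2]})
    (c : k) : Prop :=
  forall f : {mpoly k[2]}, f \is d.-homog -> phi f = c *: f.

End Operators.

Definition inPi (r a b : nat) : bool := (2 * (a + b + 1) <= r)%N.

(* All subtractions below are in nat.  For 2 <= r <= minn m n, inPi r a b,
   i + j <= r and (x, y, z) in the range of the sum, every argument of a
   factorial and every upper bound is a nonnegative integer, so no truncation
   takes place there; in the lower bounds of y and z, truncation at 0 is
   precisely the max(0, -) of the definition of Lambda. *)
Section ClosedForm.
Variable k : fieldType.
Variables m n r a b i j : nat.
Local Open Scope nat_scope.

Definition N1 : nat :=
  (m + n - 2 * i + 1)`! * (m + n - 2 * j + 1)`! * (2 * m - 2 * a)`!
  * (2 * a + 1)`! * (m - 2 * a - 1)`! * (n - 2 * b - 1)`!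
  * (2 * m - r - 2 * a + 2 * b)`! * (2 * n - r + 2 * a - 2 * b)`!
  * (2 * m + 2 * n - r - 2 * a - 2 * b - 1)`!.

Definition N2 : nat :=
  j`! * (m - i)`! * (m - j)`! * (m + n - j + 1)`! * (m + n - r + i - j)`!
  * (m + n - r - i + j)`! * (2 * m + 2 * n - r - i - j + 1)`!
  * (2 * m - 4 * a - 2)`! * (2 * n - 4 * b - 2)`!.

Definition T1 (x y z : nat) : nat :=
  (n - x)`! * (m - j + x)`! * (n - 2 * b - 1 + x)`! * (m - 2 * a - 1 + y)`!
  * (r - 2 * a - 2 * b - 2 + y)`! * (m + n - 2 * i - z)`!
  * (m + n - r + i - j + z)`! * (n - i + 2 * a + 1 - y - z)`!.

(* The last factor is (-n + r - 2a - 1 + x + y)!, reordered for nat. *)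
Definition T2 (x y z : nat) : nat :=
  x`! * y`! * z`! * (n - j - x)`! * (n - 2 * b - 1 - x)`! * (2 * a + 1 - y)`!
  * (2 * m - 4 * a - 1 + y)`! * (2 * n - r + 2 * a - 2 * b - y)`!
  * (n - i - z)`! * (r - i - j - z)`! * (m + n - i + 1 - z)`!
  * (m - r + i + x + z)`! * (r + x + y - n - 2 * a - 1)`!.

Definition Gamma : k :=
  ((-1) ^+ (n - j) *
   \sum_(0 <= x < (minn (n - 2 * b - 1) (n - j)).+1)
   \sum_(n - r + 2 * a + 1 - x <= y <
           (minn (2 * a + 1) (2 * n - r + 2 * a - 2 * b)).+1)
   \sum_(r - m - i - x <= z <
           (minn (minn (n - i) (r - i - j)) (n - i + 2 * a + 1 - y)).+1)
     (-1) ^+ (x + y + z) * ((T1 x y z)%:R / (T2 x y z)%:R))%R.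

Definition kappaFormula : k := (N1%:R / N2%:R * Gamma)%R.

End ClosedForm.

Definition theta (k : fieldType) (kappa : nat -> nat -> nat -> nat -> k)
    (a b i j : nat) : k :=
  if i == j then kappa a b i j else 2 * kappa a b i j.

(* Main.v *)
Require Import Defs.
From mathcomp Require Import all_boot all_order all_algebra.
From mathcomp Require Import ssrcomplements mpoly.
From mathcomp Require Import ring zify.
Set Implicit Arguments.
Unset Strict Implicit.
Unset Printing Implicit Defensive.
Import GRing.Theory.
Local Open Scope ring_scope.

(** Equip k[x,y,z,p,q,u,v] with the apolar form [fp], for which multiplication
    by (s t) is adjoint to Omega_st and t d_s is adjoint to s d_t.  Up to
    constants, xi is a composition proj o iota2 o iota1 of such operators, so by
    Schur's lemma kappa is read off from the lowest weight vector z_2^D,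
    D = 2(m+n-r): it is the pairing of projd(z_2^D), the adjoint image, with
    iota2(iota1(z_2^D)).  Expanding (x y)^(r-2a-2b-2), sl_2-invariance makes the
    terms proportional to each other, and the first one is a double sum of
    products of three transvectants of monomials ([ninej_sum]).  Taking monomials
    adapted to a Moebius map turns it into the triple sum Gamma.

    For the syzygies, the Capelli identity yields the Clebsch-Gordan expansion of
    iota2(iota1(f)) as a combination of the projd_ij(f), i + j <= r, whose
    coefficients are the kappa_ij up to normalization.  Pair it with
    A(p)A(q)B(u)B(v): the left side vanishes because (p q)^(2a+1) is
    antisymmetric, and on the right proj_ij of this product is
    ((A,B)_i,(A,B)_j)_(r-i-j). *)

(** * Sums of transvectants of monomials *)

(** Pairing the coupling scheme ((m m)(n n)) with ((m n)(m n)) gives, up to normalization, a 9j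
    symbol: a sum over products of six coupling coefficients. At lowest weight three of the six
    vertices degenerate to binomial coefficients; the other three are transvectants of monomials,
    each a single sum, so a fivefold sum is left. Two of the outer summations disappear because a
    transvectant of monomials has several expressions: written as [trv_e], two of the three
    transvectants merge their dependence on the outer indices into one product of falling
    factorials. The outer sums and the third transvectant, in Rankin-Cohen form, are then a
    generating function that collapses to a single sum.

    The closed formula shows no symmetry in i and j. The sign (-1)^(r-i-j) under their exchange,
    which accounts for the factor 2 in theta, is read off from the double sum instead.

    In the Clebsch-Gordan expansion only i + j <= r occurs: a component with another total index
    would be a lowest weight vector of the wrong weight. The pairing arguments work over a field of
    characteristic zero, so generic forms are treated over the fraction field of their coefficient
    ring. *)

Section Factorials.
Variable k : fieldType.
Hypothesis k_char0 : [pchar k] =i pred0.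

Lemma natf0 n : (n%:R == 0 :> k) = (n == 0)%N.
Proof. exact: ((pcharf0P k).1 k_char0 n). Qed.

Lemma factf_neq0 n : (n`!)%:R != 0 :> k.
Proof. by rewrite natf0 -lt0n fact_gt0. Qed.

Lemma ffact_split n a b : (n ^_ (a + b) = n ^_ a * (n - a) ^_ b)%N.
Proof.
elim: a n => [|a IH] n; first by rewrite ffactn0 mul1n subn0.
case: n => [|n]; first by rewrite addSn ffact0n /= ffact0n.
by rewrite addSn !ffactSS IH mulnA subSS.
Qed.

Lemma coef_signM (R : nzRingType) n (p : {poly R}) i :
  ((-1) ^+ n * p)`_i = (-1) ^+ n * p`_i.
Proof.
by rewrite -!(signr_odd _ n); case: (odd n); rewrite ?expr0 ?expr1 ?mul1r ?mulN1r ?coefN.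
Qed.

(** Binomial inversion: compare the coefficients of X^q in (1 - (1 + X))^h = (-X)^h. *)
Lemma sum_alt_bin_bin (R : comNzRingType) h q :
  \sum_(g < h.+1) (-1) ^+ g * ('C(h, g) * 'C(g, q))%:R = (-1) ^+ h * (h == q)%:R :> R.
Proof.
have E : \sum_(g < h.+1) (- (1 + 'X) : {poly R}) ^+ g *+ 'C(h, g) = (- 'X) ^+ h.
  have -> : - 'X = 1 + - (1 + 'X) :> {poly R} by rewrite opprD addNKr.
  by rewrite exprDn; apply: eq_bigr => g _; rewrite expr1n mul1r.
have := congr1 (fun p : {poly R} => p`_q) E; rewrite /= coef_sum.
have -> : ((- 'X) ^+ h : {poly R})`_q = (-1) ^+ h * (h == q)%:R.
  by rewrite [(- 'X) ^+ h]exprNn coef_signM coefXn eq_sym.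
move=> <-; apply: eq_bigr => g _.
rewrite coefMn [(- (1 + 'X)) ^+ g]exprNn coef_signM [1 + 'X]addrC.
have -> : ('X + 1 : {poly R}) ^+ g = \sum_(i < g.+1) 'X^i *+ 'C(g, i).
  rewrite addrC exprDn; apply: eq_bigr => i _.
  by rewrite expr1n mul1r.
rewrite coef_sum.
have -> : \sum_(i < g.+1) ('X^i *+ 'C(g, i) : {poly R})`_q = ('C(g, q))%:R.
  rewrite (eq_bigr (fun i : 'I_g.+1 => (if (i : nat) == q then 'C(g, i)%:R else 0 : R))); last first.
    by move=> i _; rewrite coefMn coefXn eq_sym; case: eqP; rewrite // mul0rn.
  rewrite -big_mkcond /=; case: (ltnP q g.+1) => hq.
    by rewrite (big_pred1 (Ordinal hq)) // => i; rewrite -val_eqE.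
  rewrite big1 ?bin_small // => i /eqP e; move: (ltn_ord i); rewrite e; lia.
by rewrite -mulrnAr -mulrnA mulnC.
Qed.

(** Chu-Vandermonde with a negative argument, the factor (A-n)! absorbing the quotients
    (A-j)!/(A-n)!. It trades a falling factorial of A - a for those of a. The induction on n is
    Pascal's rule. *)
Lemma ffact_sub_expand n A a : (n <= A)%N -> (a <= A)%N ->
  ((A - a) ^_ n * (A - n)`!)%:R
  = \sum_(j < n.+1) (-1) ^+ j * ('C(n, j) * (a ^_ j * (A - j)`!))%:R :> k.
Proof.
elim: n A a => [|n IH] A a nA aA.
  by rewrite big_ord1 /= subn0 bin0 !mul1n expr0 mul1r.
rewrite big_ord_recl /= expr0 mul1r bin0 mul1n ffactn0 mul1n subn0.
under eq_bigr => j _ do rewrite /bump /= add1n binS mulnDl natrD mulrDr.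
rewrite big_split /= addrA.
have -> : A`!%:R + \sum_(j < n.+1) (-1) ^+ j.+1 * ('C(n, j.+1) * (a ^_ j.+1 * (A - j.+1)`!))%:R
   = \sum_(j < n.+1) (-1) ^+ j * ('C(n, j) * (a ^_ j * (A - j)`!))%:R :> k.
  rewrite [RHS]big_ord_recl big_ord_recr /= expr0 mul1r bin0 mul1n ffactn0 mul1n subn0.
  by rewrite (bin_small (ltnSn n)) mul0n mulr0 addr0.
rewrite -IH; [|lia|lia].
case: a aA => [|a] aA.
  rewrite big1 ?addr0; last by move=> j _; rewrite ffact0n /= mul0n muln0 mulr0.
  congr (_%:R); rewrite subn0 ffactnSr -mulnA; congr (_ * _)%N.
  by rewrite subnS -[in RHS](prednK (_ : 0 < A - n)%N) ?factS ?prednK; lia.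
case: A nA aA => [//|A] nA aA.
under eq_bigr => j _ do
  rewrite exprS mulN1r mulNr ffactSS subSS mulnA mulnCA -mulnA natrM mulrCA -mulrN mulrN.
rewrite sumrN -mulr_sumr.
have -> : \sum_(i < n.+1) (-1) ^+ i * ('C(n, i) * a ^_ i * (A - i)`!)%:R
    = ((A - a) ^_ n * (A - n)`!)%:R :> k.
  by rewrite IH; [apply: eq_bigr => j _; rewrite mulnA| lia | lia].
rewrite subSS; have [hn|hn] := leqP n (A - a); last first.
  by rewrite !ffact_small ?mul0n ?mulr0 ?subr0 //; lia.
have e : (A.+1 - n = (A - n).+1)%N by lia.
rewrite -natrM -natrB; last first.
  by rewrite mulnCA leq_mul2l e factS leq_mul2r; apply/orP; right; apply/orP; right; lia.
congr (_%:R); rewrite ffactnSr ?subSS e factS [(a.+1 * _)%N]mulnCA -mulnA -mulnBr.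
by rewrite -mulnBl; congr (_ * (_ * _))%N; lia.
Qed.

(* Monomial form of the transvectant: the coefficient produced by applying the
   transvectant of index q to x_1^a x_2^(A-a) and x_1^b x_2^(B-b), up to sign. *)
Definition trv q A B a b : k :=
  \sum_(g < q.+1) (-1) ^+ g *
    ('C(q, g) * ((a ^_ g * (A - a) ^_ (q - g)) * (b ^_ (q - g) * (B - b) ^_ g)))%:R.

(* Rankin-Cohen form. *)
Definition trv_rc q A B a b : k :=
  \sum_(h < q.+1) (-1) ^+ h *
    ('C(q, h) * (((A - h)`! * (B - q + h)`!) * (a ^_ h * b ^_ (q - h))))%:R.

(** A third form of the same coefficient, up to normalization. Here b enters only through a + b, so
    two such factors can be merged when their falling factorials follow one another. *)
Definition trv_e q A B a b : k :=
  \sum_(g < q.+1) (-1) ^+ g * ('C(q, g) * (a ^_ g * (a + b - g) ^_ (q - g)))%:R *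
    ((A - g)`!%:R / (A + B - q + 1 - g)`!%:R).

Lemma bin_trinomial q g h : (g <= h)%N -> (h <= q)%N ->
  ('C(q, g) * 'C(q - g, h - g) = 'C(q, h) * 'C(h, g))%N.
Proof.
move=> gh hq; apply/eqP.
have p : (0 < g`! * (h - g)`! * (q - h)`!)%N by rewrite !muln_gt0 !fact_gt0.
rewrite -(eqn_pmul2r p); apply/eqP.
have e1 := bin_fact (leq_trans gh hq); have e2 := bin_fact (leq_sub2r g hq).
have e3 := bin_fact hq; have e4 := bin_fact gh.
have e : (q - g - (h - g) = q - h)%N by lia.
rewrite e in e2.
transitivity (q`!); [rewrite -e1 -e2 | rewrite -e3 -e4]; ring.
Qed.

(** Eliminating A - a leaves g only in a sign and in C(h,g), which prepares the sum over g in [trv]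
    for binomial inversion. [ffact_expand_right] treats the other pair of falling factorials in the
    same way. *)
Lemma ffact_expand_left q A a g : (g <= q)%N -> (q <= A)%N -> (a <= A)%N ->
  ('C(q, g) * (a ^_ g * (A - a) ^_ (q - g)) * (A - q)`!)%:R
  = \sum_(h < q.+1) (-1) ^+ (h + g) * ('C(q, h) * 'C(h, g) * (a ^_ h * (A - h)`!))%:R :> k.
Proof.
move=> gq qA aA.
have [ga|ag] := leqP g a; last first.
  rewrite ffact_small // mul0n muln0 mul0n big1 // => h _.
  have [hg|gh] := ltnP h g; first by rewrite (bin_small hg) muln0 mul0n mulr0.
  by rewrite ffact_small ?mul0n ?muln0 ?mulr0 //; lia.
have := @ffact_sub_expand (q - g) (A - g) (a - g).
have -> : (A - g - (a - g) = A - a)%N by lia.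
have -> : (A - g - (q - g) = A - q)%N by lia.
move=> E; rewrite mulnA -mulnA natrM E; [|lia|lia].
rewrite mulr_sumr -[RHS](big_mkord xpredT
  (fun h => (-1) ^+ (h + g) * ('C(q, h) * 'C(h, g) * (a ^_ h * (A - h)`!))%:R)).
rewrite (big_cat_nat _ (n := g)) //=; last lia.
rewrite [X in _ = X + _]big_nat [X in _ = X + _]big1 ?add0r; last first.
  by move=> h hg /=; rewrite (bin_small (_ : h < g)%N) ?muln0 ?mul0n ?mulr0 //; lia.
rewrite -[X in _ = X]/(\sum_(0 + g <= h < q.+1) _) big_addn subSn // big_mkord; apply: eq_bigr => j _.
rewrite -addnA exprD addnn -muln2 exprM sqrr_sign.
have jq := ltn_ord j.
have -> : (A - g - j = A - (j + g))%N by lia.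
rewrite -(@bin_trinomial q g (j + g)); [|lia|lia].
by rewrite addnK [(j + g)%N]addnC ffact_split !natrM; ring.
Qed.

Lemma ffact_expand_right q B b g : (g <= q)%N -> (q <= B)%N -> (b <= B)%N ->
  (b ^_ (q - g) * (B - b) ^_ g * (B - q)`!)%:R
  = \sum_(h < q.+1) (-1) ^+ (h + g) * ('C(g, h) * (b ^_ (q - h) * (B - q + h)`!))%:R :> k.
Proof.
move=> gq qB bB.
have [gb|bg] := leqP (q - g) b; last first.
  rewrite ffact_small // !mul0n big1 // => h _.
  have [hg|gh] := ltnP g h; first by rewrite (bin_small hg) mul0n mulr0.
  by rewrite ffact_small ?mul0n ?muln0 ?mulr0 //; lia.
have := @ffact_sub_expand g (B - (q - g)) (b - (q - g)).
have -> : (B - (q - g) - (b - (q - g)) = B - b)%N by lia.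
have -> : (B - (q - g) - g = B - q)%N by lia.
move=> E; rewrite -mulnA natrM E; [|lia|lia].
rewrite mulr_sumr -[RHS](big_mkord xpredT
  (fun h => (-1) ^+ (h + g) * ('C(g, h) * (b ^_ (q - h) * (B - q + h)`!))%:R)).
rewrite (big_cat_nat _ (n := g.+1)) //=.
rewrite [X in _ = _ + X]big_nat [X in _ = _ + X]big1 ?addr0; last first.
  by move=> h hg /=; rewrite (bin_small (_ : g < h)%N) ?mul0n ?mulr0 //; lia.
rewrite big_mkord (reindex_inj rev_ord_inj) /=; apply: eq_bigr => j _.
have jg := ltn_ord j; rewrite subSS.
have -> : (-1) ^+ (j + g) = (-1) ^+ (g - j) :> k.
  by rewrite -signr_odd -[RHS]signr_odd oddB ?oddD 1?addbC //; lia.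
rewrite bin_sub; last lia.
have -> : (B - (q - g) - (g - j) = B - q + j)%N by lia.
have -> : (q - j = (q - g) + (g - j))%N by lia.
by rewrite ffact_split !natrM; ring.
Qed.

(** Once both pairs of falling factorials are expanded, g occurs only in (-1)^g C(h,g) C(g,h');
    summing over g forces h = h'. *)
Lemma trv_rcE q A B a b : (q <= A)%N -> (q <= B)%N -> (a <= A)%N -> (b <= B)%N ->
  trv q A B a b * ((A - q)`! * (B - q)`!)%:R = trv_rc q A B a b.
Proof.
move=> qA qB aA bB; rewrite /trv mulr_suml.
transitivity (\sum_(g < q.+1) \sum_(h < q.+1) \sum_(h' < q.+1)
   ((-1) ^+ g * ('C(h, g) * 'C(g, h'))%:R) * ((-1) ^+ (h + h') *
     ('C(q, h) * ((a ^_ h * (A - h)`!) * (b ^_ (q - h') * (B - q + h')`!)))%:R) : k).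
  apply: eq_bigr => g _.
  transitivity ((-1) ^+ g * ('C(q, g) * (a ^_ g * (A - a) ^_ (q - g)) * (A - q)`!)%:R *
     (b ^_ (q - g) * (B - b) ^_ g * (B - q)`!)%:R : k).
    by rewrite !natrM; ring.
  have gq : (g <= q)%N by rewrite -ltnS.
  rewrite ffact_expand_left // ffact_expand_right // [X in X * _]mulr_sumr mulr_suml.
  apply: eq_bigr => h _; rewrite mulr_sumr; apply: eq_bigr => h' _.
  have -> : (-1) ^+ (h + h') = (-1) ^+ (h + g) * (-1) ^+ (h' + g) :> k.
    by rewrite -exprD addnACA [RHS]exprD -[(-1) ^+ (g + g)]signr_odd oddD addbb mulr1.
  by rewrite !natrM; ring.
rewrite exchange_big; apply: eq_bigr => h _ /=.
rewrite exchange_big /=.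
have G (h' : nat) (c : k) : (h <= q)%N ->
    \sum_(g < q.+1) (-1) ^+ g * ('C(h, g) * 'C(g, h'))%:R * c = (-1) ^+ h * (h == h' :> nat)%:R * c :> k.
  move=> hq; rewrite -mulr_suml -sum_alt_bin_bin; congr (_ * _).
  rewrite [RHS](big_ord_widen_cond q.+1 xpredT (fun g => (-1) ^+ g * ('C(h, g) * 'C(g, h'))%:R)) //.
  rewrite [LHS](bigID (fun i : 'I_q.+1 => (i < h.+1)%N)) /= [X in _ + X]big1 ?addr0 //.
  by move=> i; rewrite -leqNgt => hi; rewrite (bin_small hi) mul0n mulr0.
have hq : (h <= q)%N by rewrite -ltnS.
under eq_bigr => h' _ do rewrite G //.
rewrite (bigD1 h) //= [X in _ + X]big1 ?addr0; last first.
  by move=> h'; rewrite -val_eqE /= eq_sym => /negbTE->; rewrite mulr0 mul0r.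
rewrite eqxx mulr1 -[(-1) ^+ (h + h)]signr_odd oddD addbb mul1r; congr (_ * _%:R).
by ring.
Qed.

(** An h-th finite difference of (A-g)!/(N-g)!, that is, a terminating Chu-Vandermonde sum; Pascal's
    rule reduces it to two differences of the preceding order. *)
Lemma sum_alt_bin_fact_ratio h A N : (h <= A)%N -> (A < N)%N ->
  \sum_(g < h.+1) (-1) ^+ g * 'C(h, g)%:R * ((A - g)`!%:R / (N - g)`!%:R)
  = (-1) ^+ h * ((A - h)`! * (N - A + h - 1)`!)%:R / ((N - A - 1)`! * N`!)%:R :> k.
Proof.
elim: h A N => [|h IH] A N hA AN.
  rewrite big_ord1 /= !subn0 addn0 bin0 expr0 !mul1r !natrM.
  by field; rewrite !factf_neq0.
case: A hA AN => [//|A] hA; case: N => [//|N] AN.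
rewrite big_ord_recl /= expr0 mul1r bin0 mul1r !subn0.
under eq_bigr => j _ do rewrite /bump /= add1n binS natrD mulrDr mulrDl !subSS.
rewrite big_split /= addrA.
have -> : A.+1`!%:R / N.+1`!%:R + \sum_(i < h.+1) (-1) ^+ i.+1 * 'C(h, i.+1)%:R *
        ((A - i)`!%:R / (N - i)`!%:R)
   = \sum_(g < h.+1) (-1) ^+ g * 'C(h, g)%:R * ((A.+1 - g)`!%:R / (N.+1 - g)`!%:R) :> k.
  rewrite [RHS]big_ord_recl big_ord_recr /= expr0 bin0 !mul1r !subn0.
  by rewrite (bin_small (ltnSn h)) mulr0 mul0r addr0.
rewrite IH; [|lia|lia].
under eq_bigr => j _ do rewrite exprS mulN1r !mulNr.
rewrite sumrN IH; [|lia|lia].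
have -> : (A.+1 - h = (A - h).+1)%N by lia.
have -> : (N.+1 - A.+1 + h.+1 - 1 = (N - A + h - 1).+1)%N by lia.
rewrite !subSS !factS exprS mulN1r !natrM.
have e : (A - h).+1%:R = (N.+1)%:R - ((N - A + h - 1).+1)%:R :> k.
  by rewrite -natrB; [congr (_%:R)|]; lia.
rewrite e; field.
by rewrite nat1r !natf0 -!lt0n !fact_gt0.
Qed.

Lemma ffactD x y n :
  ((x + y) ^_ n = \sum_(j < n.+1) 'C(n, j) * (x ^_ j * y ^_ (n - j)))%N.
Proof.
rewrite -bin_ffact -binomial.Vandermonde mulnC big_distrr /=; apply: eq_bigr => j _.
have jn : (j <= n)%N by rewrite -ltnS.
by rewrite -(bin_fact jn) -!bin_ffact; ring.
Qed.

(** Vandermonde splits the falling factorial of a + b - g, which turns [trv_e] into a double sum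
    over g and h; the sum over g is then the finite difference [sum_alt_bin_fact_ratio]. *)
Lemma trv_rc_e q A B a b : (q <= A)%N -> (q <= B)%N ->
  trv_rc q A B a b = ((B - q)`! * (A + B - q + 1)`!)%:R * trv_e q A B a b.
Proof.
move=> qA qB; rewrite /trv_e.
transitivity (((B - q)`! * (A + B - q + 1)`!)%:R * \sum_(g < q.+1) \sum_(h < q.+1)
   ((-1) ^+ g * 'C(h, g)%:R * ((A - g)`!%:R / (A + B - q + 1 - g)`!%:R)) *
     ('C(q, h) * (a ^_ h * b ^_ (q - h)))%:R : k); last first.
  congr (_ * _); apply: eq_bigr => g _.
  have gq : (g <= q)%N by rewrite -ltnS.
  have -> : ('C(q, g) * (a ^_ g * (a + b - g) ^_ (q - g)) =
     \sum_(h < q.+1) 'C(h, g) * ('C(q, h) * (a ^_ h * b ^_ (q - h))))%N.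
    have [ga|ag] := leqP g a; last first.
      rewrite ffact_small // mul0n muln0 big1 // => h _.
      have [hg|gh] := ltnP h g; first by rewrite (bin_small hg) mul0n.
      by rewrite (@ffact_small a) ?mul0n ?muln0 //; lia.
    rewrite [RHS](_ : _ = \sum_(0 <= h < q.+1) 'C(h, g) * ('C(q, h) * (a ^_ h * b ^_ (q - h))))%N;
      last by rewrite big_mkord.
    rewrite (big_cat_nat _ (n := g)) //=; last lia.
    rewrite [X in _ = (X + _)%N]big_nat [X in _ = (X + _)%N]big1 ?add0n; last first.
      by move=> h hg /=; rewrite (bin_small (_ : h < g)%N) //; lia.
    rewrite -[X in _ = X]/(\sum_(0 + g <= h < q.+1) _)%N big_addn subSn // big_mkord.
    have -> : (a + b - g = (a - g) + b)%N by lia.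
    rewrite ffactD mulnCA !big_distrr /=; apply: eq_bigr => j _.
    have jq := ltn_ord j.
    have T : ('C((j + g), g) * 'C(q, (j + g)) = 'C(q, g) * 'C(q - g, j))%N.
      by rewrite mulnC -(@bin_trinomial q g (j + g)) ?addnK //; lia.
    rewrite [RHS]mulnA T.
    rewrite [(j + g)%N]addnC ffact_split.
    have -> : (q - (g + j) = q - g - j)%N by lia.
    by ring.
  rewrite natr_sum [X in _ = X * _]mulr_sumr mulr_suml.
  by apply: eq_bigr => h _; rewrite !natrM; ring.
rewrite exchange_big mulr_sumr; apply: eq_bigr => h _ /=.
have hq : (h <= q)%N by rewrite -ltnS.
rewrite -mulr_suml.
have -> : \sum_(i < q.+1) (-1) ^+ i * 'C(h, i)%:R * ((A - i)`!%:R / (A + B - q + 1 - i)`!%:R)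
   = \sum_(i < h.+1) (-1) ^+ i * 'C(h, i)%:R * ((A - i)`!%:R / (A + B - q + 1 - i)`!%:R) :> k.
  rewrite [RHS](big_ord_widen_cond q.+1 xpredT
    (fun i => (-1) ^+ i * 'C(h, i)%:R * ((A - i)`!%:R / (A + B - q + 1 - i)`!%:R))) //.
  rewrite [LHS](bigID (fun i : 'I_q.+1 => (i < h.+1)%N)) /= [X in _ + X]big1 ?addr0 //.
  by move=> i; rewrite -leqNgt => hi; rewrite (bin_small hi) mulr0 mul0r.
rewrite sum_alt_bin_fact_ratio; [|lia|lia].
have -> : (A + B - q + 1 - A + h - 1 = B - q + h)%N by lia.
have -> : (A + B - q + 1 - A - 1 = B - q)%N by lia.
rewrite !natrM; field.
by rewrite !factf_neq0.
Qed.

Lemma sum_ord_trim (V : nmodType) (F : nat -> V) p q : (p <= q)%N ->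
  (forall f, (p <= f)%N -> F f = 0) -> \sum_(f < q) F f = \sum_(f < p) F f.
Proof.
move=> pq F0; rewrite -!(big_mkord xpredT F) (big_cat_nat _ (n := p)) //=.
by rewrite [X in _ + X]big_nat [X in _ + X]big1 ?addr0 // => i hi; rewrite F0 //; lia.
Qed.

Lemma sum_ord_support (V : nmodType) (F : nat -> V) p q :
  (forall f, (p <= f)%N -> F f = 0) -> (forall f, (q <= f)%N -> F f = 0) ->
  \sum_(f < p) F f = \sum_(f < q) F f.
Proof. by move=> Fp Fq; case/orP: (leq_total p q) => h; rewrite (sum_ord_trim h). Qed.

End Factorials.

(** * Collapsing the outer sums by generating functions *)

Section Mobius.
Variable k : fieldType.
Hypothesis k_char0 : [pchar k] =i pred0.
Variables (Q n q : nat).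
Hypotheses (qQ : (q <= Q)%N) (qn : (q <= n)%N).

Lemma coef_1DXn (R : comNzRingType) m i : ((1 + 'X : {poly R}) ^+ m)`_i = 'C(m, i)%:R.
Proof.
rewrite exprDn coef_sum.
rewrite (eq_bigr (fun l : 'I_m.+1 => (if (l : nat) == i then 'C(m, l)%:R else 0 : R))); last first.
  by move=> l _; rewrite coefMn expr1n mul1r coefXn eq_sym; case: eqP; rewrite // mul0rn.
rewrite -big_mkcond /=; case: (ltnP i m.+1) => hq.
  by rewrite (big_pred1 (Ordinal hq)) // => l; rewrite -val_eqE.
rewrite big1 ?bin_small // => l /eqP e; move: (ltn_ord l); rewrite e; lia.
Qed.

Lemma coef_CBXn (R : comNzRingType) (c : R) m i : (i <= m)%N ->
  ((c%:P - 'X) ^+ m)`_i = (-1) ^+ i * 'C(m, i)%:R * c ^+ (m - i).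
Proof.
move=> im; rewrite exprDn coef_sum (bigD1 (Ordinal (im : (i < m.+1)%N))) //= big1 ?addr0.
  rewrite coefMn -rmorphXn coefCM [(- 'X) ^+ i]exprNn coef_signM coefXn eqxx mulr1.
  by rewrite -mulr_natr; ring.
move=> l; rewrite -val_eqE /= => nl.
by rewrite coefMn -rmorphXn coefCM [(- 'X) ^+ l]exprNn coef_signM coefXn eq_sym (negbTE nl) !mulr0 mul0rn.
Qed.

(* Value at the origin of the transvectant of index q of two univariate
   (dehomogenized) forms of orders Q and n. *)
Definition trv0 (p1 p2 : {poly {poly k}}) : {poly k} :=
  \sum_(x < q.+1) ((-1) ^+ x * ((Q - q + x)`! * (n - x)`!)%:R : k)%:P
     * (p1`_(q - x) * p2`_x).

Lemma trv0_suml (I : finType) (F : I -> {poly {poly k}}) p2 :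
  trv0 (\sum_i F i) p2 = \sum_i trv0 (F i) p2.
Proof.
rewrite exchange_big; apply: eq_bigr => x _ /=.
by rewrite coef_sum mulr_suml mulr_sumr.
Qed.

Lemma trv0_sumr (I : finType) (F : I -> {poly {poly k}}) p1 :
  trv0 p1 (\sum_i F i) = \sum_i trv0 p1 (F i).
Proof.
rewrite exchange_big; apply: eq_bigr => x _ /=.
by rewrite coef_sum !mulr_sumr.
Qed.

Lemma trv0_CM c d p1 p2 : trv0 (c%:P * p1) (d%:P * p2) = c * d * trv0 p1 p2.
Proof.
by rewrite /trv0 mulr_sumr; apply: eq_bigr => x _; rewrite !coefCM; ring.
Qed.

Let piX : {poly {poly k}} := 'X%:P - 'X.

(* The basis adapted to the Moebius map s |-> s/('X - s), which fixes the
   origin: only total weight q survives. *)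
Lemma trv0_mobius e f : (e <= Q)%N -> (f <= n)%N ->
  trv0 ('X^e * piX ^+ (Q - e)) ('X^f * piX ^+ (n - f)) =
  if (e + f == q)%N then ((-1) ^+ f * ((Q - q + f)`! * (n - f)`!)%:R)%:P * 'X ^+ (Q + n - q) else 0.
Proof.
move=> eQ fn.
have cf e' Q' i : (e' <= Q')%N -> (i <= Q')%N -> ('X^e' * piX ^+ (Q' - e'))`_i =
    (if (i < e')%N then 0 else (-1) ^+ (i - e') * 'C(Q' - e', i - e')%:R * 'X ^+ (Q' - i)).
  move=> h1 h2; rewrite coefXnM; case: ltnP => // h3.
  by rewrite coef_CBXn; [congr (_ * 'X ^+ _)|]; lia.
have [efq|qef] := leqP (e + f) q; last first.
  rewrite gtn_eqF // /trv0 big1 // => x _; have xq := ltn_ord x.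
  rewrite !cf //; try lia.
  by case: ltnP => h1; rewrite ?mul0r ?mulr0 //; case: ltnP => h2; rewrite ?mulr0 //; lia.
(* After cancellation of factorials the sum over x = w + f is a multiple of the alternating sum of
   C(d,w), which vanishes unless d = 0. *)
pose d := (q - (e + f))%N.
transitivity (\sum_(w < d.+1) ((-1) ^+ w * 'C(d, w)%:R : k)%:P *
   (((-1) ^+ (f + d) * ((Q - e)`! * (n - f)`!)%:R / d`!%:R)%:P * 'X ^+ (Q + n - q))); last first.
  rewrite -mulr_suml -raddf_sum /=.
  have -> : \sum_(w < d.+1) (-1) ^+ w * 'C(d, w)%:R = (d == 0)%:R :> k.
    have := @sum_alt_bin_bin k d 0; under eq_bigr => w _ do rewrite bin0 muln1.
    by move=> ->; case: (d) => [|d0]; rewrite ?mulr1 ?mulr0.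
  have -> : (d == 0)%N = (e + f == q)%N by apply/eqP/eqP; rewrite /d; lia.
  case: eqP => e1; last by rewrite mul0r.
  have -> : d = 0%N by rewrite /d; lia.
  have -> : (Q - e = Q - q + f)%N by lia.
  by rewrite addn0 fact0 divr1 mul1r.
rewrite /trv0.
rewrite -(big_mkord xpredT (fun x => ((-1) ^+ x * ((Q - q + x)`! * (n - x)`!)%:R : k)%:P *
   (('X^e * piX ^+ (Q - e))`_(q - x) * ('X^f * piX ^+ (n - f))`_x))).
rewrite (big_cat_nat _ (n := f)) //=; last lia.
rewrite [X in X + _]big_nat [X in X + _]big1 ?add0r; last first.
  by move=> x hx /=; rewrite (cf f n); try lia; case: ltnP; rewrite ?mulr0 //; lia.
rewrite (big_cat_nat _ (n := (q - e).+1)) //=; [|lia|lia].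
rewrite [X in _ + X]big_nat [X in _ + X]big1 ?addr0; last first.
  by move=> x hx /=; rewrite (cf e Q); try lia; case: ltnP; rewrite ?mul0r ?mulr0 //; lia.
rewrite -[X in X = _]/(\sum_(0 + f <= x < (q - e).+1) _) big_addn.
have -> : ((q - e).+1 - f = d.+1)%N by rewrite /d; lia.
rewrite big_mkord; apply: eq_bigr => w _.
have wd : (w <= q - (e + f))%N by rewrite -ltnS.
rewrite !cf; try lia.
have -> : (q - (w + f) < e)%N = false by apply/negbTE; lia.
have -> : (w + f < f)%N = false by apply/negbTE; lia.
have -> : (q - (w + f) - e = d - w)%N by rewrite /d; lia.
rewrite addnK.
transitivity ((((-1) ^+ (w + f) * ((Q - q + (w + f))`! * (n - (w + f))`!)%:R *
   ((-1) ^+ (d - w) * 'C(Q - e, d - w)%:R * ((-1) ^+ w * 'C(n - f, w)%:R)))%:P : {poly k})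
   * ('X ^+ (Q - (q - (w + f))) * 'X ^+ (n - (w + f)))).
  by rewrite !polyCM !rmorphXn /= !polyCN !polyC1 !polyC_natr; ring.
rewrite -exprD.
have -> : (Q - (q - (w + f)) + (n - (w + f)) = Q + n - q)%N by lia.
rewrite [RHS]mulrA -polyCM; congr (_%:P * _).
have e1 : ('C(Q - e, d - w) * (Q - q + (w + f))`! * (d - w)`! = (Q - e)`!)%N.
  have := @bin_fact (Q - e) (d - w); have -> : (Q - e - (d - w) = Q - q + (w + f))%N by lia.
  by move=> <-; [ring | lia].
have e2 : ('C(n - f, w) * (n - (w + f))`! * w`! = (n - f)`!)%N.
  have := @bin_fact (n - f) w; have -> : (n - f - w = n - (w + f))%N by lia.
  by move=> <-; [ring | lia].
have wd' : (w <= d)%N by [].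
rewrite -e1 -e2 -(bin_fact wd').
have -> : (-1) ^+ (f + d) = (-1) ^+ (w + f) * (-1) ^+ (d - w) :> k.
  by rewrite -exprD; congr (_ ^+ _); lia.
rewrite !natrM; field.
by rewrite !factf_neq0 // natf0 // -lt0n bin_gt0.
Qed.

(** Write T for the outer variable and s for the inner one. The sums over z and l are the binomial
    expansions of phi = (s - T)^a and psi = ((1+T)(1+s))^N (T - s)^K', the sum over x is their
    transvectant at s = 0, and the falling factorial of order B extracts the coefficient of T^B.
    Expanding phi and psi in the basis of [trv0_mobius] leaves a single sum. *)
Lemma mobius_sum N K' a B : (N + K' = n)%N -> (a <= Q)%N ->
  \sum_(z < a.+1) \sum_(l < K'.+1) (-1) ^+ (z + l) *
     ('C(a, z) * 'C(K', l) * (z + n - l) ^_ B)%:R *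
     \sum_(x < q.+1) (-1) ^+ x * ('C(q, x) * ((Q - q + x)`! * (n - x)`!)
                                   * ((a - z) ^_ (q - x) * (N + l) ^_ x))%:R
  = (-1) ^+ a * (B`! * q`!)%:R * \sum_(f < q.+1) (-1) ^+ f *
     (((Q - q + f)`! * (n - f)`!) * ('C(Q - a, q - f) * 'C(N, f))
      * (if (a + K' <= B + q)%N then 'C(N + f, B + q - (a + K')) else 0))%:R :> k.
Proof.
move=> NK aQ.
pose phi : {poly {poly k}} := \sum_(z < a.+1) ((-1) ^+ z * 'C(a, z)%:R * (1 + 'X) ^+ z)%:P * (1 + 'X) ^+ (a - z).
pose psi : {poly {poly k}} := \sum_(l < K'.+1) ((-1) ^+ l * 'C(K', l)%:R * (1 + 'X) ^+ (n - l))%:P * (1 + 'X) ^+ (N + l).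
transitivity ((B`! * q`!)%:R * (trv0 phi psi)`_B).
  rewrite /phi trv0_suml coef_sum mulr_sumr; apply: eq_bigr => z _.
  rewrite /psi trv0_sumr coef_sum mulr_sumr; apply: eq_bigr => l _.
  rewrite trv0_CM.
  have -> : trv0 ((1 + 'X) ^+ (a - z)) ((1 + 'X) ^+ (N + l)) =
     (\sum_(x < q.+1) (-1) ^+ x * (((Q - q + x)`! * (n - x)`!)
                                   * ('C(a - z, q - x) * 'C(N + l, x)))%:R : k)%:P.
    rewrite /trv0 raddf_sum /=; apply: eq_bigr => x _.
    by rewrite !coef_1DXn !polyCM !rmorphXn /= !polyCN !polyC1 !polyC_natr !natrM; ring.
  rewrite coefMC.
  have -> : ((-1) ^+ z * 'C(a, z)%:R * (1 + 'X) ^+ z * ((-1) ^+ l * 'C(K', l)%:R * (1 + 'X) ^+ (n - l)) : {poly k})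
     = (-1) ^+ (z + l) * (('C(a, z) * 'C(K', l))%:R%:P * (1 + 'X) ^+ (z + n - l)).
    have lK := ltn_ord l.
    have -> : (z + n - l = z + (n - l))%N by lia.
    by rewrite !exprD polyC_natr !natrM; ring.
  rewrite coef_signM coefCM coef_1DXn -(@bin_ffact _ B).
  rewrite !mulr_sumr; apply: eq_bigr => x _.
  have xq : (x <= q)%N by rewrite -ltnS.
  by rewrite -!bin_ffact -[in RHS](bin_fact xq) !natrM; ring.
have phiE : phi = (-1) ^+ a * piX ^+ a.
  rewrite -exprMn mulN1r /piX opprB.
  have -> : 'X - 'X%:P = (1 + 'X) - (1 + 'X)%:P :> {poly {poly k}} by rewrite polyCD polyC1; ring.
  rewrite exprDn /phi; apply: eq_bigr => z _.
  rewrite !polyCM !rmorphXn /= polyCN polyC1 polyC_natr -[RHS]mulr_natr [(- (1 + 'X)%:P) ^+ z]exprNn; ring.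
have psiE : psi = ((1 + 'X) ^+ N)%:P * (1 + 'X) ^+ N * piX ^+ K'.
  have -> : piX = (1 + 'X)%:P - (1 + 'X) :> {poly {poly k}} by rewrite /piX polyCD polyC1; ring.
  rewrite [_ ^+ K']exprDn /psi mulr_sumr; apply: eq_bigr => l _.
  have lK := ltn_ord l.
  have -> : (n - l = N + (K' - l))%N by lia.
  rewrite !polyCM !exprD !rmorphM !rmorphXn /= polyCN polyC1 polyC_natr -[_ *+ 'C(K', l)]mulr_natr [(- (1 + 'X)) ^+ l]exprNn; ring.
(* The extra power of T = (T - s) + s is what expands phi in the adapted basis s^e (T - s)^(Q-e). *)
have phi2 : ('X ^+ (Q - a))%:P * phi = \sum_(e < (Q - a).+1)
    ((-1) ^+ a * 'C(Q - a, e)%:R)%:P * ('X ^+ e * piX ^+ (Q - e)).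
  have E : 'X%:P = piX + 'X by rewrite /piX subrK.
  rewrite rmorphXn /= [X in X ^+ (Q - a)]E exprDn phiE mulr_suml; apply: eq_bigr => e _.
  have he := ltn_ord e.
  have -> : (Q - e = Q - a - e + a)%N by lia.
  by rewrite exprD polyCM !rmorphXn /= polyCN polyC1 polyC_natr -[_ *+ 'C(_, _)]mulr_natr; ring.
(* Here the identity is T(1 + s) = (T - s) + s(1 + T). *)
have psi2 : ('X ^+ N)%:P * psi = \sum_(f < N.+1)
    ('C(N, f)%:R * (1 + 'X) ^+ (N + f))%:P * ('X ^+ f * piX ^+ (n - f)).
  have E : 'X%:P * (1 + 'X) = piX + 'X * (1 + 'X)%:P :> {poly {poly k}}.
    by rewrite /piX polyCD polyC1; ring.
  have -> : ('X ^+ N)%:P * psi = ((1 + 'X) ^+ N)%:P * ((piX + 'X * (1 + 'X)%:P) ^+ N * piX ^+ K').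
    by rewrite -E exprMn psiE rmorphXn /=; ring.
  rewrite [(piX + _) ^+ N]exprDn mulr_suml mulr_sumr; apply: eq_bigr => f _.
  have he := ltn_ord f.
  have -> : (n - f = N - f + K')%N by lia.
  by rewrite !exprD polyCM !rmorphM !rmorphXn /= polyC_natr -[_ *+ 'C(_, _)]mulr_natr exprMn; ring.
pose G f : {poly k} := if (f <= q)%N then ((-1) ^+ a * ('C(Q - a, q - f) * 'C(N, f))%:R * ((-1) ^+ f * ((Q - q + f)`! * (n - f)`!)%:R))%:P
   * ('X ^+ (Q + n - q) * (1 + 'X) ^+ (N + f)) else 0.
have main : 'X ^+ (Q - a + N) * trv0 phi psi = \sum_(f < q.+1) G f.
  rewrite exprD -trv0_CM phi2 psi2 trv0_sumr.
  rewrite (@sum_ord_support _ G q.+1 N.+1); first last.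
  - move=> f hf; rewrite /G; case: ifP => // _.
    by rewrite (bin_small (_ : N < f)%N) ?muln0 ?mulr0 ?mul0r ?polyC0 ?mul0r //; lia.
  - by move=> f hf; rewrite /G; case: ifP => //; lia.
  apply: eq_bigr => f _; have hf := ltn_ord f.
  rewrite trv0_suml /G.
  have fn : (f <= n)%N by lia.
  have tE (e : 'I_(Q - a).+1) : trv0 (((-1) ^+ a * 'C(Q - a, e)%:R)%:P * ('X ^+ e * piX ^+ (Q - e)))
       (('C(N, f)%:R * (1 + 'X) ^+ (N + f))%:P * ('X ^+ f * piX ^+ (n - f)))
     = if (e + f == q)%N then ((-1) ^+ a * ('C(Q - a, e) * 'C(N, f))%:R * ((-1) ^+ f * ((Q - q + f)`! * (n - f)`!)%:R))%:P
   * ('X ^+ (Q + n - q) * (1 + 'X) ^+ (N + f)) else 0.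
    have he := ltn_ord e.
    rewrite trv0_CM trv0_mobius //; last lia.
    case: ifP => _; last by rewrite mulr0.
    by rewrite !polyCM !rmorphXn /= !polyCN !polyC1 !polyC_natr !natrM; ring.
  rewrite (eq_bigr _ (fun e _ => tE e)) -big_mkcond /=.
  case: leqP => hfq; last by rewrite big1 // => e /eqP; lia.
  have [hq|hq] := leqP (q - f) (Q - a).
    rewrite (big_pred1 (Ordinal (hq : (q - f < (Q - a).+1)%N))) //.
    by move=> e /=; rewrite -[e == _]val_eqE /=; apply/eqP/eqP; lia.
  rewrite (bin_small hq) mul0n mulr0 mul0r polyC0 mul0r big1 // => e /eqP; have := ltn_ord e; lia.
(* The auxiliary power of T only shifts the coefficient to be read. If the power T^(Q+n-q) in [G]
   exceeds that degree, the coefficient is 0: this is the [if] in the statement. *)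
have -> : (trv0 phi psi)`_B = ('X ^+ (Q - a + N) * trv0 phi psi)`_(B + (Q - a + N)).
  by rewrite coefXnM addnK; case: ltnP => //; lia.
rewrite main coef_sum !mulr_sumr; apply: eq_bigr => f _.
have hf := ltn_ord f; rewrite /G -ltnS hf coefCM coefXnM.
have -> : (B + (Q - a + N) < Q + n - q)%N = ~~ (a + K' <= B + q)%N by lia.
case: (boolP (a + K' <= B + q)%N) => hb /=; last by rewrite muln0 !mulr0.
rewrite coef_1DXn.
have -> : (B + (Q - a + N) - (Q + n - q) = B + q - (a + K'))%N by lia.
by rewrite !natrM; ring.
Qed.

End Mobius.

(** * The double sum of products of three transvectants *)

Section NineJ.
Variable k : fieldType.
Hypothesis k_char0 : [pchar k] =i pred0.

Lemma trv_e_of q A B a b : (q <= A)%N -> (q <= B)%N -> (a <= A)%N -> (b <= B)%N ->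
  trv k q A B a b = (A + B - q + 1)`!%:R / (A - q)`!%:R * trv_e k q A B a b.
Proof.
move=> qA qB aA bB.
apply: (mulIf (factf_neq0 k_char0 (A - q))); apply: (mulIf (factf_neq0 k_char0 (B - q))).
rewrite -mulrA -natrM trv_rcE // (trv_rc_e k_char0) // natrM; field.
by rewrite factf_neq0.
Qed.

Lemma trv_rc_rev q A B a b : (q <= A)%N -> (q <= B)%N ->
  trv_rc k q A B a b = (-1) ^+ q * \sum_(x < q.+1) (-1) ^+ x *
    ('C(q, x) * ((A - q + x)`! * (B - x)`!) * (a ^_ (q - x) * b ^_ x))%:R.
Proof.
move=> qA qB; rewrite /trv_rc (reindex_inj rev_ord_inj) mulr_sumr; apply: eq_bigr => x _ /=.
have xq : (x <= q)%N by rewrite -ltnS.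
rewrite subSS bin_sub // subKn //.
have -> : (A - (q - x) = A - q + x)%N by lia.
have -> : (B - q + (q - x) = B - x)%N by lia.
have -> : (-1) ^+ (q - x) = (-1) ^+ q * (-1) ^+ x :> k.
  by rewrite -exprD -signr_odd -[RHS]signr_odd oddD oddB.
by rewrite !natrM; ring.
Qed.

Variables m n i j K K' M N P Q t c mi mj ni nj : nat.
Hypotheses (mE : (M + K)%N = m) (nE : (N + K')%N = n) (PE : (mi + ni)%N = P) (QE : (mj + nj)%N = Q)
  (miE : (mi + i)%N = m) (mjE : (mj + j)%N = m) (niE : (ni + i)%N = n) (njE : (nj + j)%N = n)
  (tE : (t + i + j)%N = (c + K + K')%N) (rm : (c + K + K' <= m)%N) (rn : (c + K + K' <= n)%N).

(** The nondegenerate part of a 9j symbol: the two binomial coefficients are vertices at extreme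
    weight, and the three [trv] are the coupling coefficients of the pairs (p,u), (q,v) and
    (p,q). *)
Definition ninej_sum : k :=
  \sum_(z < t.+1) \sum_(l < K'.+1) (-1) ^+ (z + l) * ('C(t, z) * 'C(K', l))%:R *
    (trv k ni P n z (n - l) * trv k nj Q n (t - z) (N + l)
     * trv k K m m (z + i - l) (t - z + j + l - K')).

(** The indices g and y come from the [trv_e] expansions of the first and third transvectants; f is
    the index produced by [mobius_sum], whose right-hand side is the middle factor. *)
Definition ninej_term (g y f : nat) : k :=
  ('C(ni, g) * 'C(K, y) * (c + K - y) ^_ (K - y) * t ^_ g * (ni - g + y)`!
   * (((mj + f)`! * (n - f)`!) * ('C(Q - (t - g), nj - f) * 'C(N, f))
      * (if (t - g + K' <= ni - g + y + nj)%N
         then 'C(N + f, ni - g + y + nj - (t - g + K')) else 0)))%:R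
  * ((P - g)`!%:R / (mi + n + 1 - g)`!%:R) * ((m - y)`!%:R / (M + m + 1 - y)`!%:R).

(** In [trv_e] form the first transvectant contributes falling factorials of z and of z+n-l-g, the
    third one of z+i-l. As n - ni = i, the last two concatenate to a single falling factorial of
    order ni-g+y. With the second transvectant in Rankin-Cohen form, the sums over z and l are then
    those of [mobius_sum]. *)
Lemma ninej_sumE :
  ninej_sum = ((mi + n + 1)`!%:R / mi`!%:R * ((M + m + 1)`!%:R / M`!%:R)
     * (nj`!%:R / (mj`! * j`!)%:R)) * (-1) ^+ (t + nj) *
   \sum_(g < ni.+1) \sum_(y < K.+1) \sum_(f < nj.+1)
     (-1) ^+ (g + y + f) * ninej_term g y f.
Proof.
have hP : (P + n - ni + 1 = mi + n + 1)%N by lia.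
have hPq : (P - ni = mi)%N by lia.
have hQq : (Q - nj = mj)%N by lia.
have hMK : (m - K = M)%N by lia.
pose RC2 z l := trv_rc k nj Q n (t - z) (N + l).
pose e1 g : k := (-1) ^+ g * 'C(ni, g)%:R * ((P - g)`!%:R / (mi + n + 1 - g)`!%:R).
pose e3 y : k := (-1) ^+ y * ('C(K, y) * (c + K - y) ^_ (K - y))%:R * ((m - y)`!%:R / (M + m + 1 - y)`!%:R).
pose c0 : k := ((mi + n + 1)`!%:R / mi`!%:R * ((M + m + 1)`!%:R / M`!%:R))
   / (mj`! * j`!)%:R.
have step1 (z : 'I_t.+1) (l : 'I_K'.+1) :
    trv k ni P n z (n - l) * trv k nj Q n (t - z) (N + l)
     * trv k K m m (z + i - l) (t - z + j + l - K') =
   \sum_(g < ni.+1) \sum_(y < K.+1)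
      c0 * (e1 g * e3 y) * (z ^_ g * (z + n - l - g) ^_ (ni - g + y))%:R * RC2 z l.
  have zt : (z <= t)%N by rewrite -ltnS.
  have lK : (l <= K')%N by rewrite -ltnS.
  rewrite (@trv_e_of ni) //; try lia.
  rewrite (@trv_e_of K) //; try lia.
  have -> : trv k nj Q n (t - z) (N + l) = RC2 z l / (mj`! * j`!)%:R.
    have njq : (n - nj = j)%N by lia.
    rewrite /RC2 -trv_rcE ?hQq ?njq; try lia.
    by rewrite mulfK // natf0 // -lt0n muln_gt0 !fact_gt0.
  rewrite hP hPq hMK.
  have -> : (m + m - K + 1 = M + m + 1)%N by lia.
  transitivity (c0 * (trv_e k ni P n z (n - l) * trv_e k K m m (z + i - l) (t - z + j + l - K')) * RC2 z l).
    by rewrite /c0; ring.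
  rewrite /trv_e mulr_suml mulr_sumr mulr_suml; apply: eq_bigr => g _.
  rewrite [X in (c0 * X) * _]mulr_sumr [X in X * _]mulr_sumr mulr_suml; apply: eq_bigr => y _.
  rewrite hP.
  have -> : (m + m - K + 1 = M + m + 1)%N by lia.
  have gi : (g <= ni)%N by rewrite -ltnS.
  have -> : (z + (n - l) - g = z + n - l - g)%N by lia.
  (* In the ranges where z+i-l or t-z+j+l-K' would be truncated, the first respectively the second
     transvectant contributes a vanishing factor, so both sides are 0. *)
  have [h1|h1] := ltnP (z + i) l.
    have [h2|h2] := ltnP z g.
      by rewrite !(ffact_small h2) !(mul0n, muln0, mulr0n, mul0r, mulr0).
    rewrite (@ffact_small (z + n - l - g) (ni - g)); last lia.
    rewrite (@ffact_small (z + n - l - g) (ni - g + y)); last lia.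
    by rewrite !(mul0n, muln0, mulr0n, mul0r, mulr0).
  have [h2|h2] := ltnP (t - z + j + l) K'.
    have -> : RC2 z l = 0.
      rewrite /RC2 /trv_rc big1 // => h _; have [h3|h3] := ltnP (t - z) h.
        by rewrite (ffact_small h3) !(mul0n, muln0, mulr0n, mul0r, mulr0).
      have hn := ltn_ord h.
      by rewrite (@ffact_small (N + l)) ?(mul0n, muln0, mulr0n, mul0r, mulr0) //; lia.
    by rewrite !(mul0n, muln0, mulr0n, mul0r, mulr0).
  have -> : (z + i - l + (t - z + j + l - K') - y = c + K - y)%N by lia.
  have -> : (z + n - l - g) ^_ (ni - g + y) = ((z + n - l - g) ^_ (ni - g) * (z + i - l) ^_ y)%N.
    by rewrite ffact_split; congr (_ * _ ^_ _)%N; lia.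
  by rewrite /e1 /e3 !natrM; ring.
rewrite /ninej_sum.
under eq_bigr => z _ do under eq_bigr => l _ do rewrite step1 mulr_sumr.
under eq_bigr => z _ do rewrite exchange_big /=.
rewrite exchange_big mulr_sumr; apply: eq_bigr => g _ /=.
under eq_bigr => z _ do under eq_bigr => l _ do rewrite mulr_sumr.
under eq_bigr => z _ do rewrite exchange_big /=.
rewrite exchange_big mulr_sumr; apply: eq_bigr => y _ /=.
pose B := (ni - g + y)%N.
pose a := (t - g)%N.
transitivity (c0 * (e1 g * e3 y) * ((-1) ^+ g * (t ^_ g)%:R * ((-1) ^+ nj *
  \sum_(z < a.+1) \sum_(l < K'.+1) (-1) ^+ (z + l) *
     ('C(a, z) * 'C(K', l) * (z + n - l) ^_ B)%:R *
     \sum_(x < nj.+1) (-1) ^+ x * ('C(nj, x) * ((mj + x)`! * (n - x)`!)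
                                   * ((a - z) ^_ (nj - x) * (N + l) ^_ x))%:R))).
  have RCE z l : (z <= t)%N -> RC2 z l = (-1) ^+ nj * \sum_(x < nj.+1) (-1) ^+ x *
     ('C(nj, x) * ((mj + x)`! * (n - x)`!) * ((t - z) ^_ (nj - x) * (N + l) ^_ x))%:R.
    by move=> zt; rewrite /RC2 trv_rc_rev ?hQq //; lia.
  rewrite -(big_mkord xpredT (fun z => \sum_(l < K'.+1) (-1) ^+ (z + l) * ('C(t, z) * 'C(K', l))%:R *
     (c0 * (e1 g * e3 y) * (z ^_ g * (z + n - l - g) ^_ (ni - g + y))%:R * RC2 z l))).
  have [tg|gt] := ltnP t g.
    rewrite (ffact_small tg) !(mul0n, muln0, mulr0n, mul0r, mulr0) big_nat big1 // => z zt.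
    rewrite big1 // => l _; rewrite (@ffact_small z g) ?(mul0n, muln0, mulr0n, mul0r, mulr0) //; lia.
  rewrite (big_cat_nat _ (n := g)) //=; last lia.
  rewrite [X in X + _]big_nat [X in X + _]big1 ?add0r; last first.
    move=> z zt; rewrite big1 // => l _.
    by rewrite (@ffact_small z g) ?(mul0n, muln0, mulr0n, mul0r, mulr0) //; lia.
  rewrite -[X in X = _]/(\sum_(0 + g <= z < t.+1) _) big_addn subSn // big_mkord -/a.
  rewrite !mulr_sumr; apply: eq_bigr => z _; rewrite !mulr_sumr; apply: eq_bigr => l _.
  have zt : (z <= t - g)%N by rewrite -ltnS.
  rewrite RCE; last by lia.
  have -> : (t - (z + g) = a - z)%N by rewrite /a; lia.
  have -> : (z + g + n - l - g = z + n - l)%N by lia.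
  have -> : (-1) ^+ (z + g + l) = (-1) ^+ g * (-1) ^+ (z + l) :> k by rewrite -exprD; congr (_ ^+ _); lia.
  (* Shifting z by g absorbs the falling factorial of z into the binomial coefficient, replacing t
     by t - g. *)
  have cE : ('C(t, z + g) * (z + g) ^_ g = t ^_ g * 'C(a, z))%N.
    have zgt : (z + g <= t)%N by lia.
    have := @bin_trinomial t g (z + g) (leq_addl _ _) zgt; rewrite addnK -!bin_ffact mulnA => <-.
    by rewrite /a; ring.
  have -> : ('C(a, z) * 'C(K', l) * (z + n - l) ^_ B)%:R = ('C(a, z)%:R * ('C(K', l) * (z + n - l) ^_ B)%:R) :> k.
    by rewrite -natrM mulnA.
  have E1 : (t ^_ g)%:R * 'C(a, z)%:R = 'C(t, z + g)%:R * ((z + g) ^_ g)%:R :> k by rewrite -!natrM cE.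
  transitivity (c0 * (e1 g * e3 y) * ((-1) ^+ g * ((t ^_ g)%:R * 'C(a, z)%:R)) * ((-1) ^+ nj * ((-1) ^+ (z + l) *
    ('C(K', l) * (z + n - l) ^_ B)%:R) * \sum_(x < nj.+1) (-1) ^+ x *
     ('C(nj, x) * ((mj + x)`! * (n - x)`!) * ((a - z) ^_ (nj - x) * (N + l) ^_ x))%:R)).
    by rewrite E1 !natrM; ring.
  by ring.
have mb : forall N' K0 a0 B0, (N' + K0 = n)%N -> (a0 <= Q)%N -> _ :=
  @mobius_sum k k_char0 Q n nj ltac:(lia) ltac:(lia).
rewrite hQq in mb; rewrite mb ?/a //; last by lia.
rewrite !mulr_sumr; apply: eq_bigr => f _.
rewrite /ninej_term -/B.
have [tg|gt] := ltnP t g.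
  by rewrite !(ffact_small tg) !(mul0n, muln0, mulr0n, mul0r, mulr0).
have -> : (-1) ^+ (t + nj) = (-1) ^+ g * (-1) ^+ (t - g) * (-1) ^+ nj :> k.
  by rewrite -!exprD; congr (_ ^+ _); lia.
by rewrite /e1 /e3 /c0 !exprD !natrM; ring.
Qed.

End NineJ.

(** * Identification with the triple sum Gamma *)

Section ClosedFormSum.
Variable k : fieldType.
Hypothesis k_char0 : [pchar k] =i pred0.

Lemma binf n m : (m <= n)%N -> 'C(n, m)%:R = n`!%:R / (m`!%:R * (n - m)`!%:R) :> k.
Proof.
by move=> mn; rewrite -(bin_fact mn) !natrM mulfK // mulf_neq0 ?factf_neq0.
Qed.

Lemma ffactf n m : (m <= n)%N -> (n ^_ m)%:R = n`!%:R / (n - m)`!%:R :> k.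
Proof. by move=> mn; rewrite -(ffact_fact mn) natrM mulfK // factf_neq0. Qed.

Lemma sum_nat_restrict (V : nmodType) (F : nat -> V) lo hi n :
  (forall x, (x < lo)%N || (hi <= x)%N -> (x < n)%N -> F x = 0) -> (hi <= n)%N ->
  \sum_(x < n) F x = \sum_(lo <= x < hi) F x.
Proof.
move=> F0 hn; rewrite -(big_mkord xpredT F).
have [lh|hl] := leqP lo hi; last first.
  rewrite [RHS]big_geq; last lia.
  by rewrite big_nat big1 // => x hx; apply: F0; lia.
rewrite (big_cat_nat _ (n := lo)) //=; last lia.
rewrite [X in X + _]big_nat [X in X + _]big1 ?add0r; last by move=> x hx; apply: F0; lia.
rewrite (big_cat_nat _ (n := hi)) //=.
by rewrite [X in _ + X]big_nat [X in _ + X]big1 ?addr0 // => x hx; apply: F0; lia.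
Qed.

(** The index y is reversed, because Lambda counts it from the other end. The inequalities describe
    the support, on which every binomial coefficient is a quotient of factorials. *)
Lemma ninej_termE m n K K' M N P Q t c mi mj ni nj be Qt g y x :
  (M + K)%N = m -> (N + K')%N = n -> (mi + ni)%N = P -> (mj + nj)%N = Q ->
  (Qt + t)%N = Q -> (be + c)%N = (2 * N)%N ->
  (x <= N)%N -> (x <= nj)%N -> (y <= K)%N -> (y <= be)%N -> (be <= N + x + y)%N ->
  (g <= ni)%N -> (g <= t)%N -> (nj <= Qt)%N ->
  (ni + nj + K = be + t + K')%N ->
  ninej_term k m n K K' M N P Q t c mi mj ni nj g (K - y) x =
  (ni`! * t`! * K`! * N`!)%:R / c`!%:R *
  (((n - x)`! * (mj + x)`! * (N + x)`! * (M + y)`! * (c + y)`! * (P - g)`! * (Qt + g)`!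
       * (ni + K - y - g)`!)%:R
   / (x`! * y`! * g`! * (nj - x)`! * (N - x)`! * (K - y)`! * (2 * M + 1 + y)`! * (be - y)`!
       * (ni - g)`! * (t - g)`! * (mi + n + 1 - g)`! * (Qt - nj + x + g)`! * (N + x + y - be)`!)%:R).
Proof.
move=> mE nE PE QE QtE beE xN xnj yK ybe beN gni gt nQ key.
rewrite /ninej_term ifT; last lia.
have -> : (c + K - (K - y) = c + y)%N by lia.
have -> : (K - (K - y) = y)%N by lia.
have -> : (ni - g + (K - y) = ni + K - y - g)%N by lia.
have -> : (Q - (t - g) = Qt + g)%N by lia.
have -> : (ni + K - y - g + nj - (t - g + K') = be - y)%N by lia.
have -> : (m - (K - y) = M + y)%N by lia.
have -> : (M + m + 1 - (K - y) = 2 * M + 1 + y)%N by lia.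
rewrite !natrM !binf ?ffactf; try lia.
have -> : (K - (K - y) = y)%N by lia.
have -> : (c + y - y = c)%N by lia.
have -> : (Qt + g - (nj - x) = Qt - nj + x + g)%N by lia.
have -> : (N + x - (be - y) = N + x + y - be)%N by lia.
by field; rewrite !factf_neq0.
Qed.

(** The indices correspond by f = x, g = z and the reversal of y. Outside Lambda some binomial
    coefficient or falling factorial is 0, so the rectangular sum is the sum over Lambda. *)
Lemma ninej_term_Gamma m n r a b i j : (r <= m)%N -> (r <= n)%N -> inPi r a b -> (i + j <= r)%N ->
  let K := (2 * a + 1)%N in let K' := (2 * b + 1)%N in
  let N := (n - 2 * b - 1)%N in let t := (r - i - j)%N in
  \sum_(g < (n - i).+1) \sum_(y < K.+1) \sum_(x < (n - j).+1) (-1) ^+ (g + y + x) *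
    ninej_term k m n K K' (m - 2 * a - 1) N (m + n - 2 * i) (m + n - 2 * j) t (r - 2 * a - 2 * b - 2)
      (m - i) (m - j) (n - i) (n - j) g y x
  = - (((n - i)`! * t`! * K`! * N`!)%:R / (r - 2 * a - 2 * b - 2)`!%:R *
       ((-1) ^+ (n - j) * Gamma k m n r a b i j)).
Proof.
move=> rm rn ab ij K K' N t; rewrite /inPi in ab.
rewrite /Gamma signrMK.
rewrite {}/t {}/N.
have KE : K = (2 * a + 1)%N by [].
have K'E : K' = (2 * b + 1)%N by [].
clearbody K K'.
move EN: (n - 2 * b - 1)%N => N; move Et: (r - i - j)%N => t.
move EM: (m - 2 * a - 1)%N => M; move EP: (m + n - 2 * i)%N => P; move EQ: (m + n - 2 * j)%N => Q.
move Ec: (r - 2 * a - 2 * b - 2)%N => c; move Emi: (m - i)%N => mi; move Emj: (m - j)%N => mj.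
move Eni: (n - i)%N => ni; move Enj: (n - j)%N => nj; move Ebe: (2 * n - r + 2 * a - 2 * b)%N => be.
pose Qt := (m + n - r + i - j)%N; have EQt : (m + n - r + i - j)%N = Qt by []; clearbody Qt.
have mE : (M + K = m)%N by clear -EM KE ab rm; lia.
have nE : (N + K' = n)%N by clear -EN K'E ab rn; lia.
have miE : (mi + i = m)%N by clear -Emi ij rm; lia.
have mjE : (mj + j = m)%N by clear -Emj ij rm; lia.
have niE : (ni + i = n)%N by clear -Eni ij rn; lia.
have njE : (nj + j = n)%N by clear -Enj ij rn; lia.
have PE : (mi + ni = P)%N by clear -EP miE niE; lia.
have QE : (mj + nj = Q)%N by clear -EQ mjE njE; lia.
have cE : (c + K + K' = r)%N by clear -Ec KE K'E ab; lia.
have tE : (t + i + j = r)%N by clear -Et ij; lia.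
have beE : (be + c = 2 * N)%N by clear -Ebe cE nE KE K'E rn ab; lia.
have QtE : (Qt + t = Q)%N by clear -EQt QE mjE njE tE rm rn; lia.
have Tterm x y z : (x <= nj)%N -> (x <= N)%N -> (y <= K)%N -> (y <= be)%N -> (be <= N + x + y)%N ->
   (z <= ni)%N -> (z <= t)%N ->
   (T1 m n r a b i j x y z)%:R / (T2 m n r a b i j x y z)%:R =
   ((n - x)`! * (mj + x)`! * (N + x)`! * (M + y)`! * (c + y)`! * (P - z)`! * (Qt + z)`!
       * (ni + K - y - z)`!)%:R
   / (x`! * y`! * z`! * (nj - x)`! * (N - x)`! * (K - y)`! * (2 * M + 1 + y)`! * (be - y)`!
       * (ni - z)`! * (t - z)`! * (mi + n + 1 - z)`! * (Qt - nj + x + z)`! * (N + x + y - be)`!)%:R :> k.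
  move=> xj xN yK yb bNx zi zt; rewrite /T1 /T2 EM EP Ec Emj Eni EN Et Enj Ebe EQt.
  have -> : (2 * m - 4 * a - 1 + y = 2 * M + 1 + y)%N by clear -mE KE; lia.
  have -> : (m + n - i + 1 - z = mi + n + 1 - z)%N by clear -miE; lia.
  have -> : (m - r + i + x + z = Qt - nj + x + z)%N by clear -QtE tE njE mjE QE rm; lia.
  have -> : (r + x + y - n - 2 * a - 1 = N + x + y - be)%N by clear -nE K'E cE beE KE bNx; lia.
  by rewrite -[(ni + 2 * a + 1)%N]addnA -KE.
have lowE x : (n - r + 2 * a + 1 - x = be - N - x)%N by clear -beE cE KE nE rn; lia.
have upE y : (ni + 2 * a + 1 - y = ni + K - y)%N by clear -KE; lia.
clear EM EP EQ Ec Emi Emj Eni Enj Ebe EQt Et EN.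
pose F x y z : k := ninej_term k m n K K' M N P Q t c mi mj ni nj z (K - y) x.
(* Replacing y by K - y changes the sign, since K is odd. *)
transitivity (- \sum_(x < nj.+1) \sum_(y < K.+1) \sum_(z < ni.+1) (-1) ^+ (x + y + z) * F x y z).
  rewrite -sumrN; under eq_bigr => g _ do rewrite exchange_big /=.
  rewrite exchange_big; apply: eq_bigr => x _ /=.
  rewrite exchange_big -sumrN (reindex_inj rev_ord_inj) /=; apply: eq_bigr => y _.
  rewrite -sumrN; apply: eq_bigr => g _; rewrite subSS /F -mulNr; congr (_ * _).
  have yK : (y <= K)%N by rewrite -ltnS.
  rewrite -signr_odd -[in RHS]signr_odd.
  have -> : odd (g + (K - y) + x) = ~~ odd (x + y + g) by clear -yK KE; lia.
  by case: odd; rewrite ?expr1 ?expr0 ?opprK.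
have keyE : (ni + nj + K = be + t + K')%N by clear -niE njE beE tE cE nE; lia.
(* Each bound of Lambda that is stricter than the rectangular range is the vanishing condition of
   one factor of the term. *)
have Fsmall x y z : (x <= nj)%N -> (y <= K)%N -> (z <= ni)%N ->
   [|| (N < x)%N, (be < y)%N, (N + x + y < be)%N | (t < z)%N] -> F x y z = 0.
  move=> xj yK zi h; rewrite /F /ninej_term.
  have [zt|tz] := leqP z t; last first.
    by rewrite (ffact_small tz) !(mul0n, muln0, mulr0n, mul0r, mulr0).
  have [xN|Nx] := leqP x N; last first.
    by rewrite (bin_small Nx) !(mul0n, muln0, mulr0n, mul0r, mulr0).
  case: ifP => h1; last by rewrite !(mul0n, muln0, mulr0n, mul0r, mulr0).
  have -> : (ni - z + (K - y) + nj - (t - z + K') = be - y)%N by clear -keyE zi zt yK; lia.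
  have yb : (y <= be)%N by clear -keyE zi zt yK h1; lia.
  rewrite (@bin_small (N + x)) ?(mul0n, muln0, mulr0n, mul0r, mulr0) //; clear -h zt xN yb; lia.
rewrite mulr_sumr; congr (- _).
rewrite (@sum_nat_restrict _ (fun x => \sum_(y < K.+1) \sum_(z < ni.+1) (-1) ^+ (x + y + z) * F x y z)
   0 (minn N nj).+1); [|move=> x hx xj|lia]; last first.
  rewrite big1 // => y _; rewrite big1 // => z _; rewrite Fsmall ?mulr0 //; have := ltn_ord y; have := ltn_ord z;
   clear -hx xj; lia.
rewrite big_nat [in RHS]big_nat; apply: eq_bigr => x hx.
rewrite (@sum_nat_restrict _ (fun y => \sum_(z < ni.+1) (-1) ^+ (x + y + z) * F x y z)
   (be - N - x) (minn K be).+1); [|move=> y hy yj|lia]; last first.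
  rewrite big1 // => z _; rewrite Fsmall ?mulr0 //; have := ltn_ord z; clear -hx hy yj; lia.
rewrite lowE -!KE mulr_sumr big_nat [in RHS]big_nat; apply: eq_bigr => y hy.
have -> : (r - m - i - x = 0)%N by clear -rm; lia.
rewrite upE (@sum_nat_restrict _ (fun z => (-1) ^+ (x + y + z) * F x y z)
   0 (minn (minn ni t) (ni + K - y)).+1); [|move=> z hz zj|lia]; last first.
  by rewrite Fsmall ?mulr0 //; clear -hx hy hz zj; lia.
rewrite mulr_sumr big_nat [in RHS]big_nat; apply: eq_bigr => z hz.
rewrite [RHS]mulrCA; congr (_ * _).
have h1 : (x <= nj)%N by clear -hx; lia.
have h2 : (x <= N)%N by clear -hx; lia.
have h3 : (y <= K)%N by clear -hy; lia.
have h4 : (y <= be)%N by clear -hy; lia.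
have h5 : (be <= N + x + y)%N by clear -hy; lia.
have h6 : (z <= ni)%N by clear -hz; lia.
have h7 : (z <= t)%N by clear -hz; lia.
rewrite Tterm // /F (@ninej_termE _ _ _ _ _ _ _ _ _ _ _ _ _ _ be Qt) //.
by clear -QtE tE njE mjE QE rm; lia.
Qed.

End ClosedFormSum.

(** * The apolar form and the polarization operators *)

Section Linear.
Variable k : comNzRingType.

(** Linearity is a predicate on bare functions, so that operators built by iteration and composition
    keep their plain form. *)
Definition islin (V W : lmodType k) (f : V -> W) := forall a u v, f (a *: u + v) = a *: f u + f v.

Variables U V W : lmodType k.
Implicit Types (f : V -> W) (g : U -> V).

Lemma islin0 f : islin f -> f 0 = 0.
Proof.
move=> fl; have := fl (-1) 0 0; by rewrite scaler0 addr0 scaleN1r addNr.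
Qed.

Lemma islinZ f a u : islin f -> f (a *: u) = a *: f u.
Proof. by move=> fl; rewrite -[a *: u]addr0 fl islin0 // addr0. Qed.

Lemma islinD f u v : islin f -> f (u + v) = f u + f v.
Proof. by move=> fl; rewrite -{1}[u]scale1r fl scale1r. Qed.

Lemma islinN f u : islin f -> f (- u) = - f u.
Proof. by move=> fl; rewrite -scaleN1r islinZ // scaleN1r. Qed.

Lemma islinB f u v : islin f -> f (u - v) = f u - f v.
Proof. by move=> fl; rewrite islinD // islinN. Qed.

Lemma islin_sum f (I : Type) (r : seq I) (P : pred I) F : islin f ->
  f (\sum_(i <- r | P i) F i) = \sum_(i <- r | P i) f (F i).
Proof.
move=> fl; elim/big_rec2: _ => [|i y1 y2 _ <-]; first exact: islin0.
by rewrite islinD.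
Qed.

Lemma islin_comp f g : islin f -> islin g -> islin (fun x => f (g x)).
Proof. by move=> fl gl a u v; rewrite gl fl. Qed.
End Linear.

Lemma islin_iter (k : comNzRingType) (V : lmodType k) (f : V -> V) n : islin f -> islin (iter n f).
Proof. by move=> fl; elim: n => [|n IH] a u v //=; rewrite IH fl. Qed.

Lemma islin_mull (k : comNzRingType) (A : comAlgType k) (c : A) : islin (fun x : A => c * x).
Proof. by move=> a u v; rewrite mulrDr scalerAr. Qed.

Lemma iter_comm (T : Type) (f g : T -> T) n : (forall x, f (g x) = g (f x)) ->
  forall x, f (iter n g x) = iter n g (f x).
Proof. by move=> fg x; elim: n => //= n IH; rewrite fg IH. Qed.

Lemma iter0 (k : comNzRingType) (V : lmodType k) (f : V -> V) n : islin f -> iter n f 0 = 0.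
Proof. by move=> fl; apply: islin0; apply: islin_iter. Qed.

Section Fischer.
Variables (n : nat) (k : fieldType).
Hypothesis k_char0 : [pchar k] =i pred0.
Implicit Types (f g h : {mpoly k[n]}) (m : 'X_{1..n}).

Lemma islin_mderiv i : islin (mderiv (R := k) (n := n) i).
Proof. by move=> a u v; rewrite mderivD mderivZ. Qed.

Lemma mderivXU i j : ('X_i : {mpoly k[n]})^`M(j) = (i == j)%:R.
Proof.
rewrite mderivX mnm1E; case: eqP => [->|_]; last by rewrite scale0r.
by rewrite scale1r -mpolyX0; congr 'X_[_]; apply/mnmP => l; rewrite mnmBE mnm0E subnn.
Qed.

Definition mfac m := (\prod_(i < n) (m i)`!)%N.

(* The apolar (Fischer) form: multiplication by a variable and the
   corresponding derivation are adjoint. *)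
Definition fp f g : k := \sum_(m <- msupp f) f@_m * g@_m * (mfac m)%:R.

Lemma fpwE f g d : (msize f <= d)%N ->
  fp f g = \sum_(m : 'X_{1..n < d}) f@_m * g@_m * (mfac m)%:R.
Proof.
move=> le_d; pose I : subFinType _ := 'X_{1..n < d}.
rewrite /fp (big_mksub I) /=; first last.
- by move=> x /msize_mdeg_lt/leq_trans/(_ le_d).
- by rewrite msupp_uniq.
rewrite big_rmcond //= => j /memN_msupp_eq0 ->.
by rewrite !mul0r.
Qed.

Lemma fpC f g : fp f g = fp g f.
Proof.
rewrite (@fpwE f g (maxn (msize f) (msize g))) ?leq_maxl //.
rewrite (@fpwE g f (maxn (msize f) (msize g))) ?leq_maxr //.
by apply: eq_bigr => m _; congr (_ * _); rewrite mulrC.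
Qed.

Lemma fp_linr f : islin (fp f : {mpoly k[n]} -> k^o).
Proof.
move=> a u v; rewrite /fp /= -[X in _ = X + _]/(a * _) mulr_sumr -big_split; apply: eq_bigr => m _ /=.
by rewrite mcoeffD mcoeffZ; ring.
Qed.

Lemma fp_linl g : islin ((fun f => fp f g) : {mpoly k[n]} -> k^o).
Proof. by move=> a u v; rewrite !(fpC _ g) fp_linr. Qed.

Lemma fpXm m g : fp 'X_[m] g = g@_m * (mfac m)%:R.
Proof. by rewrite /fp msuppX big_seq1 mcoeffX eqxx mul1r. Qed.

Lemma mfacDU m i : mfac (m + U_(i)) = (mfac m * (m i).+1)%N.
Proof.
rewrite /mfac (bigD1 i) //= [in RHS](bigD1 i) //= mnmDE mnm1E eqxx addn1 factS.
rewrite [RHS]mulnAC [(_ * (m i).+1)%N]mulnC; congr (_ * _)%N.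
by apply: eq_bigr => j ji; rewrite mnmDE mnm1E eq_sym (negbTE ji) addn0.
Qed.

Lemma fpXl i f g : fp ('X_i * f) g = fp f g^`M(i).
Proof.
rewrite [f]mpolyE mulr_sumr.
rewrite (islin_sum _ _ _ (fp_linl g)) (islin_sum _ _ _ (fp_linl _)).
apply: eq_bigr => m _; rewrite -scalerAr.
rewrite (islinZ _ _ (fp_linl g)) (islinZ _ _ (fp_linl _)).
suff -> : fp ('X_i * 'X_[m]) g = fp 'X_[m] g^`M(i) by [].
rewrite -mpolyXD addmC !fpXm mfacDU mcoeff_deriv natrM -mulr_natr; ring.
Qed.

Lemma fpXr i f g : fp f ('X_i * g) = fp f^`M(i) g.
Proof. by rewrite fpC fpXl fpC. Qed.

Lemma mfac_neq0 m : (mfac m)%:R != 0 :> k.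
Proof.
rewrite ((pcharf0P k).1 k_char0) -lt0n.
by apply: prodn_gt0 => i; rewrite fact_gt0.
Qed.

(** The Euler operator of one variable is self-adjoint and a monomial is its eigenvector; pairing
    with that monomial reads off the coefficient. *)
Lemma mcoeff_XD i f m : ('X_i * f^`M(i))@_m = (m i)%:R * f@_m.
Proof.
apply: (mulIf (mfac_neq0 m)).
rewrite -fpXm fpXr mderivX (islinZ _ _ (fp_linl _)) /=.
have [mi|mi] := eqVneq (m i) 0%N.
  by rewrite mi scale0r !mul0r.
have [m' mE] : exists m', m = (m' + U_(i))%MM.
  by exists (m - U_(i))%MM; rewrite submK // lep1mP.
rewrite mE addmK fpXm mcoeff_deriv mfacDU mnmDE mnm1E eqxx addn1.
by rewrite -[_ *: _]/(_ * _) natrM -mulr_natr; ring.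
Qed.

End Fischer.

Definition allPairs : seq varPair := [:: vx; vy; vz; vp; vq; vu; vv].
(** The type [varPair] contains arbitrary pairs of indices. The seven genuine pairs have disjoint
    coordinates, on which all commutation rules below rest. *)
Definition vpair (s : varPair) := s \in allPairs.

Lemma vpairP (Q : varPair -> Prop) :
  [/\ Q vx, Q vy, Q vz & [/\ Q vp, Q vq, Q vu & Q vv]] -> forall s, vpair s -> Q s.
Proof.
case=> h1 h2 h3 [h4 h5 h6 h7] s; rewrite /vpair !inE.
by repeat (case/orP => [/eqP-> //|]); move/eqP->.
Qed.

Lemma vpair_coord s t : vpair s -> vpair t ->
  [/\ (s.1 == t.1) = (s == t), (s.2 == t.2) = (s == t), (s.1 == t.2) = false & (s.2 == t.1) = false].
Proof.
move=> sv tv.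
have : all (fun s => all (fun t => [&& (s.1 == t.1) == (s == t), (s.2 == t.2) == (s == t),
   (s.1 == t.2) == false & (s.2 == t.1) == false]) allPairs) allPairs by [].
by move/allP/(_ _ sv)/allP/(_ _ tv) => /and4P[/eqP-> /eqP-> /eqP-> /eqP->].
Qed.

Section Commutators.
Variable k : fieldType.
Implicit Types (f g : {mpoly k[14]}) (s t a b c d : varPair).

Lemma polarizeM t s f g : polarize t s (f * g) = polarize t s f * g + f * polarize t s g.
Proof. by rewrite /polarize !mderivM; ring. Qed.

Lemma islin_polarize t s : islin (@polarize k t s).
Proof.
move=> a u v; rewrite /polarize !mderivD !mderivZ !mulrDr -!scalerAr scalerDr; ring.
Qed.

Lemma islin_Omega s t : islin (@Omega k s t).
Proof.
by move=> a u v; rewrite /Omega !(mderivD, mderivZ) scalerBr opprD addrACA.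
Qed.

Lemma mdX1 s t : vpair s -> vpair t -> ('X_(s.1) : {mpoly k[14]})^`M(t.1) = (s == t)%:R.
Proof. by move=> sv tv; have [e _ _ _] := vpair_coord sv tv; rewrite mderivXU e. Qed.
Lemma mdX2 s t : vpair s -> vpair t -> ('X_(s.2) : {mpoly k[14]})^`M(t.2) = (s == t)%:R.
Proof. by move=> sv tv; have [_ e _ _] := vpair_coord sv tv; rewrite mderivXU e. Qed.
Lemma mdX12 s t : vpair s -> vpair t -> ('X_(s.1) : {mpoly k[14]})^`M(t.2) = 0.
Proof. by move=> sv tv; have [_ _ e _] := vpair_coord sv tv; rewrite mderivXU e. Qed.
Lemma mdX21 s t : vpair s -> vpair t -> ('X_(s.2) : {mpoly k[14]})^`M(t.1) = 0.
Proof. by move=> sv tv; have [_ _ _ e] := vpair_coord sv tv; rewrite mderivXU e. Qed.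

Lemma mderiv_polarize1 a b c f : vpair a -> vpair b -> vpair c ->
  (polarize a b f)^`M(c.1) = polarize a b f^`M(c.1) + (a == c)%:R * f^`M(b.1).
Proof.
move=> av bv cv; rewrite /polarize mderivD !mderivM mdX1 // mdX21 //.
rewrite [f^`M(b.1)^`M(c.1)]mderiv_comm [f^`M(b.2)^`M(c.1)]mderiv_comm; ring.
Qed.

Lemma mderiv_polarize2 a b c f : vpair a -> vpair b -> vpair c ->
  (polarize a b f)^`M(c.2) = polarize a b f^`M(c.2) + (a == c)%:R * f^`M(b.2).
Proof.
move=> av bv cv; rewrite /polarize mderivD !mderivM mdX12 // mdX2 //.
rewrite [f^`M(b.1)^`M(c.2)]mderiv_comm [f^`M(b.2)^`M(c.2)]mderiv_comm; ring.
Qed.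

(** The commutation relations of the matrix units of gl_7, arranged without subtraction. *)
Lemma polarize_comm a b c d f : vpair a -> vpair b -> vpair c -> vpair d ->
  polarize a b (polarize c d f) + (a == d)%:R * polarize c b f =
  polarize c d (polarize a b f) + (b == c)%:R * polarize a d f.
Proof.
move=> av bv cv dv.
rewrite {1}/polarize (mderiv_polarize1 _ cv) // (mderiv_polarize2 _ cv) //.
rewrite [in RHS]/(polarize c d) (mderiv_polarize1 _ av) // (mderiv_polarize2 _ av) //.
rewrite [c == b]eq_sym /polarize.
rewrite [f^`M(d.1)^`M(b.1)]mderiv_comm [f^`M(d.1)^`M(b.2)]mderiv_comm.
rewrite [f^`M(d.2)^`M(b.1)]mderiv_comm [f^`M(d.2)^`M(b.2)]mderiv_comm.
ring.
Qed.

(** Commuting past a d_b acts on Omega as a derivation that replaces an index a by b. *)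
Lemma Omega_polarize s t a b f : vpair s -> vpair t -> vpair a -> vpair b ->
  Omega s t (polarize a b f) =
  polarize a b (Omega s t f) + (a == s)%:R * Omega b t f + (a == t)%:R * Omega s b f.
Proof.
move=> sv tv av bv.
have dM i (x : bool) (g : {mpoly k[14]}) : ((x%:R : {mpoly k[14]}) * g)^`M(i) = x%:R * g^`M(i).
  by case: x; rewrite ?mul1r ?mul0r ?mderiv0.
rewrite {1}/Omega (mderiv_polarize1 _ av) // (mderiv_polarize2 _ av) //.
rewrite ![(polarize a b _ + _ * _)^`M(_)]mderivD !dM (mderiv_polarize1 _ av) // (mderiv_polarize2 _ av) //.
rewrite /Omega [in RHS](islinB _ _ (islin_polarize a b)).
rewrite [f^`M(s.1)^`M(b.2)]mderiv_comm [f^`M(s.2)^`M(b.1)]mderiv_comm.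
ring.
Qed.

Lemma polarize_bracket a b s t : vpair a -> vpair b -> vpair s -> vpair t ->
  polarize a b (bracket k s t) = (b == s)%:R * bracket k a t + (b == t)%:R * bracket k s a.
Proof.
move=> av bv sv tv; rewrite /polarize /bracket !mderivB !mderivM.
rewrite !mdX1 // !mdX2 // !mdX12 // !mdX21 // [s == b]eq_sym [t == b]eq_sym; ring.
Qed.

Lemma Omega_bracket s t f : vpair s -> vpair t -> s != t ->
  Omega s t (bracket k s t * f) =
  bracket k s t * Omega s t f + (polarize s s f + polarize t t f + f *+ 2).
Proof.
move=> sv tv st; rewrite /Omega /bracket /polarize.
rewrite !(mderivM, mderivB, mderivD) !mdX1 // !mdX2 // !mdX12 // !mdX21 // !eqxx [t == s]eq_sym (negbTE st).
rewrite !mulr1n !mulr0n !(mderivM, mderivB, mderivD, mderiv0, mul0r, mul1r, add0r, addr0, subr0, sub0r, mdX1, mdX2, mdX12, mdX21) //.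
have Z i : (1 : {mpoly k[14]})^`M(i) = 0 by rewrite -[1]/(1%:MP) mderivC.
rewrite !Z; ring.
Qed.

(** The Capelli identity for two pairs. On a multihomogeneous polynomial killed by Omega, polarizing
    forth and back is therefore a scalar. *)
Lemma capelli s t f : vpair s -> vpair t -> s != t ->
  polarize t s (polarize s t f) = polarize t t (polarize s s f) + polarize t t f - bracket k s t * Omega s t f.
Proof.
move=> sv tv st; rewrite /Omega /bracket /polarize.
rewrite !(mderivM, mderivB, mderivD) !mdX1 // !mdX2 // !mdX12 // !mdX21 // !eqxx (negbTE st).
rewrite [f^`M(t.1)^`M(s.1)]mderiv_comm [f^`M(t.1)^`M(s.2)]mderiv_comm.
rewrite [f^`M(t.2)^`M(s.1)]mderiv_comm [f^`M(t.2)^`M(s.2)]mderiv_comm.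
rewrite !mulr1n !mulr0n; ring.
Qed.

End Commutators.

(** * Equivariance under sl_2 *)

Section Equivariance.
Variable k : fieldType.
Implicit Types (f g : {mpoly k[14]}) (s t a b c d : varPair).

(* The raising (e = true) and lowering operators of sl_2, acting diagonally. *)
Definition co (e : bool) (s : varPair) : 'I_14 := if e then s.1 else s.2.
Definition sl2op (e : bool) f : {mpoly k[14]} := \sum_(s <- allPairs) 'X_(co e s) * f^`M(co (~~ e) s).

Lemma sl2opM e f g : sl2op e (f * g) = sl2op e f * g + f * sl2op e g.
Proof.
rewrite /sl2op mulr_suml mulr_sumr -big_split; apply: eq_bigr => s _ /=.
by rewrite mderivM; ring.
Qed.

Lemma islin_sl2op e : islin (sl2op e).
Proof.
move=> a u v; rewrite /sl2op scaler_sumr -big_split; apply: eq_bigr => s _ /=.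
by rewrite mderivD mderivZ mulrDr -scalerAr.
Qed.

Lemma sl2opXn e f n : sl2op e f = 0 -> sl2op e (f ^+ n) = 0.
Proof.
move=> f0; elim: n => [|n IH]; last by rewrite exprS sl2opM f0 IH mul0r mulr0 addr0.
rewrite expr0 /sl2op big1 // => s _.
by rewrite -[1]/(1%:MP) mderivC mulr0.
Qed.

Lemma mdXco e e' s t : vpair s -> vpair t ->
  ('X_(co e s) : {mpoly k[14]})^`M(co e' t) = ((e == e') && (s == t))%:R.
Proof. by move=> sv tv; case: e; case: e'; rewrite /= ?mdX1 ?mdX2 ?mdX12 ?mdX21. Qed.

Lemma sum_allPairs (V : nmodType) (F : varPair -> V) s : vpair s ->
  \sum_(t <- allPairs) (if t == s then F t else 0) = F s.
Proof.
move=> sv; rewrite (bigD1_seq s) /=; [|exact: sv|by []].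
by rewrite eqxx big1 ?addr0 // => t /negbTE->.
Qed.

Lemma mderiv_sl2op e e' s f : vpair s ->
  (sl2op e f)^`M(co e' s) = sl2op e f^`M(co e' s) + (e == e')%:R * f^`M(co (~~ e) s).
Proof.
move=> sv; rewrite /sl2op raddf_sum /=.
transitivity (\sum_(t <- allPairs) ('X_(co e t) * f^`M(co e' s)^`M(co (~~ e) t)
   + (if t == s then (e == e')%:R * f^`M(co (~~ e) t) else 0))).
  rewrite big_seq [RHS]big_seq; apply: eq_bigr => t tv.
  rewrite mderivM mdXco // mderiv_comm.
  by case: (t == s); case: (e == e'); rewrite /= ?mulr1n ?mulr0n ?mul1r ?mul0r ?add0r ?addr0 // addrC.
by rewrite big_split /= sum_allPairs.
Qed.

Lemma sl2op_X e e' s : vpair s -> sl2op e 'X_(co e' s) = (e == ~~ e')%:R * 'X_(co e s).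
Proof.
move=> sv; rewrite /sl2op.
transitivity (\sum_(t <- allPairs) (if t == s then (e == ~~ e')%:R * 'X_(co e t) : {mpoly k[14]} else 0)).
  rewrite big_seq [RHS]big_seq; apply: eq_bigr => t tv.
  rewrite mdXco // [s == t]eq_sym; case: (t == s); rewrite ?andbF ?mulr0 // andbT mulrC.
  by case: e; case: e'.
by rewrite sum_allPairs.
Qed.

Lemma sl2op_polarize e a b f : vpair a -> vpair b ->
  sl2op e (polarize a b f) = polarize a b (sl2op e f).
Proof.
move=> av bv; rewrite /polarize.
have D1 := @mderiv_sl2op e true b f bv; have D2 := @mderiv_sl2op e false b f bv.
have X1 := @sl2op_X e true a av; have X2 := @sl2op_X e false a av.
rewrite /= in D1 D2 X1 X2.
rewrite (islinD _ _ (islin_sl2op e)) !sl2opM D1 D2 X1 X2.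
by case: e {D1 D2 X1 X2} => /=; rewrite ?mulr1n ?mulr0n; ring.
Qed.

Lemma sl2op_Omega e s t f : vpair s -> vpair t ->
  sl2op e (Omega s t f) = Omega s t (sl2op e f).
Proof.
move=> sv tv; rewrite /Omega.
have S1 g := @mderiv_sl2op e true s g sv; have S2 g := @mderiv_sl2op e false s g sv.
have T1 g := @mderiv_sl2op e true t g tv; have T2 g := @mderiv_sl2op e false t g tv.
rewrite /= in S1 S2 T1 T2.
rewrite (islinB _ _ (islin_sl2op e)) S1 S2 !mderivD !mderivM T1 T2.
have Z (x : bool) i : (x%:R : {mpoly k[14]})^`M(i) = 0 by rewrite -mpolyC_nat mderivC.
rewrite !Z [f^`M(co (~~ e) s)^`M(t.2)]mderiv_comm [f^`M(co (~~ e) s)^`M(t.1)]mderiv_comm.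
rewrite [f^`M(s.1)^`M(co (~~ e) t)]mderiv_comm [f^`M(s.2)^`M(co (~~ e) t)]mderiv_comm.
case: e {S1 S2 T1 T2} => /=; rewrite ?mulr1n ?mulr0n.
  by rewrite [f^`M(t.2)^`M(s.2)]mderiv_comm; ring.
by rewrite [f^`M(t.1)^`M(s.1)]mderiv_comm; ring.
Qed.

Lemma sl2op_bracket e s t : vpair s -> vpair t -> sl2op e (bracket k s t) = 0.
Proof.
move=> sv tv; rewrite /bracket (islinB _ _ (islin_sl2op e)) !sl2opM.
have X1 := @sl2op_X e true s sv; have X2 := @sl2op_X e false s sv.
have Y1 := @sl2op_X e true t tv; have Y2 := @sl2op_X e false t tv.
rewrite /= in X1 X2 Y1 Y2; rewrite X1 X2 Y1 Y2.
by case: e {X1 X2 Y1 Y2} => /=; rewrite ?mulr1n ?mulr0n; ring.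
Qed.

End Equivariance.

Section Operators.
Variable k : fieldType.
Hypothesis k_char0 : [pchar k] =i pred0.
Implicit Types (f g h : {mpoly k[14]}) (s t w a b c : varPair) (d : varPair -> nat).

Lemma natk_neq0 n : (0 < n)%N -> n%:R != 0 :> k.
Proof. by move=> n0; rewrite ((pcharf0P k).1 k_char0) -lt0n. Qed.

Lemma OmegaSS s f : Omega s s f = 0.
Proof. by rewrite /Omega mderiv_comm subrr. Qed.

(* Multihomogeneity, expressed by the Euler operators. *)
Definition mh d f := forall s, vpair s -> polarize s s f = (d s)%:R *: f.

Definition deg7 (x y z p q u v : nat) : varPair -> nat :=
  fun s => nth 0%N [:: x; y; z; p; q; u; v] (index s allPairs).

Lemma mh0 d : mh d 0.
Proof. by move=> s sv; rewrite scaler0 islin0 //; apply: islin_polarize. Qed.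

Lemma mh_ext d d' f : (forall s, vpair s -> d s = d' s) -> mh d f -> mh d' f.
Proof. by move=> e df s sv; rewrite df // e. Qed.

Lemma mhD d f g : mh d f -> mh d g -> mh d (f + g).
Proof. by move=> df dg s sv; rewrite (islinD _ _ (islin_polarize s s)) df // dg // scalerDr. Qed.

Lemma mhZ d (x : k) f : mh d f -> mh d (x *: f).
Proof. by move=> df s sv; rewrite (islinZ _ _ (islin_polarize s s)) df // !scalerA mulrC. Qed.

Lemma mh_sum (I : Type) (r : seq I) (P : pred I) d (F : I -> {mpoly k[14]}) :
  (forall i, P i -> mh d (F i)) -> mh d (\sum_(i <- r | P i) F i).
Proof. by move=> dF; apply: big_ind => //; [exact: mh0 | move=> f g; exact: mhD]. Qed.

(** Comparing coefficients, the total exponent of s annihilates every nonzero coefficient of f. In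
    characteristic zero it is then 0, so s does not occur in f. *)
Lemma mh_deriv0 d f s : mh d f -> vpair s -> d s = 0%N -> f^`M(s.1) = 0 /\ f^`M(s.2) = 0.
Proof.
move=> df sv ds; have := df s sv; rewrite ds scale0r => e.
have m0 m : f@_m != 0 -> (m s.1 = 0%N) /\ (m s.2 = 0%N).
  move=> fm; have := congr1 (fun g => g@_m) e.
  rewrite /polarize mcoeffD mcoeff0 !(mcoeff_XD k_char0) -mulrDl -natrD => /eqP.
  by rewrite mulf_eq0 (negbTE fm) orbF ((pcharf0P k).1 k_char0) addn_eq0 => /andP[/eqP-> /eqP->].
split; apply/mpolyP => m; rewrite mcoeff0 mcoeff_deriv.
  case: (eqVneq (f@_(m + U_(s.1))) 0) => [->|/m0[e1 e2]]; first by rewrite mul0rn.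
  by move: e1; rewrite mnmDE mnm1E eqxx addn1.
case: (eqVneq (f@_(m + U_(s.2))) 0) => [->|/m0[e1 e2]]; first by rewrite mul0rn.
by move: e2; rewrite mnmDE mnm1E eqxx addn1.
Qed.

Lemma mh_polarize0 d f a b : mh d f -> vpair b -> d b = 0%N -> polarize a b f = 0.
Proof. by move=> df bv db; have [e1 e2] := mh_deriv0 df bv db; rewrite /polarize e1 e2 !mulr0 addr0. Qed.

Lemma mh_Omega0l d f s t : mh d f -> vpair s -> d s = 0%N -> Omega s t f = 0.
Proof. by move=> df bv db; have [e1 e2] := mh_deriv0 df bv db; rewrite /Omega e1 e2 !mderiv0 subrr. Qed.

Lemma mh_Omega0r d f s t : mh d f -> vpair t -> d t = 0%N -> Omega s t f = 0.
Proof.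
move=> df bv db; have [e1 e2] := mh_deriv0 df bv db.
by rewrite /Omega mderiv_comm [f^`M(s.2)^`M(t.1)]mderiv_comm e1 e2 !mderiv0 subrr.
Qed.

Lemma bool_mul (x : bool) f : (x%:R : {mpoly k[14]}) * f = (x%:R : k) *: f.
Proof. by case: x; rewrite ?mul1r ?scale1r ?mul0r ?scale0r. Qed.

(** The change of degree is stated by adding on both sides, which keeps truncated subtraction out of
    the multidegrees. *)
Lemma mh_polarize1 d d' a b f : vpair a -> vpair b -> a != b ->
  (forall s, vpair s -> d' s + (s == b) = d s + (s == a))%N ->
  mh d f -> mh d' (polarize a b f).
Proof.
move=> av bv ab dd df s sv.
have := polarize_comm f sv sv av bv.
rewrite (df s sv) (islinZ _ _ (islin_polarize a b)) !bool_mul.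
have -> : (s == b)%:R *: polarize a s f = (s == b)%:R *: polarize a b f.
  by case: eqP => [->|]; rewrite ?scale0r.
have -> : (s == a)%:R *: polarize s b f = (s == a)%:R *: polarize a b f.
  by case: eqP => [->|]; rewrite ?scale0r.
rewrite -scalerDl -natrD -dd // natrD scalerDl => e.
by apply: (addIr ((s == b)%:R *: polarize a b f)).
Qed.

Lemma mh_polarize n d d' a b f : vpair a -> vpair b -> a != b ->
  (forall s, vpair s -> d' s + n * (s == b) = d s + n * (s == a))%N ->
  mh d f -> mh d' (iter n (polarize a b) f).
Proof.
move=> av bv ab; elim: n d' => [|n IH] d' dd df.
  by apply: mh_ext df => s sv; have := dd s sv; lia.
have nab s : ~~ ((s == a) && (s == b)).
  by apply/negP => /andP[/eqP-> /eqP e]; move: ab; rewrite e eqxx.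
rewrite iterS; apply: (@mh_polarize1 (fun s => d' s + (s == b) - (s == a))%N) => //.
  move=> s sv; have := dd s sv; have := nab s.
  by case: (s == a); case: (s == b) => //=; lia.
apply: IH df => s sv; have := dd s sv; have := nab s.
by case: (s == a); case: (s == b) => //=; lia.
Qed.
End Operators.

Section CapelliTheory.
Variable k : fieldType.
Hypothesis k_char0 : [pchar k] =i pred0.
Implicit Types (f g h : {mpoly k[14]}) (s t w c : varPair) (d : varPair -> nat).

Lemma mh_Omega n d d' s t f : vpair s -> vpair t -> s != t ->
  (forall c, vpair c -> d' c + n * (c == s) + n * (c == t) = d c)%N ->
  mh d f -> mh d' (iter n (Omega s t) f).
Proof.
move=> sv tv st; elim: n d' => [|n IH] d' dd df.
  by apply: mh_ext df => c cv; have := dd c cv; lia.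
have nst c : ~~ ((c == s) && (c == t)).
  by apply/negP => /andP[/eqP-> /eqP e]; move: st; rewrite e eqxx.
pose d1 c := (d' c + (c == s) + (c == t))%N.
have dg : mh d1 (iter n (Omega s t) f).
  apply: IH => // c cv; rewrite /d1.
  by have := dd c cv; have := nst c; case: (c == s); case: (c == t) => //=; lia.
rewrite iterS; move: dg; set g := iter n _ f => dg c cv.
have := Omega_polarize g sv tv cv cv; rewrite (dg c cv) (islinZ _ _ (islin_Omega s t)) !bool_mul.
have -> : (c == s)%:R *: Omega c t g = (c == s)%:R *: Omega s t g.
  by case: eqP => [->|]; rewrite ?scale0r.
have -> : (c == t)%:R *: Omega s c g = (c == t)%:R *: Omega s t g.
  by case: eqP => [->|]; rewrite ?scale0r.
rewrite /d1 !natrD !scalerDl => e.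
by apply: (addIr ((c == s)%:R *: Omega s t g)); apply: (addIr ((c == t)%:R *: Omega s t g)).
Qed.

Lemma mh_bracket n d d' s t f : vpair s -> vpair t -> s != t ->
  (forall c, vpair c -> d' c = d c + n * (c == s) + n * (c == t))%N ->
  mh d f -> mh d' (bracket k s t ^+ n * f).
Proof.
move=> sv tv st; elim: n d' => [|n IH] d' dd df.
  by rewrite expr0 mul1r; apply: mh_ext df => c cv; have := dd c cv; lia.
pose d1 c := (d c + n * (c == s) + n * (c == t))%N.
have dg : mh d1 (bracket k s t ^+ n * f) by apply: IH.
rewrite exprS -mulrA; move: dg; set g := _ * f => dg c cv.
rewrite polarizeM (polarize_bracket k cv cv sv tv) (dd c cv).
have -> : (c == s)%:R * bracket k c t + (c == t)%:R * bracket k s c =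
   ((c == s)%:R + (c == t)%:R) * bracket k s t.
  rewrite mulrDl; congr (_ + _); first by case: eqP => [->|]; rewrite ?mul0r.
  by case: eqP => [->|]; rewrite ?mul0r.
rewrite (dg c cv) -scalerAr -mulrA mulrDl !bool_mul -!scalerDl; congr (_ *: _).
by rewrite /d1 -!natrD; congr (_%:R); case: (c == s); case: (c == t); lia.
Qed.

(* [Eop s t w q a b] is (s t)^q (s d_w)^a (t d_w)^b and [Lop s t w q a b]
   is its adjoint (w d_t)^b (w d_s)^a Omega_st^q. *)
Definition Eop s t w q a b g : {mpoly k[14]} :=
  bracket k s t ^+ q * iter a (polarize s w) (iter b (polarize t w) g).
Definition Lop s t w q a b f : {mpoly k[14]} :=
  iter b (polarize w t) (iter a (polarize w s) (iter q (Omega s t) f)).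

Lemma islin_Eop s t w q a b : islin (Eop s t w q a b).
Proof.
move=> x u v; rewrite /Eop (islin_iter _ (islin_polarize t w)) (islin_iter _ (islin_polarize s w)).
by rewrite mulrDr scalerAr.
Qed.

Lemma islin_Lop s t w q a b : islin (Lop s t w q a b).
Proof.
move=> x u v; rewrite /Lop (islin_iter _ (islin_Omega s t)) (islin_iter _ (islin_polarize w s)).
by rewrite (islin_iter _ (islin_polarize w t)).
Qed.

Lemma mh_Eop d d' s t w q a b g : vpair s -> vpair t -> vpair w ->
  s != t -> s != w -> t != w ->
  (forall c, vpair c -> d' c + (a + b) * (c == w) = d c + (q + a) * (c == s) + (q + b) * (c == t))%N ->
  mh d g -> mh d' (Eop s t w q a b g).
Proof.
move=> sv tv wv st sw tw dd dg.
pose d1 c := (d c + b * (c == t) - b * (c == w))%N.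
pose d2 c := (d1 c + a * (c == s) - a * (c == w))%N.
have nn c : [&& ~~ ((c == s) && (c == t)), ~~ ((c == s) && (c == w)) & ~~ ((c == t) && (c == w))].
  by apply/and3P; split; apply/negP => /andP[/eqP-> /eqP e]; move: st sw tw; rewrite e eqxx ?andbF.
apply: (@mh_bracket q d2) => //.
  move=> c cv; have := dd c cv; have := nn c; rewrite /d2 /d1.
  by case: (c == s); case: (c == t); case: (c == w) => //=; lia.
apply: (@mh_polarize _ a d1) => //.
  move=> c cv; have := dd c cv; have := nn c; rewrite /d2 /d1.
  by case: (c == s); case: (c == t); case: (c == w) => //=; lia.
apply: (@mh_polarize _ b d) => //.
move=> c cv; have := dd c cv; have := nn c; rewrite /d1.
by case: (c == s); case: (c == t); case: (c == w) => //=; lia.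
Qed.

Lemma mh_Lop d d' s t w q a b f : vpair s -> vpair t -> vpair w ->
  s != t -> s != w -> t != w ->
  (forall c, vpair c -> d c + (a + b) * (c == w) = d' c + (q + a) * (c == s) + (q + b) * (c == t))%N ->
  mh d f -> mh d' (Lop s t w q a b f).
Proof.
move=> sv tv wv st sw tw dd df.
pose d1 c := (d c - q * (c == s) - q * (c == t))%N.
pose d2 c := (d1 c + a * (c == w) - a * (c == s))%N.
have nn c : [&& ~~ ((c == s) && (c == t)), ~~ ((c == s) && (c == w)) & ~~ ((c == t) && (c == w))].
  by apply/and3P; split; apply/negP => /andP[/eqP-> /eqP e]; move: st sw tw; rewrite e eqxx ?andbF.
apply: (@mh_polarize _ b d2); rewrite // 1?eq_sym //.
  move=> c cv; have := dd c cv; have := nn c; rewrite /d2 /d1.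
  by case: (c == s); case: (c == t); case: (c == w) => //=; lia.
apply: (@mh_polarize _ a d1); rewrite // 1?eq_sym //.
  move=> c cv; have := dd c cv; have := nn c; rewrite /d2 /d1.
  by case: (c == s); case: (c == t); case: (c == w) => //=; lia.
apply: (@mh_Omega q d) => //.
move=> c cv; have := dd c cv; have := nn c; rewrite /d1.
by case: (c == s); case: (c == t); case: (c == w) => //=; lia.
Qed.

Lemma sl2op_iter e (F : {mpoly k[14]} -> {mpoly k[14]}) n f :
  (forall g, sl2op e (F g) = F (sl2op e g)) -> sl2op e (iter n F f) = iter n F (sl2op e f).
Proof. by move=> c; apply: iter_comm. Qed.

Lemma sl2op_Eop e s t w q a b g : vpair s -> vpair t -> vpair w ->
  sl2op e (Eop s t w q a b g) = Eop s t w q a b (sl2op e g).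
Proof.
move=> sv tv wv; rewrite /Eop sl2opM sl2opXn ?sl2op_bracket // mul0r add0r.
by rewrite !sl2op_iter // => h; rewrite sl2op_polarize.
Qed.

Lemma sl2op_Lop e s t w q a b g : vpair s -> vpair t -> vpair w ->
  sl2op e (Lop s t w q a b g) = Lop s t w q a b (sl2op e g).
Proof.
move=> sv tv wv; rewrite /Lop.
by rewrite !sl2op_iter // => h; rewrite ?sl2op_polarize ?sl2op_Omega.
Qed.

Lemma fp_polarize s t f g : fp (polarize t s f) g = fp f (polarize s t g).
Proof.
rewrite /polarize !(islinD _ _ (fp_linl g)) !(islinD _ _ (fp_linr f)) /=.
by rewrite !fpXl !fpXr.
Qed.

Lemma fp_bracket s t f g : fp (bracket k s t * f) g = fp f (Omega s t g).
Proof.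
rewrite /bracket /Omega mulrBl (islinB _ _ (fp_linl g)) (islinB _ _ (fp_linr f)) /=.
by rewrite -!mulrA !fpXl.
Qed.

Lemma fp_iter (F G : {mpoly k[14]} -> {mpoly k[14]}) n f g :
  (forall f g, fp (F f) g = fp f (G g)) -> fp (iter n F f) g = fp f (iter n G g).
Proof.
move=> FG; elim: n g => //= n IH g.
by rewrite FG IH -[G (iter n G g)]/(iter n.+1 G g) iterSr.
Qed.

Lemma fp_Eop s t w q a b f g : fp (Eop s t w q a b f) g = fp f (Lop s t w q a b g).
Proof.
rewrite /Eop /Lop.
have -> h : bracket k s t ^+ q * h = iter q (fun x => bracket k s t * x) h.
  by elim: q => [|q IH]; rewrite ?expr0 ?mul1r //= exprS -mulrA IH.
rewrite (fp_iter _ _ _ (fun f g => fp_bracket s t f g)).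
by rewrite !(fp_iter _ _ _ (fun f g => fp_polarize _ _ f g)).
Qed.

Lemma fp_sl2op e f g : fp (sl2op e f) g = fp f (sl2op (~~ e) g).
Proof.
rewrite /sl2op (islin_sum _ _ _ (fp_linl g)) (islin_sum _ _ _ (fp_linr f)) /=.
by apply: eq_bigr => s _; rewrite fpXl fpXr negbK.
Qed.

End CapelliTheory.

(** * The Clebsch-Gordan decomposition *)

Section ClebschGordan.
Variable k : fieldType.
Hypothesis k_char0 : [pchar k] =i pred0.
Implicit Types (f g h : {mpoly k[14]}) (s t w c : varPair) (d : varPair -> nat).

(** The commutator of Omega_st with s d_t is Omega_ss, which is 0. *)
Lemma Omega_polarize_same s t f : vpair s -> vpair t -> s != t ->
  Omega s t f = 0 -> Omega s t (polarize s t f) = 0.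
Proof.
move=> sv tv st O0; rewrite Omega_polarize // O0 OmegaSS eqxx (negbTE st).
by rewrite (islin0 (islin_polarize s t)) mulr0 mul0r !addr0.
Qed.

(** The kernel of Omega is stable under s d_t, so the Capelli identity applies at every stage. At
    current degrees d_s and d_t it contributes the factor d_t (d_s + 1). *)
Lemma capelli_string n d s t f : vpair s -> vpair t -> s != t ->
  mh d f -> (n <= d t)%N -> Omega s t f = 0 ->
  iter n (polarize t s) (iter n (polarize s t) f) = ((d t ^_ n) * (d s + n) ^_ n)%:R *: f.
Proof.
move=> sv tv st df nt O0.
have On j : Omega s t (iter j (polarize s t) f) = 0.
  by elim: j => //= j IH; apply: Omega_polarize_same.
elim: n nt => [|n IH] nt; first by rewrite !ffactn0 scale1r.
rewrite iterSr iterS; set g := iter n (polarize s t) f.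
pose d1 c := (d c + n * (c == s) - n * (c == t))%N.
have nst c : ~~ ((c == s) && (c == t)).
  by apply/negP => /andP[/eqP-> /eqP e]; move: st; rewrite e eqxx.
have dg : mh d1 g.
  apply: (@mh_polarize _ n d) => // c cv; rewrite /d1.
  have : (c == t) -> (n <= d c)%N by move/eqP->; lia.
  by have := nst c; case: (c == s); case: (c == t) => //= _ h; [lia | have := h isT; lia | lia].
rewrite capelli // On mulr0 subr0 (dg s sv) (islinZ _ _ (islin_polarize t t)) (dg t tv).
rewrite scalerA -scalerDl (islinZ _ _ (islin_iter _ (islin_polarize t s))) IH; last lia.
rewrite scalerA -natrM -natrD -natrM; congr (_%:R *: _).
rewrite /d1 !eqxx (negbTE st) [t == s]eq_sym (negbTE st) ffactnSr addnS ffactSS.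
have -> : (d s + n * true - n * false = d s + n)%N by lia.
have -> : (d t + n * false - n * true = d t - n)%N by lia.
ring.
Qed.

(** Each bracket that Omega is moved past adds an Euler term d_s + d_t + 2 at the current degrees;
    the factor is the sum of these. *)
Lemma Omega_brackXn d s t j f : vpair s -> vpair t -> s != t -> mh d f -> Omega s t f = 0 ->
  Omega s t (bracket k s t ^+ j * f) =
  (j * (d s + d t + j + 1))%:R *: (bracket k s t ^+ j.-1 * f).
Proof.
move=> sv tv st df O0; elim: j => [|j IH]; first by rewrite mul0n scale0r mul1r.
have dg : mh (fun c => d c + j * (c == s) + j * (c == t))%N (bracket k s t ^+ j * f).
  by apply: (@mh_bracket _ j d).
rewrite exprS -mulrA Omega_bracket // IH (dg s sv) (dg t tv) /=.
rewrite -scalerAr mulrA -exprS.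
have -> : (j * (d s + d t + j + 1))%:R *: (bracket k s t ^+ j.-1.+1 * f) =
   (j * (d s + d t + j + 1))%:R *: (bracket k s t ^+ j * f) by case: (j) => [|j0]; rewrite ?mul0n ?scale0r.
rewrite -scaler_nat -!scalerDl -!natrD; congr (_%:R *: _).
rewrite !eqxx (negbTE st) [t == s]eq_sym (negbTE st); lia.
Qed.

Lemma Omega_iter_brackXn d s t q f : vpair s -> vpair t -> s != t -> mh d f -> Omega s t f = 0 ->
  forall q', iter q' (Omega s t) (bracket k s t ^+ q * f) =
   ((q ^_ q') * (d s + d t + q + 1) ^_ q')%:R *: (bracket k s t ^+ (q - q') * f).
Proof.
move=> sv tv st df O0; elim=> [|q' IH]; first by rewrite !ffactn0 subn0 scale1r.
rewrite iterS IH (islinZ _ _ (islin_Omega s t)) (Omega_brackXn _ sv tv st df O0) scalerA -natrM.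
rewrite -subnS; case: (leqP q' q) => h; last by rewrite !(ffact_small (_ : q < _)%N) ?mul0n ?scale0r //; lia.
congr (_%:R *: _); rewrite !ffactnSr.
have -> : (d s + d t + q + 1 - q' = d s + d t + (q - q') + 1)%N by lia.
ring.
Qed.

Definition freeOf s f := f^`M(s.1) = 0 /\ f^`M(s.2) = 0.

(** Neither Omega kernel is obviously preserved alone, but the common kernel of Omega_st, Omega_wt
    and Omega_sw is stable under s d_w and t d_w, and it contains every polynomial free of s and
    t. *)
Lemma Omega_Epol s t w a b g : vpair s -> vpair t -> vpair w -> s != t -> s != w -> t != w ->
  freeOf s g -> freeOf t g ->
  Omega s t (iter a (polarize s w) (iter b (polarize t w) g)) = 0 /\
  Omega s w (iter b (polarize t w) g) = 0.
Proof.
move=> sv tv wv st sw tw [s1 s2] [t1 t2].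
pose K f := [/\ Omega s t f = 0, Omega w t f = 0 & Omega s w f = 0].
have Kt f : K f -> K (polarize t w f).
  move=> [h1 h2 h3]; split; rewrite Omega_polarize // ?h1 ?h2 ?h3 ?OmegaSS (islin0 (islin_polarize t w));
    by rewrite ?mulr0 ?addr0 // [t == s]eq_sym (negbTE st) (negbTE tw) !mul0r !addr0.
have Ks f : K f -> K (polarize s w f).
  move=> [h1 h2 h3]; split; rewrite Omega_polarize // ?h1 ?h2 ?h3 ?OmegaSS (islin0 (islin_polarize s w));
    by rewrite ?mulr0 ?addr0 // (negbTE st) (negbTE sw) !mul0r !addr0.
have K0 : K g.
  split; rewrite /Omega.
  - by rewrite s1 s2 !mderiv0 subrr.
  - by rewrite mderiv_comm [g^`M(w.2)^`M(t.1)]mderiv_comm t1 t2 !mderiv0 subrr.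
  - by rewrite s1 s2 !mderiv0 subrr.
have Kb n : K (iter n (polarize t w) g) by elim: n => //= n; apply: Kt.
split; last by case: (Kb b).
have [] // : K (iter a (polarize s w) (iter b (polarize t w) g)).
by elim: a => //= n; apply: Ks.
Qed.

(** The squared norm, for the apolar form, of the Clebsch-Gordan embedding [Eop] of forms of order a
    + b. *)
Definition cgNorm q a b := (q`! * (a + b + q + 1) ^_ q * (a`! * b`! * (a + b)`!))%N.

Lemma Lop_Eop d s t w q a b g : vpair s -> vpair t -> vpair w -> s != t -> s != w -> t != w ->
  mh d g -> d s = 0%N -> d t = 0%N -> d w = (a + b)%N ->
  Lop s t w q a b (Eop s t w q a b g) = (cgNorm q a b)%:R *: g.
Proof.
move=> sv tv wv st sw tw dg ds dt dw.
have sf : freeOf s g := mh_deriv0 k_char0 dg sv ds.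
have tf : freeOf t g := mh_deriv0 k_char0 dg tv dt.
have [O1 O2] := Omega_Epol a b sv tv wv st sw tw sf tf.
pose d1 c := (d c + b * (c == t) - b * (c == w))%N.
pose d2 c := (d1 c + a * (c == s) - a * (c == w))%N.
have dh1 : mh d1 (iter b (polarize t w) g).
  apply: (@mh_polarize _ b d) => // c cv; rewrite /d1.
  have [->|cw] := eqVneq c w; last by rewrite !muln0 subn0 addn0.
  by rewrite dw [w == t]eq_sym (negbTE tw); lia.
have dh2 : mh d2 (iter a (polarize s w) (iter b (polarize t w) g)).
  apply: (@mh_polarize _ a d1) => // c cv; rewrite /d2.
  have [->|cw] := eqVneq c w; last by rewrite !muln0 subn0 addn0.
  by rewrite /d1 eqxx dw [w == t]eq_sym (negbTE tw) [w == s]eq_sym (negbTE sw); lia.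
have d1w : d1 w = a by rewrite /d1 eqxx dw [w == t]eq_sym (negbTE tw); lia.
have d1s : d1 s = 0%N by rewrite /d1 ds (negbTE st) (negbTE sw) !muln0.
have d1t : d1 t = b by rewrite /d1 dt eqxx (negbTE tw); lia.
have d2s : d2 s = a by rewrite /d2 d1s eqxx (negbTE sw); lia.
have d2t : d2 t = b by rewrite /d2 d1t [t == s]eq_sym (negbTE st) (negbTE tw); lia.
rewrite /Lop /Eop (Omega_iter_brackXn _ sv tv st dh2 O1) subnn expr0 mul1r d2s d2t ffactnn.
rewrite !(islinZ _ _ (islin_iter _ (islin_polarize _ _))).
rewrite (capelli_string sv wv sw dh1) ?d1w // d1s add0n !ffactnn.
rewrite (islinZ _ _ (islin_iter _ (islin_polarize _ _))).
rewrite (capelli_string tv wv tw dg) ?dw ?dt //; first last.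
- by case: tf => t1 t2; rewrite /Omega t1 t2 !mderiv0 subrr.
- by lia.
rewrite !scalerA -!natrM; congr (_%:R *: _); rewrite add0n ffactnn /cgNorm.
by rewrite -(ffact_fact (leq_addl a b)) addnK; ring.
Qed.

(** For a = d s + 1 and b = d t + 1 this is, up to factorials, restriction of (s t) f to s = t = w,
    where the bracket vanishes. *)
Lemma polarize_iter_brack d s t w a b f : vpair s -> vpair t -> vpair w ->
  s != t -> s != w -> t != w -> mh d f -> (d s < a)%N -> (d t < b)%N ->
  iter b (polarize w t) (iter a (polarize w s) (bracket k s t * f)) = 0.
Proof.
move=> sv tv wv st sw tw df ha hb.
have kill u x y h : vpair u -> u != w -> mh y h -> (y u < x)%N -> iter x (polarize w u) h = 0.
  move=> uv uw dh hx; have -> : x = ((x - (y u).+1) + (y u).+1)%N by lia.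
  rewrite iterD iterS.
  pose y1 c := (y c + y u * (c == w) - y u * (c == u))%N.
  have d1 : mh y1 (iter (y u) (polarize w u) h).
    apply: (@mh_polarize _ _ y); rewrite // 1?eq_sym // => c cv; rewrite /y1.
    have [->|cu] := eqVneq c u; last by rewrite !muln0 subn0 addn0.
    by rewrite (negbTE uw); lia.
  rewrite (mh_polarize0 k_char0 _ d1) //; last by rewrite /y1 eqxx (negbTE uw); lia.
  by rewrite iter0 //; apply: islin_polarize.
have wt0 : polarize w s (bracket k w t) = 0.
  rewrite polarize_bracket // (negbTE sw) (negbTE st) !mulr0n; ring.
have wt1 : polarize w t (bracket k w t) = 0.
  rewrite polarize_bracket // (negbTE tw) eqxx /bracket mulr1n mulr0n; ring.
have st1 : polarize w s (bracket k s t) = bracket k w t.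
  rewrite polarize_bracket // eqxx (negbTE st) mulr0n mulr1n; ring.
(* The bracket absorbs at most one w d_s, which turns (s t) into (w t); the latter is constant for
   both w d_s and w d_t. *)
have E x : iter x (polarize w s) (bracket k s t * f) =
    bracket k s t * iter x (polarize w s) f + x%:R *: (bracket k w t * iter x.-1 (polarize w s) f).
  elim: x => [|x IH]; first by rewrite scale0r addr0.
  rewrite iterS IH (islinD _ _ (islin_polarize w s)) (islinZ _ _ (islin_polarize w s)) !polarizeM wt0 st1 mul0r add0r.
  rewrite [_ + bracket k s t * _]addrC -addrA; congr (_ + _).
  case: x {IH} => [|x]; first by rewrite mulr0n mulr1n scale0r addr0 scale1r /=.
  have -> : x.+2%:R = x.+1%:R + 1 :> k by rewrite -natr1.
  by rewrite scalerDl scale1r [RHS]addrC.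
rewrite E (kill s a d f) // mulr0 add0r (islinZ _ _ (islin_iter _ (islin_polarize _ _))).
have P x h : iter x (polarize w t) (bracket k w t * h) = bracket k w t * iter x (polarize w t) h.
  by elim: x => //= x ->; rewrite polarizeM wt1 mul0r add0r.
rewrite P.
have [le|gt] := leqP a.-1 (d s); last first.
  by rewrite (kill s a.-1 d f) // iter0 ?mulr0 ?scaler0 //; apply: islin_polarize.
pose y1 c := (d c + a.-1 * (c == w) - a.-1 * (c == s))%N.
rewrite (kill t b y1) ?mulr0 ?scaler0 //; last by rewrite /y1 (negbTE tw) [t == s]eq_sym (negbTE st); lia.
apply: (@mh_polarize _ _ d); rewrite // 1?eq_sym // => c cv; rewrite /y1.
have [->|cu] := eqVneq c s; last by rewrite !muln0 subn0 addn0.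
by rewrite (negbTE sw); lia.
Qed.

(** If q < q', the power of Omega kills the bracket power. If q > q', a factor (s t) remains, and
    full polarization to the diagonal kills it. *)
Lemma Lop_Eop_neq d s t w q q' a a' b b' g : vpair s -> vpair t -> vpair w ->
  s != t -> s != w -> t != w ->
  mh d g -> d s = 0%N -> d t = 0%N -> d w = (a + b)%N -> q != q' ->
  (a' + q' = a + q)%N -> (b' + q' = b + q)%N ->
  Lop s t w q' a' b' (Eop s t w q a b g) = 0.
Proof.
move=> sv tv wv st sw tw dg ds dt dw qq aq bq.
have sf : freeOf s g := mh_deriv0 k_char0 dg sv ds.
have tf : freeOf t g := mh_deriv0 k_char0 dg tv dt.
have [O1 O2] := Omega_Epol a b sv tv wv st sw tw sf tf.
pose d2 c := (d c - (a + b) * (c == w) + a * (c == s) + b * (c == t))%N.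
set h := iter a (polarize s w) (iter b (polarize t w) g) in O1.
have dh2 : mh d2 h.
  pose d1 c := (d c + b * (c == t) - b * (c == w))%N.
  apply: (@mh_polarize _ a d1) => // [c cv|].
    rewrite /d2 /d1; have [->|cw] := eqVneq c w; last by rewrite !muln0 !subn0 addn0 addnAC.
    by rewrite dw [w == t]eq_sym (negbTE tw) [w == s]eq_sym (negbTE sw); lia.
  apply: (@mh_polarize _ b d) => // c cv; rewrite /d1.
  have [->|cw] := eqVneq c w; last by rewrite !muln0 subn0 addn0.
  by rewrite dw [w == t]eq_sym (negbTE tw); lia.
rewrite /Lop /Eop -/h (Omega_iter_brackXn _ sv tv st dh2 O1).
rewrite !(islinZ _ _ (islin_iter _ (islin_polarize _ _))).
have [lt|ge] := ltnP q q'; first by rewrite (ffact_small lt) mul0n scale0r.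
have -> : (q - q' = (q - q').-1.+1)%N by move/eqP: qq; lia.
rewrite exprS -mulrA.
pose d3 c := (d2 c + (q - q').-1 * (c == s) + (q - q').-1 * (c == t))%N.
have dh3 : mh d3 (bracket k s t ^+ (q - q').-1 * h) by apply: (@mh_bracket _ _ d2).
have qq' : (q' < q)%N by rewrite ltn_neqAle eq_sym qq.
have s3 : (d3 s < a')%N.
  by rewrite /d3 /d2 !eqxx ds (negbTE st) (negbTE sw); lia.
have t3 : (d3 t < b')%N.
  by rewrite /d3 /d2 !eqxx dt [t == s]eq_sym (negbTE st) (negbTE tw); lia.
by rewrite (polarize_iter_brack sv tv wv st sw tw dh3) ?scaler0.
Qed.

(* The transvectants of all indices determine a bihomogeneous polynomial: by
   the Capelli identity, restriction to the diagonal is injective on the kernel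
   of Omega. *)
Lemma Lop_inj d s t w f : vpair s -> vpair t -> vpair w -> s != t -> s != w -> t != w ->
  mh d f -> d w = 0%N ->
  (forall q, (q <= minn (d s) (d t))%N -> Lop s t w q (d s - q) (d t - q) f = 0) -> f = 0.
Proof.
move=> sv tv wv st sw tw df dw L0.
pose dq q c := (d c - q * (c == s) - q * (c == t))%N.
have dO q : (q <= minn (d s) (d t))%N -> mh (dq q) (iter q (Omega s t) f).
  move=> hq; apply: (@mh_Omega _ _ d) => // c cv; rewrite /dq.
  have [->|cs] := eqVneq c s; first by rewrite (negbTE st); lia.
  by have [->|ct] := eqVneq c t; lia.
have dqs q : dq q s = (d s - q)%N by rewrite /dq eqxx (negbTE st); lia.
have dqt q : dq q t = (d t - q)%N by rewrite /dq eqxx [t == s]eq_sym (negbTE st); lia.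
have dqw q : dq q w = 0%N by rewrite /dq dw [w == s]eq_sym (negbTE sw) [w == t]eq_sym (negbTE tw).
(* Descending induction on the power of Omega, starting above the degree. At each stage Omega^q f is
   killed by Omega, so the Capelli identity undoes the polarizations t to w and then s to w, whose
   result vanishes by hypothesis. *)
suff H n : (n <= (minn (d s) (d t)).+1)%N -> iter ((minn (d s) (d t)).+1 - n) (Omega s t) f = 0.
  by have := H _ (leqnn _); rewrite subnn.
elim: n => [_|n IH hn].
  rewrite subn0 iterS.
  case/orP: (leq_total (d s) (d t)) => h.
    rewrite (mh_Omega0l k_char0 _ (dO _ (leqnn _))) // dqs; lia.
  rewrite (mh_Omega0r k_char0 _ (dO _ (leqnn _))) // dqt; lia.
set q := ((minn (d s) (d t)).+1 - n.+1)%N.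
have hq : (q <= minn (d s) (d t))%N by rewrite /q; lia.
have hq1 : ((minn (d s) (d t)).+1 - n = q.+1)%N by rewrite /q; lia.
have := IH (ltnW hn); rewrite hq1 iterS => O0.
have := L0 q hq; rewrite /Lop.
move: O0 (dO q hq); set H := iter q (Omega s t) f => O0 dH L0q.
have ws : w != s by rewrite eq_sym.
have wt : w != t by rewrite eq_sym.
have OwH : Omega w t H = 0 by apply: (mh_Omega0l k_char0 _ dH).
pose H1 := iter (d s - q) (polarize w s) H.
have OK1 : Omega w t H1 = 0 /\ Omega s t H1 = 0.
  rewrite /H1; elim: (d s - q)%N => //= x [e1 e2].
  rewrite !Omega_polarize // e1 e2 !(islin0 (islin_polarize w s)) !eqxx (negbTE ws) (negbTE wt).
  by rewrite mulr1n mulr0n !(mul1r, mul0r, addr0).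
pose d1 c := (dq q c + (d s - q) * (c == w) - (d s - q) * (c == s))%N.
have dH1 : mh d1 H1.
  apply: (@mh_polarize _ _ (dq q)) => // c cv; rewrite /d1.
  have [->|cs] := eqVneq c s; last by rewrite !muln0 subn0 addn0.
  by rewrite (negbTE sw) dqs; lia.
have d1t : d1 t = (d t - q)%N by rewrite /d1 dqt (negbTE tw) [t == s]eq_sym (negbTE st) !muln0 addn0 subn0.
have d1w : d1 w = (d s - q)%N by rewrite /d1 dqw eqxx (negbTE ws) muln0 muln1 subn0.
have E1 : H1 = 0.
  have := capelli_string wv tv wt dH1 (leqnn _) OK1.1; rewrite d1t L0q iter0; last exact: islin_polarize.
  move/esym/eqP; rewrite scaler_eq0 => /orP[|/eqP //].
  by rewrite ((pcharf0P k).1 k_char0) ffactnn muln_eq0 -!leqn0 leqNgt fact_gt0 /= leqNgt ffact_gt0 leq_addl.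
have OwH' : Omega w s H = 0 by apply: (mh_Omega0l k_char0 _ dH).
have := capelli_string wv sv ws dH (leqnn _) OwH'; rewrite dqs -/H1 E1 iter0; last exact: islin_polarize.
move/esym/eqP; rewrite scaler_eq0 => /orP[|/eqP //].
by rewrite ((pcharf0P k).1 k_char0) ffactnn muln_eq0 -!leqn0 leqNgt fact_gt0 /= leqNgt ffact_gt0 leq_addl.
Qed.

Lemma natk_inj x y : x%:R = y%:R :> k -> x = y.
Proof.
wlog xy : x y / (x <= y)%N => [H|] e.
  by case/orP: (leq_total x y) => h; [apply: H | apply/esym/H].
have /eqP : (y - x)%:R = 0 :> k by rewrite natrB // e subrr.
by rewrite ((pcharf0P k).1 k_char0) => /eqP; lia.
Qed.

Lemma pair_cover (i : 'I_14) : exists2 s, vpair s & (i == s.1) || (i == s.2).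
Proof.
case: i => [[|[|[|[|[|[|[|[|[|[|[|[|[|[|i]]]]]]]]]]]]]] hi] //;
 first [by exists vx | by exists vy | by exists vz | by exists vp | by exists vq | by exists vu | by exists vv].
Qed.

(** Only z occurs, so the lowering operator is z_2 d/dz_1. Its kernel is free of z_1, and the degree
    fixes the power of z_2. *)
Lemma lowest_weight d f : mh d f -> (forall s, vpair s -> s != vz -> d s = 0%N) ->
  sl2op false f = 0 -> exists x : k, f = x *: 'X_(vz.2) ^+ d vz.
Proof.
move=> df d0 F0.
have fr s : vpair s -> s != vz -> freeOf s f.
  by move=> sv sz; apply: (mh_deriv0 k_char0 df sv); apply: d0.
have F1 : 'X_(vz.2) * f^`M(vz.1) = 0.
  rewrite -[RHS]F0 /sl2op (bigD1_seq vz) //= big_seq_cond big1 ?addr0 // => s /andP[sv sz].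
  by case: (fr s sv sz) => e1 e2; rewrite /co /= e1 mulr0.
have z1 : f^`M(vz.1) = 0.
  move/eqP: F1; rewrite mulf_eq0 => /orP[/eqP X0|/eqP //].
  by have := congr1 (mcoeff U_(vz.2)) X0; rewrite mcoeffXU eqxx mcoeff0 => /eqP; rewrite oner_eq0.
have m0 (i : 'I_14) : f^`M(i) = 0 -> forall m, f@_m != 0 -> m i = 0%N.
  move=> fi m fm; have := mcoeff_XD k_char0 i f m; rewrite fi mulr0 mcoeff0 => /esym/eqP.
  by rewrite mulf_eq0 (negbTE fm) orbF ((pcharf0P k).1 k_char0) => /eqP.
have mz m : f@_m != 0 -> m = (U_(vz.2) *+ d vz)%MM.
  move=> fm; apply/mnmP => i; rewrite mulmnE mnm1E.
  have hs s : vpair s -> s != vz -> (m s.1 = 0%N) /\ (m s.2 = 0%N).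
    by move=> sv sz; case: (fr s sv sz) => e1 e2; split; apply: m0.
  have hz1 := m0 _ z1 m fm.
  have hz2 : m vz.2 = d vz.
    have := congr1 (mcoeff m) (df vz isT).
    rewrite /polarize z1 mulr0 add0r (mcoeff_XD k_char0) mcoeffZ.
    by move/(mulIf fm)/natk_inj.
  have [s sv] := pair_cover i.
  have [->|sz] := eqVneq s vz.
    by case/orP => /eqP->; [rewrite hz1 | rewrite hz2 eqxx mul1n].
  have [e1 e2] := hs s sv sz; have [_ c2 c3 _] := @vpair_coord vz s isT sv.
  have [_ _ _ c4] := @vpair_coord vz s isT sv.
  by case/orP => /eqP->; [rewrite e1 c4 | rewrite e2 c2 eq_sym (negbTE sz)].
exists (f@_(U_(vz.2) *+ d vz)); apply/mpolyP => m; rewrite mcoeffZ mcoeffXn.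
case: eqP => [<-|nm]; first by rewrite mulr1.
by rewrite mulr0; apply/eqP; case: (eqVneq f@_m 0) => // /mz e; case: nm.
Qed.

End ClebschGordan.

(** * The endomorphism xi *)

Section Substitution.
Variable k : fieldType.
Hypothesis k_char0 : [pchar k] =i pred0.
Implicit Types (f g h : {mpoly k[14]}) (s t w c : varPair) (d : varPair -> nat).

(* Restricting to s = t turns t d_s into the Euler operator of s. *)
Lemma subst_polarize (phi : {mpoly k[14]} -> {mpoly k[14]}) n d s t f :
  islin phi -> (forall f g, phi (f * g) = phi f * phi g) ->
  phi 'X_(t.1) = phi 'X_(s.1) -> phi 'X_(t.2) = phi 'X_(s.2) ->
  vpair s -> vpair t -> t != s -> mh d f -> d s = n ->
  phi (iter n (polarize t s) f) = n`!%:R *: phi f.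
Proof.
move=> lphi mphi e1 e2 sv tv ts.
elim: n d f => [|n IH] d f df ds; first by rewrite scale1r.
rewrite iterSr (IH (fun c => d c + (c == t) - (c == s))%N); first last.
- by rewrite eqxx [s == t]eq_sym (negbTE ts) ds; lia.
- apply: (@mh_polarize1 _ d) => // c cv.
  have [->|cs] := eqVneq c s; last by rewrite subn0 addn0.
  by rewrite [s == t]eq_sym (negbTE ts) ds; lia.
have -> : phi (polarize t s f) = phi (polarize s s f).
  by rewrite /polarize !(islinD _ _ lphi) !mphi e1 e2.
by rewrite (df s sv) ds (islinZ _ _ lphi) scalerA -natrM factS mulnC.
Qed.

Lemma mcoeff_free f s m : freeOf s f -> f@_m != 0 -> (m s.1 = 0%N) /\ (m s.2 = 0%N).
Proof.
case=> e1 e2 fm; split; apply/eqP; rewrite -((pcharf0P k).1 k_char0).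
  have := mcoeff_XD k_char0 s.1 f m; rewrite e1 mulr0 mcoeff0 => /esym/eqP.
  by rewrite mulf_eq0 (negbTE fm) orbF.
have := mcoeff_XD k_char0 s.2 f m; rewrite e2 mulr0 mcoeff0 => /esym/eqP.
by rewrite mulf_eq0 (negbTE fm) orbF.
Qed.

Lemma comp_mpoly_fix f (T : 14.-tuple {mpoly k[14]}) :
  (forall s, vpair s -> freeOf s f \/ (tnth T s.1 = 'X_(s.1) /\ tnth T s.2 = 'X_(s.2))) ->
  f \mPo T = f.
Proof.
move=> H; rewrite comp_mpolyE [RHS]mpolyE big_seq [RHS]big_seq; apply: eq_bigr => m.
rewrite mcoeff_msupp => fm; rewrite mpolyXE_id; congr (_ *: _); apply: eq_bigr => i _.
have [s sv si] := pair_cover i.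
case: (H s sv) => [fr|[e1 e2]]; last by case/orP: si => /eqP->; rewrite ?e1 ?e2.
by have [e1 e2] := mcoeff_free fr fm; case/orP: si => /eqP->; rewrite ?e1 ?e2.
Qed.

Lemma islin_substXY : islin (@substXY k).
Proof. by move=> x u v; rewrite /substXY comp_mpolyD comp_mpolyZ. Qed.

Lemma substXYM f g : substXY (f * g) = substXY f * substXY g.
Proof. by rewrite /substXY rmorphM. Qed.

(** The final substitution followed by the embedding of binary forms, so that it can be compared
    with operators on the 14-variable ring. *)
Definition substZZ f := toZ (substZ f).

Lemma islin_substZ : islin (@substZ k).
Proof. by move=> x u v; rewrite /substZ comp_mpolyD comp_mpolyZ. Qed.

Lemma islin_toZ : islin (@toZ k).
Proof. by move=> x u v; rewrite /toZ comp_mpolyD comp_mpolyZ. Qed.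

Lemma islin_substZZ : islin substZZ.
Proof. exact: islin_comp islin_toZ islin_substZ. Qed.

Lemma substZZM f g : substZZ (f * g) = substZZ f * substZZ g.
Proof. by rewrite /substZZ /substZ /toZ !rmorphM. Qed.

Lemma comp_mpolyXt (n m : nat) (T : n.-tuple {mpoly k[m]}) i : 'X_i \mPo T = tnth T i.
Proof. by rewrite comp_mpolyXU (tnth_nth 0). Qed.

Lemma substZZ_X s : vpair s -> substZZ 'X_(s.1) = 'X_(vz.1) /\ substZZ 'X_(s.2) = 'X_(vz.2).
Proof.
move: s; apply: vpairP; rewrite /substZZ /substZ /toZ.
by split; [ | | |split]; split; rewrite comp_mpolyXt /tnth /= comp_mpolyXt.
Qed.

Lemma substZZE f : substZZ f = f \mPo [tuple 'X_(if odd i then vz.2 else vz.1) | i < 14].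
Proof.
have lin T : islin (fun f : {mpoly k[14]} => f \mPo T : {mpoly k[14]}).
  by move=> x u v; rewrite comp_mpolyD comp_mpolyZ.
rewrite [f]mpolyE (islin_sum _ _ _ islin_substZZ) (islin_sum _ _ _ (lin _)); apply: eq_bigr => m _.
rewrite (islinZ _ _ islin_substZZ) comp_mpolyZ; congr (_ *: _).
rewrite comp_mpolyX mpolyXE_id.
rewrite /substZZ /substZ /toZ !rmorph_prod; apply: eq_bigr => i _ /=.
rewrite !rmorphXn /= tnth_mktuple; congr (_ ^+ _).
have [s sv] := pair_cover i; have := substZZ_X sv.
rewrite /substZZ /substZ /toZ => -[e1 e2] /orP[] /eqP ->; rewrite ?e1 ?e2.
  by move: s sv {e1 e2}; apply: vpairP.
by move: s sv {e1 e2}; apply: vpairP.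
Qed.

Lemma substZZ_id f : (forall s, vpair s -> s != vz -> freeOf s f) -> substZZ f = f.
Proof.
move=> fr; rewrite substZZE comp_mpoly_fix // => s sv.
have [->|sz] := eqVneq s vz; last by left; apply: fr.
by right; rewrite !tnth_mktuple.
Qed.

Lemma toZK : cancel (@toZ k) (@substZ k).
Proof.
move=> f; rewrite -[RHS]comp_mpoly_id.
have lin T : islin (fun f : {mpoly k[2]} => f \mPo T : {mpoly k[2]}).
  by move=> x u v; rewrite comp_mpolyD comp_mpolyZ.
have lin2 : islin (fun f : {mpoly k[2]} => substZ (toZ f)) := islin_comp islin_substZ islin_toZ.
rewrite [f]mpolyE (islin_sum _ _ _ lin2) (islin_sum _ _ _ (lin _)); apply: eq_bigr => m _.
rewrite (islinZ _ _ lin2) (islinZ _ _ (lin _)); congr (_ *: _).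
rewrite comp_mpolyX mpolyXE_id.
rewrite /substZ /toZ !rmorph_prod; apply: eq_bigr => i _ /=.
rewrite !rmorphXn /= tnth_mktuple; congr (_ ^+ _).
by case: i => [[|[|i]] hi] //; rewrite !comp_mpolyXt /=; congr ('X_ _); apply: val_inj.
Qed.

End Substitution.

Lemma deg7E x y z p q u v :
  (deg7 x y z p q u v vx = x) * (deg7 x y z p q u v vy = y) * (deg7 x y z p q u v vz = z) *
  (deg7 x y z p q u v vp = p) * (deg7 x y z p q u v vq = q) * (deg7 x y z p q u v vu = u) *
  (deg7 x y z p q u v vv = v).
Proof. by []. Qed.

Ltac vpairs := apply: vpairP; split; [ | | | split]; rewrite ?deg7E;
  repeat match goal with |- context [nat_of_bool (?a == ?b)] =>
    let e := eval vm_compute in (a == b) in change (a == b) with e end;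
  rewrite /= ?muln0 ?muln1 ?addn0 ?add0n; try lia.

(** * The composition of couplings underlying xi *)

Section Network.
Variable k : fieldType.
Hypothesis k_char0 : [pchar k] =i pred0.
Implicit Types (f g h F : {mpoly k[14]}) (s t w c : varPair) (d : varPair -> nat).

Variables m n i j K K' M N cc al be mi mj ni nj tt Pt Qt : nat.
Hypotheses (mE : (M + K)%N = m) (nE : (N + K')%N = n) (alE : (al + cc)%N = (M + M)%N)
  (beE : (be + cc)%N = (N + N)%N)
  (miE : (mi + i)%N = m) (mjE : (mj + j)%N = m) (niE : (ni + i)%N = n) (njE : (nj + j)%N = n)
  (PE : (Pt + tt)%N = (mi + ni)%N) (QE : (Qt + tt)%N = (mj + nj)%N) (DE : (al + be)%N = (Pt + Qt)%N).

(* With K = 2a+1, K' = 2b+1, M = m-K, N = n-K' and cc = r-K-K', up to constants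
   iota1 is step (1) of the definition of xi, iota2 steps (2)-(3) and proj steps
   (4)-(5); projd is the adjoint of proj. *)
Definition iota2 g := Eop vp vq vx K M M (Eop vu vv vy K' N N g).
Definition iota1 g := Eop vx vy vz cc al be g.
Definition proj F :=
  Lop vx vy vz tt Pt Qt (Lop vq vv vy j mj nj (Lop vp vu vx i mi ni F)).
Definition projd f :=
  Eop vp vu vx i mi ni (Eop vq vv vy j mj nj (Eop vx vy vz tt Pt Qt f)).

Lemma fp_projd f F : fp (projd f) F = fp f (proj F).
Proof. by rewrite /projd /proj !fp_Eop. Qed.

Lemma islin_iota1 : islin iota1. Proof. exact: islin_Eop. Qed.
Lemma islin_iota2 : islin iota2. Proof. exact: islin_comp (islin_Eop _ _ _ _ _ _) (islin_Eop _ _ _ _ _ _). Qed.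
Lemma islin_proj : islin proj.
Proof. exact: islin_comp (islin_Lop _ _ _ _ _ _) (islin_comp (islin_Lop _ _ _ _ _ _) (islin_Lop _ _ _ _ _ _)). Qed.
Lemma islin_projd : islin projd.
Proof. exact: islin_comp (islin_Eop _ _ _ _ _ _) (islin_comp (islin_Eop _ _ _ _ _ _) (islin_Eop _ _ _ _ _ _)). Qed.

Lemma sl2op_iota1 e f : sl2op e (iota1 f) = iota1 (sl2op e f). Proof. exact: sl2op_Eop. Qed.
Lemma sl2op_iota2 e f : sl2op e (iota2 f) = iota2 (sl2op e f).
Proof. by rewrite /iota2 !sl2op_Eop. Qed.
Lemma sl2op_proj e f : sl2op e (proj f) = proj (sl2op e f).
Proof. by rewrite /proj !sl2op_Lop. Qed.
Lemma sl2op_projd e f : sl2op e (projd f) = projd (sl2op e f).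
Proof. by rewrite /projd !sl2op_Eop. Qed.

Lemma mh_iota1 f : mh (deg7 0 0 (al + be) 0 0 0 0) f -> mh (deg7 (M + M) (N + N) 0 0 0 0 0) (iota1 f).
Proof. clear - alE beE. by apply: mh_Eop => //; vpairs. Qed.

Lemma mh_iota2 g : mh (deg7 (M + M) (N + N) 0 0 0 0 0) g -> mh (deg7 0 0 0 m m n n) (iota2 g).
Proof. clear - mE nE.
move=> dg; apply: (@mh_Eop _ (deg7 (M + M) 0 0 0 0 n n)) => //; first by vpairs.
by apply: mh_Eop dg => //; vpairs.
Qed.

Lemma mh_projR F : mh (deg7 0 0 0 m m n n) F ->
  mh (deg7 (mi + ni) (mj + nj) 0 0 0 0 0) (Lop vq vv vy j mj nj (Lop vp vu vx i mi ni F)).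
Proof. clear - miE mjE niE njE.
move=> dF; apply: (@mh_Lop _ (deg7 (mi + ni) 0 0 0 m 0 n)) => //; first by vpairs.
by apply: mh_Lop dF => //; vpairs.
Qed.

Lemma mh_proj F : mh (deg7 0 0 0 m m n n) F -> mh (deg7 0 0 (Pt + Qt) 0 0 0 0) (proj F).
Proof. clear - miE mjE niE njE PE QE. by move=> /mh_projR; apply: mh_Lop => //; vpairs. Qed.

Lemma mh_projd f : mh (deg7 0 0 (Pt + Qt) 0 0 0 0) f -> mh (deg7 0 0 0 m m n n) (projd f).
Proof. clear - miE mjE niE njE PE QE.
move=> df; apply: (@mh_Eop _ (deg7 (mi + ni) 0 0 0 m 0 n)) => //; first by vpairs.
apply: (@mh_Eop _ (deg7 (mi + ni) (mj + nj) 0 0 0 0 0)) => //; first by vpairs.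
by apply: mh_Eop df => //; vpairs.
Qed.

Lemma Omega_comm s t s' t' f : Omega s t (Omega s' t' f) = Omega s' t' (Omega s t f).
Proof.
rewrite /Omega !mderivB.
have E a b x y : f^`M(a)^`M(b)^`M(x)^`M(y) = f^`M(x)^`M(y)^`M(a)^`M(b).
  by rewrite [f^`M(a)^`M(b)^`M(x)]mderiv_comm [f^`M(a)^`M(x)]mderiv_comm
     [f^`M(x)^`M(a)^`M(b)^`M(y)]mderiv_comm [f^`M(x)^`M(a)^`M(y)]mderiv_comm.
by rewrite (E s'.1 t'.2 s.1 t.2) (E s'.2 t'.1 s.1 t.2) (E s'.1 t'.2 s.2 t.1) (E s'.2 t'.1 s.2 t.1); ring.
Qed.

(** This is the order of step (4), where both powers of Omega act before any variables are
    identified. Operators on disjoint pairs commute. *)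
Lemma Lop_OmegaE F : Lop vq vv vy j mj nj (Lop vp vu vx i mi ni F) =
  iter nj (polarize vy vv) (iter mj (polarize vy vq) (iter ni (polarize vx vu) (iter mi (polarize vx vp)
    (iter i (Omega vp vu) (iter j (Omega vq vv) F))))).
Proof.
rewrite /Lop; congr (iter nj _ (iter mj _ _)).
have OP t f : t = vp \/ t = vu -> Omega vq vv (polarize vx t f) = polarize vx t (Omega vq vv f).
  by move=> e; rewrite Omega_polarize //; [rewrite /= !mul0r !addr0 | case: e => ->].
have P1 n1 f : iter j (Omega vq vv) (iter n1 (polarize vx vu) f) = iter n1 (polarize vx vu) (iter j (Omega vq vv) f).
  by elim: j => //= j0 ->; apply: iter_comm => g; apply: OP; right.
have P2 n1 f : iter j (Omega vq vv) (iter n1 (polarize vx vp) f) = iter n1 (polarize vx vp) (iter j (Omega vq vv) f).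
  by elim: j => //= j0 ->; apply: iter_comm => g; apply: OP; left.
have P3 n1 f : iter j (Omega vq vv) (iter n1 (Omega vp vu) f) = iter n1 (Omega vp vu) (iter j (Omega vq vv) f).
  by elim: j => //= j0 ->; apply: iter_comm => g; apply: Omega_comm.
by rewrite P1 P2 P3.
Qed.

(** Polarizing away the full degree of a pair is a substitution times a factorial; six pairs are
    polarized away, whence six factorials. *)
Lemma subst_proj F : mh (deg7 0 0 0 m m n n) F ->
  proj F = (mi`! * ni`! * mj`! * nj`! * Pt`! * Qt`!)%:R *:
  substZZ (iter tt (Omega vx vy) (substXY (iter i (Omega vp vu) (iter j (Omega vq vv) F)))).
Proof. clear - k_char0 miE mjE niE njE PE QE.
move=> dF; have dR := mh_projR dF; have dp := mh_proj dF.
move: dR dp; rewrite /proj Lop_OmegaE; set F1 := iter i _ _; set R := iter nj _ _ => dR dp.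
have dF1 : mh (deg7 0 0 0 mi mj ni nj) F1.
  apply: (@mh_Omega _ i (deg7 0 0 0 m mj n nj)) => //; first by vpairs.
  by apply: mh_Omega dF => //; vpairs.
have RE : R = (mi`! * ni`! * mj`! * nj`!)%:R *: substXY F1.
  (* R involves only x and y and is fixed by the substitution, under which the polarizations inside
     R can be evaluated. *)
  have <- : substXY R = R.
    apply: (comp_mpoly_fix k_char0).
    apply: vpairP; split; [right|right|right|split; left]; rewrite ?(tnth_nth 0) //;
      exact: (mh_deriv0 k_char0 dR).
  have X1 : substXY 'X_(vx.1) = substXY 'X_(vp.1) :> {mpoly k[14]} by rewrite /substXY !comp_mpolyXt.
  have d1 : mh (deg7 mi 0 0 0 mj ni nj) (iter mi (polarize vx vp) F1).
    by apply: mh_polarize dF1 => //; vpairs.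
  have d2 : mh (deg7 (mi + ni) 0 0 0 mj 0 nj) (iter ni (polarize vx vu) (iter mi (polarize vx vp) F1)).
    by apply: mh_polarize d1 => //; vpairs.
  have d3 : mh (deg7 (mi + ni) mj 0 0 0 0 nj) (iter mj (polarize vy vq) (iter ni (polarize vx vu) (iter mi (polarize vx vp) F1))).
    by apply: mh_polarize d2 => //; vpairs.
  have SX s t : vpair s -> vpair t -> substXY 'X_(t.1) = substXY 'X_(s.1) :> {mpoly k[14]} ->
     substXY 'X_(t.2) = substXY 'X_(s.2) :> {mpoly k[14]} -> t != s ->
     forall q d f, mh d f -> d s = q -> substXY (iter q (polarize t s) f) = q`!%:R *: substXY f.
    move=> sv tv e1 e2 ts q d f; exact: (subst_polarize (@islin_substXY k) (@substXYM k)).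
  rewrite /R.
  rewrite (SX vv vy _ _ _ _ _ nj _ _ d3) ?deg7E //; try by rewrite /substXY !comp_mpolyXt.
  rewrite (SX vq vy _ _ _ _ _ mj _ _ d2) ?deg7E //; try by rewrite /substXY !comp_mpolyXt.
  rewrite (SX vu vx _ _ _ _ _ ni _ _ d1) ?deg7E //; try by rewrite /substXY !comp_mpolyXt.
  rewrite (SX vp vx _ _ _ _ _ mi _ _ dF1) ?deg7E //; try by rewrite /substXY !comp_mpolyXt.
  by rewrite !scalerA -!natrM; congr (_%:R *: _); ring.
have SZ s : vpair s -> vz != s -> forall q d f, mh d f -> d s = q ->
    substZZ (iter q (polarize vz s) f) = q`!%:R *: substZZ f.
  move=> sv zs q d f; have [S1 S2] := @substZZ_X k s sv; have [S3 S4] := @substZZ_X k vz isT.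
  by apply: (subst_polarize (@islin_substZZ k) (@substZZM k)); rewrite ?S1 ?S2.
have <- : substZZ (Lop vx vy vz tt Pt Qt R) = Lop vx vy vz tt Pt Qt R.
  apply: (substZZ_id k_char0) => s sv sz; apply: (mh_deriv0 k_char0 dp sv).
  by move: s sv sz; apply: vpairP; split; [ | | |split] => // /eqP.
have dH : mh (deg7 Pt Qt 0 0 0 0 0) (iter tt (Omega vx vy) R) by apply: mh_Omega dR => //; vpairs.
have d1 : mh (deg7 0 Qt Pt 0 0 0 0) (iter Pt (polarize vz vx) (iter tt (Omega vx vy) R)).
  by apply: mh_polarize dH => //; vpairs.
rewrite /Lop (SZ vy isT isT Qt _ _ d1 erefl) (SZ vx isT isT Pt _ _ dH erefl).
rewrite RE (islinZ _ _ (islin_iter _ (islin_Omega _ _))) (islinZ _ _ (@islin_substZZ k)).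
by rewrite !scalerA -!natrM; congr (_%:R *: _); ring.
Qed.

End Network.

(** * Weight vectors and Schur's lemma *)

Section Schur.
Variable k : fieldType.
Hypothesis k_char0 : [pchar k] =i pred0.
Implicit Types (f g h F : {mpoly k[14]}) (s t c : varPair) (d : varPair -> nat).

Lemma mhM d d' f g : mh d f -> mh d' g -> mh (fun c => d c + d' c)%N (f * g).
Proof.
move=> df dg s sv; rewrite polarizeM (df s sv) (dg s sv) -scalerAl -scalerAr natrD scalerDl.
by [].
Qed.

Lemma mh1 : mh (fun _ => 0%N) (1 : {mpoly k[14]}).
Proof. by move=> s sv; rewrite /polarize -[1]/(1%:MP) !mderivC !mulr0 addr0 scale0r. Qed.

Lemma mhX d f e : mh d f -> mh (fun c => e * d c)%N (f ^+ e).
Proof.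
move=> df; elim: e => [|e IH]; first by rewrite expr0; apply: mh_ext mh1.
by rewrite exprS; apply: mh_ext (mhM df IH) => s sv; rewrite mulSn.
Qed.

Lemma mh_X1 s : vpair s -> mh (fun c => (c == s) : nat) ('X_(s.1) : {mpoly k[14]}).
Proof.
move=> sv c cv; rewrite /polarize mdX1 // mdX12 // mulr0 addr0 [s == c]eq_sym.
by have [->|_] := eqVneq c s; rewrite ?mulr1 ?scale1r // mulr0 scale0r.
Qed.

Lemma mh_X2 s : vpair s -> mh (fun c => (c == s) : nat) ('X_(s.2) : {mpoly k[14]}).
Proof.
move=> sv c cv; rewrite /polarize mdX2 // mdX21 // mulr0 add0r [s == c]eq_sym.
by have [->|_] := eqVneq c s; rewrite ?mulr1 ?scale1r // mulr0 scale0r.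
Qed.

Definition zmon (D w : nat) : {mpoly k[14]} := 'X_(vz.1) ^+ w * 'X_(vz.2) ^+ (D - w).

Lemma mh_zmon D w : (w <= D)%N -> mh (deg7 0 0 D 0 0 0 0) (zmon D w).
Proof.
move=> wD; apply: mh_ext (mhM (mhX w (mh_X1 (s := vz) isT)) (mhX (D - w) (mh_X2 (s := vz) isT))).
by vpairs.
Qed.

Lemma homog_mdeg D (f : {mpoly k[2]}) m : f \is D.-homog -> m \in msupp f -> mdeg m = D.
Proof. by move/dhomogP => h /h. Qed.

Lemma toZ_sum D (f : {mpoly k[2]}) : f \is D.-homog ->
  toZ f = \sum_(m <- msupp f) f@_m *: zmon D (m z1).
Proof.
move=> fD; rewrite [in LHS](mpolyE f) (islin_sum _ _ _ (@islin_toZ k)) big_seq [RHS]big_seq.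
apply: eq_bigr => m mf; rewrite (islinZ _ _ (@islin_toZ k)); congr (_ *: _).
have dm := homog_mdeg fD mf.
rewrite /toZ comp_mpolyX big_ord_recl big_ord1 /zmon; congr (_ * _).
  by rewrite (tnth_nth 0) /=; congr (_ ^+ m _); apply: val_inj.
rewrite (tnth_nth 0) /=; congr (_ ^+ _).
rewrite -dm mdegE big_ord_recl big_ord1.
have -> : m ord0 = m z1 by congr (m _); apply: val_inj.
by rewrite addKn.
Qed.

Lemma mh_toZ D (f : {mpoly k[2]}) : f \is D.-homog -> mh (deg7 0 0 D 0 0 0 0) (toZ f).
Proof.
move=> fD; rewrite (toZ_sum fD) big_seq; apply: mh_sum => m mf; apply: mhZ.
apply: mh_zmon; rewrite -(homog_mdeg fD mf) mdegE big_ord_recl big_ord1.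
have -> : m ord0 = m z1 by congr (m _); apply: val_inj.
exact: leq_addr.
Qed.

Lemma mderivX_exp (i : 'I_14) f e : (f ^+ e)^`M(i) = e%:R *: (f ^+ e.-1 * f^`M(i)).
Proof.
elim: e => [|e IH]; first by rewrite expr0 -[1]/(1%:MP) mderivC scale0r.
rewrite exprS mderivM IH -scalerAr mulrA -exprS mulrC.
have -> : e%:R *: (f ^+ e.-1.+1 * f^`M(i)) = e%:R *: (f ^+ e * f^`M(i)) by case: e {IH} => [|e0] //; rewrite !scale0r.
by rewrite -[e.+1]add1n natrD scalerDl scale1r.
Qed.

Lemma sl2op_vz e f : (forall s, vpair s -> s != vz -> freeOf s f) ->
  sl2op e f = 'X_(co e vz) * f^`M(co (~~ e) vz).
Proof.
move=> fr; rewrite /sl2op (bigD1_seq vz) //= big_seq_cond big1 ?addr0 // => s /andP[sv sz].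
by case: (fr s sv sz) => e1 e2; case: e; rewrite /co /= ?e1 ?e2 mulr0.
Qed.

Lemma zmon_free D w s : vpair s -> s != vz -> freeOf s (zmon D w).
Proof.
move=> sv sz; have [e1 e2 e3 e4] := @vpair_coord vz s isT sv.
by split; rewrite /zmon mderivM !mderivX_exp !mderivXU ?e1 ?e2 ?e3 ?e4 eq_sym (negbTE sz)
  ?mulr0 ?scaler0 ?mulr0 ?mul0r ?addr0.
Qed.

Lemma sl2op_zmon D w : (w < D)%N -> sl2op true (zmon D w) = (D - w)%:R *: zmon D w.+1.
Proof.
move=> wD; rewrite sl2op_vz; last by move=> s sv sz; apply: zmon_free.
rewrite /co /zmon mderivM !mderivX_exp !mderivXU /=.
rewrite mulr0n mulr1n mulr0 scaler0 mul0r add0r mulr1 -!scalerAr mulrA -exprS; congr (_ *: (_ * _ ^+ _)).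
by lia.
Qed.

Lemma sl2op_zmon0 D : sl2op false (zmon D 0) = 0.
Proof.
rewrite sl2op_vz; last by move=> s sv sz; apply: zmon_free.
by rewrite /co /zmon expr0 mul1r mderivX_exp mderivXU /= mulr0n mulr0 scaler0 mulr0.
Qed.

(* Schur's lemma: the lowest weight vector generates the space of binary forms. *)
Lemma sl2_ext (W : lmodType k) D (E : W -> W) (L1 L2 : {mpoly k[14]} -> W) :
  islin L1 -> islin L2 -> islin E ->
  (forall f, E (L1 f) = L1 (sl2op true f)) -> (forall f, E (L2 f) = L2 (sl2op true f)) ->
  L1 (zmon D 0) = L2 (zmon D 0) ->
  forall f : {mpoly k[2]}, f \is D.-homog -> L1 (toZ f) = L2 (toZ f).
Proof.
move=> l1 l2 lE c1 c2 e0 f fD.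
have key w : (w <= D)%N -> L1 (zmon D w) = L2 (zmon D w).
  elim: w => [//|w IH] wD.
  have nz : (D - w)%:R != 0 :> k by rewrite ((pcharf0P k).1 k_char0); lia.
  have := congr1 E (IH (ltnW wD)); rewrite c1 c2 sl2op_zmon // (islinZ _ _ l1) (islinZ _ _ l2).
  by move/(congr1 (fun x => (D - w)%:R^-1 *: x)); rewrite !scalerA mulVf // !scale1r.
rewrite (toZ_sum fD) (islin_sum _ _ _ l1) (islin_sum _ _ _ l2) big_seq [RHS]big_seq.
apply: eq_bigr => m mf; rewrite (islinZ _ _ l1) (islinZ _ _ l2) key //.
rewrite -(homog_mdeg fD mf) mdegE big_ord_recl big_ord1.
have -> : m ord0 = m z1 by congr (m _); apply: val_inj.
exact: leq_addr.
Qed.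

End Schur.

(** * The value of kappa *)

Lemma sumZ_shift (k : comNzRingType) (V : lmodType k) (F : nat -> V) a :
  \sum_(g < a.+2) 'C(a.+1, g)%:R *: F g =
  \sum_(g < a.+1) 'C(a, g)%:R *: F g + \sum_(g < a.+1) 'C(a, g)%:R *: F g.+1.
Proof.
rewrite big_ord_recl /= [X in _ = X + _]big_ord_recl /= -addrA; congr (_ + _); first by rewrite !bin0.
under eq_bigr do rewrite /bump leq0n add1n binS natrD scalerDl.
rewrite big_split /=; congr (_ + _).
by rewrite big_ord_recr /= bin_small // scale0r addr0.
Qed.

Lemma iter_binomial (k : comNzRingType) (V : lmodType k) (U W : V -> V) a f :
  islin U -> islin W -> (forall g, U (W g) = W (U g)) ->
  iter a (fun g => U g + W g) f = \sum_(g < a.+1) 'C(a, g)%:R *: iter g U (iter (a - g) W f).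
Proof.
move=> lU lW UW; elim: a => [|a IH]; first by rewrite big_ord1 bin0 scale1r.
rewrite iterS IH (islin_sum _ _ _ lU) (islin_sum _ _ _ lW).
rewrite (sumZ_shift (fun g => iter g U (iter (a.+1 - g) W f))) addrC; congr (_ + _).
  apply: eq_bigr => g _; rewrite (islinZ _ _ lW) subSn; last by rewrite -ltnS.
  by rewrite iterS; congr (_ *: _); apply: iter_comm => h; rewrite UW.
by apply: eq_bigr => g _; rewrite (islinZ _ _ lU) iterS subSS.
Qed.

(** * Matrix elements of the coupling operators on monomials *)

Section Monomials.
Variable k : fieldType.
Hypothesis k_char0 : [pchar k] =i pred0.
Implicit Types (f g h : {mpoly k[14]}) (s t w : varPair).

Definition mon2 s a b : {mpoly k[14]} := 'X_(s.1) ^+ a * 'X_(s.2) ^+ b.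
Definition dm s a b f := iter a (mderiv s.1) (iter b (mderiv s.2) f).

Lemma islin_dm s a b : islin (dm s a b).
Proof. by move=> x u v; rewrite /dm !(islin_iter _ (islin_mderiv _)). Qed.

Lemma freeM s f g : freeOf s f -> freeOf s g -> freeOf s (f * g).
Proof. by move=> [f1 f2] [g1 g2]; split; rewrite mderivM ?f1 ?f2 ?g1 ?g2 mul0r mulr0 addr0. Qed.

Lemma freeD s f g : freeOf s f -> freeOf s g -> freeOf s (f + g).
Proof. by move=> [f1 f2] [g1 g2]; split; rewrite mderivD ?f1 ?f2 ?g1 ?g2 addr0. Qed.

Lemma freeZ s (a : k) f : freeOf s f -> freeOf s (a *: f).
Proof. by move=> [f1 f2]; split; rewrite mderivZ ?f1 ?f2 scaler0. Qed.

Lemma free1 s : freeOf s (1 : {mpoly k[14]}).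
Proof. by split; rewrite -[1]/(1%:MP) mderivC. Qed.

Lemma freeX s f e : freeOf s f -> freeOf s (f ^+ e).
Proof.
move=> fs; elim: e => [|e IH]; first by rewrite expr0; exact: free1.
by rewrite exprS; apply: freeM.
Qed.

Lemma free_X1 s t : vpair s -> vpair t -> s != t -> freeOf s ('X_(t.1) : {mpoly k[14]}).
Proof. by move=> sv tv st; split; rewrite ?mdX1 ?mdX12 // eq_sym (negbTE st). Qed.
Lemma free_X2 s t : vpair s -> vpair t -> s != t -> freeOf s ('X_(t.2) : {mpoly k[14]}).
Proof. by move=> sv tv st; split; rewrite ?mdX2 ?mdX21 // eq_sym (negbTE st). Qed.

Lemma free_mon2 s t a b : vpair s -> vpair t -> s != t -> freeOf s (mon2 t a b).
Proof. by move=> sv tv st; apply: freeM; apply: freeX; [apply: free_X1 | apply: free_X2]. Qed.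

Lemma free_bracket s t w : vpair s -> vpair t -> vpair w -> s != t -> s != w -> freeOf s (bracket k t w).
Proof.
move=> sv tv wv st sw; rewrite /bracket -scaleN1r; apply: freeD; first by apply: freeM; [apply: free_X1|apply: free_X2].
by apply: freeZ; apply: freeM; [apply: free_X2|apply: free_X1].
Qed.

Lemma free_polarize s t w f : vpair s -> vpair t -> s != t -> freeOf s f -> freeOf s (polarize t w f).
Proof.
move=> sv tv st fs; rewrite /polarize.
have fd x : freeOf s f^`M(x) by case: fs => f1 f2; split; rewrite mderiv_comm ?f1 ?f2 mderiv0.
by apply: freeD; apply: freeM => //; [apply: free_X1 | apply: free_X2].
Qed.

Lemma free_iter_polarize s t w f a : vpair s -> vpair t -> s != t -> freeOf s f -> freeOf s (iter a (polarize t w) f).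
Proof. by move=> sv tv st fs; elim: a => //= a; apply: free_polarize. Qed.

Lemma free_Eop (c : varPair) s t w q a b f : vpair c -> vpair s -> vpair t -> c != s -> c != t ->
  freeOf c f -> freeOf c (Eop s t w q a b f).
Proof.
move=> cv sv tv cs ct cf; apply: freeM; first by apply: freeX; apply: free_bracket.
by do 2! apply: free_iter_polarize => //.
Qed.

Lemma polarize_free t s f : freeOf s f -> polarize t s f = 0.
Proof. by case=> e1 e2; rewrite /polarize e1 e2 !mulr0 addr0. Qed.

Lemma iter_polarize_mulr a t s f h : freeOf s h -> iter a (polarize t s) (f * h) = iter a (polarize t s) f * h.
Proof. by move=> hs; elim: a => //= a ->; rewrite polarizeM (polarize_free t hs) mulr0 addr0. Qed.

Lemma Eop_mulr s t w q a b f h : freeOf w h -> Eop s t w q a b (f * h) = Eop s t w q a b f * h.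
Proof. by move=> hw; rewrite /Eop !iter_polarize_mulr // mulrA. Qed.

Lemma dm_mulr s a b f h : freeOf s h -> dm s a b (f * h) = dm s a b f * h.
Proof.
move=> [h1 h2]; rewrite /dm.
have -> : iter b (mderiv s.2) (f * h) = iter b (mderiv s.2) f * h.
  by elim: b => //= b ->; rewrite mderivM h2 mulr0 addr0.
by elim: a => //= a ->; rewrite mderivM h1 mulr0 addr0.
Qed.

Lemma dm_mon2 s (a b c e : nat) : vpair s -> dm s a b (mon2 s c e) = (c ^_ a * e ^_ b)%:R *: mon2 s (c - a) (e - b).
Proof.
move=> sv; rewrite /dm /mon2.
have H (i j : 'I_14) (h a' c' : nat) : (j == i) = false -> iter a' (mderiv i) ('X_i ^+ c' * 'X_j ^+ h : {mpoly k[14]}) =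
    (c' ^_ a')%:R *: ('X_i ^+ (c' - a') * 'X_j ^+ h).
  move=> ij; elim: a' => [|a' IH]; first by rewrite ffactn0 scale1r subn0.
  rewrite iterS IH mderivZ mderivM !mderivX_exp !mderivXU eqxx ij mulr0 scaler0 mulr0 addr0 mulr1.
  rewrite -scalerAl scalerA -natrM ffactnSr subnS; congr (_ *: (_ * _)).
rewrite mulrC H; last by have [_ _ e1 _] := vpair_coord sv sv.
rewrite mulrC (islinZ _ _ (islin_iter _ (islin_mderiv _))) H; last by have [_ _ _ e1] := vpair_coord sv sv.
by rewrite scalerA -natrM mulnC.
Qed.

Lemma fp_mon2l s a b f g : fp (mon2 s a b * f) g = fp f (dm s a b g).
Proof.
rewrite /mon2 /dm -mulrA.
have H (i : 'I_14) e f' g' : fp ('X_i ^+ e * f') g' = fp f' (iter e (mderiv i) g').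
  elim: e g' => [|e IH] g'; first by rewrite expr0 mul1r.
  by rewrite exprS -mulrA fpXl IH iterSr.
rewrite !H; congr (fp _ _).
by apply: iter_comm => x; apply/esym; apply: iter_comm => y; rewrite mderiv_comm.
Qed.

Lemma iter_mulX (i j : 'I_14) e f : i != j ->
  iter e (fun g => 'X_i * g^`M(j)) f = 'X_i ^+ e * iter e (mderiv j) f.
Proof.
move=> ij; elim: e => [|e IH]; first by rewrite expr0 mul1r.
by rewrite iterS IH mderivM mderivX_exp mderivXU (negbTE ij) mulr0 scaler0 mul0r add0r mulrA -exprS.
Qed.

(** The binomial theorem for the two summands of t d_s, which commute because t and s are distinct
    pairs. *)
Lemma polarize_expand a t s f : vpair s -> vpair t -> t != s ->
  iter a (polarize t s) f = \sum_(g < a.+1) 'C(a, g)%:R *: (mon2 t g (a - g) * dm s g (a - g) f).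
Proof.
move=> sv tv ts; have [e1 e2 e3 e4] := vpair_coord tv sv.
have lin (i j : 'I_14) : islin (fun g : {mpoly k[14]} => 'X_i * g^`M(j)).
  exact: islin_comp (islin_mull _) (islin_mderiv _).
rewrite (iter_binomial a f (lin t.1 s.1) (lin t.2 s.2)); last first.
  move=> g; rewrite !mderivM !mderivXU e3 e4 !mul0r !add0r mderiv_comm; ring.
apply: eq_bigr => g _; rewrite !iter_mulX ?e1 ?e2 //; congr (_ *: _); rewrite /mon2 /dm -mulrA; congr (_ * _).
move: (iter _ (mderiv s.2) f) => Z; move: (a - g)%N => e; move: (nat_of_ord g); elim=> [//|l IH].
by rewrite !iterS IH mderivM mderivX_exp mderivXU e4 mulr0 scaler0 mul0r add0r.
Qed.

Lemma Omega_expand a s t f : vpair s -> vpair t -> t != s ->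
  iter a (Omega s t) f = \sum_(g < a.+1) ((-1) ^+ g * 'C(a, g)%:R) *: dm s (a - g) g (dm t g (a - g) f).
Proof.
move=> sv tv ts.
pose U (g : {mpoly k[14]}) := - g^`M(s.2)^`M(t.1); pose W (g : {mpoly k[14]}) := g^`M(s.1)^`M(t.2).
have lW : islin W by exact: islin_comp (islin_mderiv _) (islin_mderiv _).
have lU : islin U by move=> x u v; rewrite /U !(mderivD, mderivZ) opprD scalerN.
have com a' b c d (x : {mpoly k[14]}) : x^`M(a')^`M(b)^`M(c)^`M(d) = x^`M(c)^`M(d)^`M(a')^`M(b).
  by rewrite [x^`M(a')^`M(b)^`M(c)]mderiv_comm [x^`M(a')^`M(c)]mderiv_comm
     [x^`M(c)^`M(a')^`M(b)^`M(d)]mderiv_comm [x^`M(c)^`M(a')^`M(d)]mderiv_comm.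
have -> : iter a (Omega s t) f = iter a (fun g => U g + W g) f.
  by apply: eq_iter => g; rewrite /Omega /U /W addrC.
rewrite (iter_binomial a f lU lW); last by move=> g; rewrite /U /W !mderivN com.
have cI i j e e' (g : {mpoly k[14]}) : iter e (mderiv i) (iter e' (mderiv j) g) = iter e' (mderiv j) (iter e (mderiv i) g).
  by apply: iter_comm => x; apply/esym; apply: iter_comm => y; rewrite mderiv_comm.
have iW e g : iter e W g = iter e (mderiv s.1) (iter e (mderiv t.2) g).
  elim: e => [//|e IH]; rewrite iterS IH /W [RHS]iterS mderiv_comm; congr (_^`M(_)).
  by apply: iter_comm => x; rewrite mderiv_comm.
have iU e g : iter e U g = (-1) ^+ e *: iter e (mderiv s.2) (iter e (mderiv t.1) g).
  elim: e => [|e IH]; first by rewrite scale1r.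
  rewrite iterS IH /U !mderivZ exprS mulN1r scaleNr [in RHS]iterS mderiv_comm; congr (- (_ *: _^`M(_))).
  by apply: iter_comm => x; rewrite mderiv_comm.
apply: eq_bigr => g _; rewrite iW iU scalerA [_ * (-1) ^+ _]mulrC; congr (_ *: _); rewrite /dm.
rewrite ![iter g (mderiv t.1) _](cI t.1) ?(cI s.2 s.1) //.
Qed.

Lemma polarize_full a b c t s : vpair s -> vpair t -> t != s -> (b + c)%N = a ->
  iter a (polarize t s) (mon2 s b c) = a`!%:R *: mon2 t b c.
Proof.
move=> sv tv ts e; rewrite polarize_expand //.
have hb : (b < a.+1)%N by lia.
have ab : (a - b = c)%N by lia.
have bf : ('C(a, b) * (b`! * c`!) = a`!)%N by rewrite -[in RHS](bin_fact (m := b) (n := a)) ?ab // -ltnS.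
rewrite (bigD1 (Ordinal hb)) //= big1 ?addr0 /=.
  by rewrite dm_mon2 // ab !ffactnn !subnn /mon2 !expr0 mulr1 -scalerAr mulr1 scalerA -natrM bf //.
move=> g; rewrite -val_eqE /= => gb; rewrite dm_mon2 //.
have [h|h] := ltnP b g; first by rewrite ffact_small // mul0n scale0r mulr0 scaler0.
by rewrite [(c ^_ _)%N]ffact_small ?muln0 ?scale0r ?mulr0 ?scaler0 //; move: gb h; move: (nat_of_ord g) => g'; lia.
Qed.

End Monomials.

Section Contract.
Variable k : fieldType.
Hypothesis k_char0 : [pchar k] =i pred0.
Implicit Types (f g h : {mpoly k[14]}) (s t w : varPair).
Notation mon2 := (@mon2 k).

Lemma mon2M s (a b c d : nat) : mon2 s a b * mon2 s c d = mon2 s (a + c) (b + d).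
Proof. by rewrite /mon2 !exprD; ring. Qed.

Lemma bracket_expand s t i : bracket k s t ^+ i =
  \sum_(e < i.+1) ((-1) ^+ e * 'C(i, e)%:R) *: (mon2 s (i - e) e * mon2 t e (i - e)).
Proof.
rewrite /bracket exprBn; apply: eq_bigr => e _; rewrite !exprMn /mon2 -mulr_natl.
rewrite -scalerA scaler_nat -mulr_natl -[(-1) ^+ e *: _]mul1r -scalerAr scalerAl.
have -> : (-1) ^+ e *: (1 : {mpoly k[14]}) = (-1) ^+ e.
  by elim: (nat_of_ord e) => [|q IH]; rewrite ?scale1r // exprS -scalerA IH scaleN1r exprS mulN1r.
ring.
Qed.

Lemma contract_coef (i ni n l g e : nat) : (ni + i = n)%N -> (g + e = l)%N -> (e <= i)%N -> (g <= ni)%N ->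
  ('C(i, e) * (l`! * (n - l)`!) = i`! * (l ^_ g * (n - l) ^_ (ni - g)))%N.
Proof.
move=> nE lE ei gn.
have e1 : (l ^_ g * e`! = l`!)%N by rewrite -(@ffact_fact l g) -?lE ?leq_addr // addKn.
have e2 : ((n - l) ^_ (ni - g) * (i - e)`! = (n - l)`!)%N.
  by rewrite -(@ffact_fact (n - l) (ni - g)); [congr (_ * _`!)%N; lia | lia].
by rewrite -(bin_fact ei) -e1 -e2; ring.
Qed.

(** Differentiating by the full degree n in u extracts a coefficient, and weight leaves a single
    monomial in p. The scalar is a coupling coefficient, that is, a transvectant of monomials. *)
Lemma contract p u x (i mi ni m n P z l : nat) : vpair p -> vpair u -> vpair x -> u != p -> u != x -> p != x ->
  (mi + i = m)%N -> (ni + i = n)%N -> (mi + ni = P)%N -> (z <= P)%N -> (l <= n)%N ->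
  dm u l (n - l) (Eop p u x i mi ni (mon2 x z (P - z))) =
  ((-1) ^+ l * (mi`! * i`!)%:R * trv k ni P n z (n - l)) *: mon2 p (z + i - l) (m - (z + i - l)).
Proof.
move=> pv uv xv up ux px mE nE PE zP ln.
rewrite /Eop (polarize_expand ni _ xv uv ux) (islin_sum _ _ _ (islin_iter _ (islin_polarize p x))).
rewrite mulr_sumr (islin_sum _ _ _ (islin_dm _ _ _)) /trv mulr_sumr scaler_suml; apply: eq_bigr => g _.
have gn : (g <= ni)%N by rewrite -ltnS.
rewrite (islinZ _ _ (islin_iter _ (islin_polarize p x))) -scalerAr (islinZ _ _ (islin_dm _ _ _)).
rewrite dm_mon2 // -scalerAr (islinZ _ _ (islin_iter _ (islin_polarize p x))) -scalerAr (islinZ _ _ (islin_dm _ _ _)).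
rewrite scalerA -natrM (_ : (n - (n - l) = l)%N); last by lia.
have [c0|c1] := eqVneq (z ^_ g * (P - z) ^_ (ni - g))%N 0%N.
  by rewrite c0 !(mul0n, muln0, mulr0, mul0r, scale0r).
have [gz gP] : (g <= z)%N /\ (ni - g <= P - z)%N.
  split; rewrite leqNgt; apply: contra c1 => h; first by rewrite ffact_small.
  by rewrite [((P - z) ^_ _)%N]ffact_small // muln0.
rewrite mulrC [mon2 u _ _ * _]mulrC iter_polarize_mulr; last by apply: free_mon2; rewrite // eq_sym.
rewrite (polarize_full _ xv pv px); last by lia.
rewrite bracket_expand mulr_sumr (islin_sum _ _ _ (islin_dm _ _ _)).
(* In the expansion of (p u)^i only the term with g + e = l has the prescribed exponents of u. *)
have T (e : 'I_i.+1) : dm u l (n - l) (mi`!%:R *: mon2 p (z - g) (P - z - (ni - g)) * mon2 u g (ni - g) *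
   (((-1) ^+ e * 'C(i, e)%:R) *: (mon2 p (i - e) e * mon2 u e (i - e)))) =
   (if (g + e == l)%N then ((-1) ^+ e * (mi`! * ('C(i, e) * (l`! * (n - l)`!)))%:R)
       *: mon2 p (z + i - l) (m - (z + i - l)) else 0).
  rewrite -scalerAr (islinZ _ _ (islin_dm _ _ _)) -!scalerAl (islinZ _ _ (islin_dm _ _ _)).
  have -> : mon2 p (z - g) (P - z - (ni - g)) * mon2 u g (ni - g) * (mon2 p (i - e) e * mon2 u e (i - e)) =
     mon2 u (g + e) (ni - g + (i - e)) * mon2 p (z - g + (i - e)) (P - z - (ni - g) + e).
    by rewrite -!mon2M; ring.
  have ei : (e <= i)%N by rewrite -ltnS.
  rewrite dm_mulr; last by apply: free_mon2.
  rewrite dm_mon2 //; case: eqP => ge.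
    have -> : (ni - g + (i - e) = n - l)%N by lia.
    rewrite ge !ffactnn !subnn /mon2 !expr0 mulr1 -scalerAl mul1r !scalerA; congr (_ *: ('X_(_) ^+ _ * 'X_(_) ^+ _)); last 2 first.
    + lia.
    + lia.
    by rewrite !natrM; ring.
  suff -> : ((g + e) ^_ l * (ni - g + (i - e)) ^_ (n - l) = 0)%N by rewrite scale0r mul0r !scaler0.
  have [h|h] := ltnP (g + e) l; first by rewrite ffact_small.
  by rewrite [((ni - g + _) ^_ _)%N]ffact_small ?muln0 //; lia.
rewrite (eq_bigr _ (fun e _ => T e)).
have [gl|gl] := leqP g l; last first.
  rewrite big1; last by move=> e _; case: eqP => // ge; lia.
  by rewrite (ffact_small gl) !muln0 mulr0 mulr0 scaler0 scale0r.
have [li|li] := leqP (l - g) i; last first.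
  rewrite big1; last by move=> e _; case: eqP => // ge; have := ltn_ord e; lia.
  rewrite [((n - l) ^_ _)%N]ffact_small; last by lia.
  by rewrite !(mul0n,muln0) mulr0 mulr0 scaler0 scale0r.
rewrite (bigD1 (Ordinal (li : (l - g < i.+1)%N))) //= big1 ?addr0; last first.
  by move=> e; rewrite -val_eqE /= => ne; case: eqP => // ge; lia.
rewrite subnKC // eqxx scalerA; congr (_ *: _).
rewrite (contract_coef nE (subnKC gl)) //.
have -> : (-1) ^+ l = (-1) ^+ (l - g) * (-1) ^+ g :> k by rewrite -exprD subnK.
have -> : (-1) ^+ (l - g) * (-1) ^+ g * (mi`! * i`!)%:R = ((-1) ^+ (l - g) * (mi`! * i`!)%:R) * (-1) ^+ g :> k by ring.
rewrite [X in _ = X]mulrA -[X in _ = X * _]mulrA -expr2 sqrr_sign mulr1 !natrM; ring.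
Qed.

End Contract.

Section LowTerm.
Variable k : fieldType.
Hypothesis k_char0 : [pchar k] =i pred0.
Implicit Types (f g h : {mpoly k[14]}) (s t w : varPair).
Notation mon2 := (@mon2 k).

Lemma polarize_low t s b D : vpair s -> vpair t -> t != s ->
  iter b (polarize t s) (mon2 s 0 D) = (D ^_ b)%:R *: (mon2 t 0 b * mon2 s 0 (D - b)).
Proof.
move=> sv tv ts; rewrite polarize_expand // big_ord_recl big1.
  by rewrite addr0 bin0 scale1r dm_mon2 // ffactn0 mul1n !subn0 -scalerAr.
by move=> g _; rewrite dm_mon2 // lift0 ffact_small // mul0n scale0r mulr0 scaler0.
Qed.

(** A pure power of w_2 polarizes to a single monomial; this is why vertices at extreme weight
    reduce to the binomial expansion of a bracket. *)
Lemma Eop_low s t w q a b : vpair s -> vpair t -> vpair w -> s != w -> t != w -> s != t ->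
  Eop s t w q a b (mon2 w 0 (a + b)) =
  (a + b)`!%:R *: (bracket k s t ^+ q * (mon2 s 0 a * mon2 t 0 b)).
Proof.
move=> sv tv wv sw tw st; rewrite /Eop polarize_low // (islinZ _ _ (islin_iter _ (islin_polarize s w))).
rewrite addnK [mon2 t _ _ * _]mulrC iter_polarize_mulr; last by apply: free_mon2; rewrite // eq_sym.
rewrite (polarize_full _ wv sv sw) ?addn0 // -scalerAl -!scalerAr scalerA -natrM; congr (_%:R *: _).
by rewrite addnC -(@ffact_fact (b + a) b) ?leq_addr // addKn mulnC.
Qed.

Lemma bracket_low s t q a b : bracket k s t ^+ q * (mon2 s 0 a * mon2 t 0 b) =
  \sum_(z < q.+1) ((-1) ^+ (q - z) * 'C(q, z)%:R) *: (mon2 s z (a + q - z) * mon2 t (q - z) (b + z)).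
Proof.
rewrite bracket_expand mulr_suml (reindex_inj rev_ord_inj); apply: eq_bigr => z _ /=.
have zq : (z <= q)%N by rewrite -ltnS.
rewrite subSS bin_sub // subKn // -scalerAl; congr (_ *: _).
by rewrite mulrACA !mon2M !addn0 [(b + z)%N]addnC (_ : a + q - z = q - z + a)%N //; lia.
Qed.

(** A nonzero coupling coefficient has its weights in range, which makes the truncated differences
    in the exponents of monomials genuine ones. *)
Lemma trv_supp q A B a b : trv k q A B a b != 0 ->
  exists g : nat, [/\ (g <= q)%N, (g <= a)%N, (q - g <= A - a)%N, (q - g <= b)%N & (g <= B - b)%N].
Proof.
have [/existsP[g /and4P[h1 h2 h3 h4]] _|/existsPn H] :=
  boolP [exists g : 'I_q.+1, [&& g <= a, q - g <= A - a, q - g <= b & g <= B - b]%N].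
  by exists g; split; rewrite // -ltnS.
rewrite /trv big1 ?eqxx // => g _.
suff -> : ((a ^_ g * (A - a) ^_ (q - g)) * (b ^_ (q - g) * (B - b) ^_ g) = 0)%N by rewrite muln0 mulr0.
apply/eqP; rewrite !muln_eq0 -!leqn0; move: (H g); rewrite !negb_and -!ltnNge.
by case/or4P => h; rewrite (ffact_small h) ?orbT.
Qed.

(** The coupling coefficient seen from the adjoint side: Omega^K expands as an alternating sum, and
    full polarization merely renames the remaining monomials. *)
Lemma Lop_mon2 s t w K M m c a (x y : nat) : vpair s -> vpair t -> vpair w -> s != t -> s != w -> t != w ->
  (M + K = m)%N -> (a + c = M + M)%N -> (x + y = c + K)%N -> (x <= m)%N -> (y <= m)%N ->
  Lop s t w K M M (mon2 s x (m - x) * mon2 t y (m - y)) =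
  ((-1) ^+ K * (M`! * M`!)%:R * trv k K m m x y) *: mon2 w c a.
Proof.
move=> sv tv wv st sw tw mE aE xyE xm ym.
have ts : t != s by rewrite eq_sym.
rewrite /Lop (Omega_expand K _ sv tv ts) (reindex_inj rev_ord_inj) !(islin_sum _ _ _ (islin_iter _ (islin_polarize _ _))).
rewrite /trv mulr_sumr scaler_suml; apply: eq_bigr => g _ /=.
have gK : (g <= K)%N by rewrite -ltnS.
rewrite subSS bin_sub // subKn //.
rewrite !(islinZ _ _ (islin_iter _ (islin_polarize _ _))) [mon2 s _ _ * _]mulrC dm_mulr; last by apply: free_mon2.
rewrite dm_mon2 // -scalerAl (islinZ _ _ (islin_dm _ _ _)) [mon2 t _ _ * _]mulrC dm_mulr; last by apply: free_mon2.
rewrite dm_mon2 // -scalerAl !(islinZ _ _ (islin_iter _ (islin_polarize _ _))) !scalerA.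
have -> : (-1) ^+ (K - g) = (-1) ^+ K * (-1) ^+ g :> k.
  have -> : (-1) ^+ K = (-1) ^+ (K - g) * (-1) ^+ g :> k by rewrite -exprD subnK.
  by rewrite -mulrA -expr2 sqrr_sign mulr1.
have [c0|c1] := eqVneq ((x ^_ g * (m - x) ^_ (K - g)) * (y ^_ (K - g) * (m - y) ^_ g))%N 0%N.
  rewrite c0 muln0 !mulr0 scale0r -mulrA -natrM.
  rewrite (_ : (_ * _ = 0)%N); last by rewrite -c0; ring.
  by rewrite mulr0 scale0r.
have [gx gm gy gym] : [/\ (g <= x)%N, (K - g <= m - x)%N, (K - g <= y)%N & (g <= m - y)%N].
  by split; rewrite leqNgt; apply: contra c1 => h; rewrite (ffact_small h) ?(mul0n,muln0).
rewrite iter_polarize_mulr; last by apply: free_mon2.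
rewrite (polarize_full _ sv wv); [|by rewrite eq_sym|lia].
rewrite [_ *: mon2 w _ _ * _]mulrC iter_polarize_mulr; last by apply: freeZ; apply: free_mon2; rewrite // eq_sym.
rewrite (polarize_full _ tv wv); [|by rewrite eq_sym|lia].
rewrite -scalerAl -scalerAr mon2M !scalerA.
have -> : (y - (K - g) + (x - g) = c)%N by lia.
have -> : (m - y - g + (m - x - (K - g)) = a)%N by lia.
by congr (_ *: _); rewrite !natrM; ring.
Qed.

Lemma fp_mon2_self s a b : vpair s -> fp (mon2 s a b) (mon2 s a b) = (a`! * b`!)%:R.
Proof.
move=> sv; rewrite -[X in fp X _]mulr1 fp_mon2l dm_mon2 // !ffactnn !subnn /mon2 !expr0 mulr1.
rewrite -[X in fp X]mpolyX0 fpXm mcoeffZ mcoeff1 eqxx mulr1 /mfac big1 ?mulr1 //.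
by move=> i _; rewrite mnm0E.
Qed.

End LowTerm.

Section FischerLinear.
Variables (N : nat) (k : fieldType).
Implicit Types f g : {mpoly k[N]}.

Lemma fp0l g : fp 0 g = 0. Proof. exact: islin0 (fp_linl g). Qed.
Lemma fp0r g : fp g 0 = 0. Proof. exact: islin0 (fp_linr g). Qed.
Lemma fpDr f g h : fp f (g + h) = fp f g + fp f h. Proof. exact: islinD (fp_linr f). Qed.
Lemma fpZl c f g : fp (c *: f) g = c * fp f g. Proof. exact: islinZ (fp_linl g). Qed.
Lemma fpZr c f g : fp f (c *: g) = c * fp f g. Proof. exact: islinZ (fp_linr f). Qed.
Lemma fp_suml (I : Type) (r : seq I) (p : pred I) F g :
  fp (\sum_(i <- r | p i) F i) g = \sum_(i <- r | p i) fp (F i) g.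
Proof. exact: islin_sum (fp_linl g). Qed.
Lemma fp_sumr (I : Type) (r : seq I) (p : pred I) F g :
  fp g (\sum_(i <- r | p i) F i) = \sum_(i <- r | p i) fp g (F i).
Proof. exact: islin_sum (fp_linr g). Qed.
End FischerLinear.

(** The coefficient of X^c in the product of (1-X)^-(a+1) and (1-X)^-(b+1). *)
Lemma sum_bin_conv a b c :
  (\sum_(e < c.+1) 'C(a + e, e) * 'C(b + (c - e), c - e) = 'C(a + b + c + 1, c))%N.
Proof.
have hockey a' c' : (\sum_(e < c'.+1) 'C(a' + e, e) = 'C(a' + c' + 1, c'))%N.
  elim: c' => [|c' IH]; first by rewrite big_ord1 !bin0.
  rewrite big_ord_recr IH /= !addn1 addnS binS addnC; congr (_ + _)%N.
elim: b c => [|b IHb] c.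
  by rewrite addn0 -hockey; apply: eq_bigr => e _; rewrite add0n binn muln1.
elim: c => [|c IHc]; first by rewrite big_ord1 !bin0.
have -> : (a + b.+1 + c.+1 + 1 = (a + b + c.+1 + 1).+1)%N by lia.
rewrite binS (_ : 'C(a + b + c.+1 + 1, c) = 'C(a + b.+1 + c + 1, c)); last by congr 'C(_, _); lia.
rewrite -IHb -IHc [in RHS]big_ord_recr /= [LHS]big_ord_recr /= !subnn !addn0 !bin0 !muln1.
rewrite addnAC; congr (_ + _)%N; rewrite -big_split; apply: eq_bigr => e _ /=.
have ec : (e <= c)%N by rewrite -ltnS.
by rewrite -mulnDr subSn // addSn binS addSnnS.
Qed.

Section MonomialActions.
Variable k : fieldType.
Notation mon2 := (@mon2 k).

Lemma iter_polarize_mul e s t q (f h : {mpoly k[14]}) : polarize s t h = 0 ->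
  iter e (polarize s t) (h ^+ q * f) = h ^+ q * iter e (polarize s t) f.
Proof.
move=> h0; have H g : polarize s t (h ^+ q * g) = h ^+ q * polarize s t g.
  rewrite polarizeM; elim: q => [|q IH]; first by rewrite expr0 -[1]/(1%:MP) /polarize !mderivC !mulr0 addr0 mul0r add0r.
  have -> : polarize s t (h ^+ q.+1) = 0.
    elim: q.+1 => [|q' IH']; first by rewrite expr0 -[1]/(1%:MP) /polarize !mderivC !mulr0 addr0.
    by rewrite exprS polarizeM h0 IH' mul0r mulr0 addr0.
  by rewrite mul0r add0r.
by elim: e => //= e ->; rewrite H.
Qed.

Lemma sl2op_mon2 s (a b : nat) : vpair s -> sl2op true (mon2 s a b) = b%:R *: mon2 s a.+1 b.-1.
Proof.
move=> sv; rewrite /sl2op -(sum_allPairs (fun t : varPair => b%:R *: mon2 t a.+1 b.-1) sv).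
rewrite big_seq [RHS]big_seq; apply: eq_bigr => t tv /=; rewrite /mon2.
have [e1 e2 e3 e4] := vpair_coord sv tv.
rewrite mderivM !mderivX_exp !mderivXU e2 e3 mulr0 scaler0 mul0r add0r; case: eqP => [->|/eqP ts].
  by rewrite eqxx mulr1 -!scalerAr mulrA -exprS.
by rewrite eq_sym (negbTE ts) mulr0 scaler0 !mulr0.
Qed.

End MonomialActions.

(** * Evaluation of the scalar at the lowest weight *)

Section KappaValue.
Variable k : fieldType.
Hypothesis k_char0 : [pchar k] =i pred0.
Notation mon2 := (@mon2 k).

Variables m n i j K K' M N cc al be mi mj ni nj tt Pt Qt : nat.
Hypotheses (mE : (M + K)%N = m) (nE : (N + K')%N = n) (alE : (al + cc)%N = (M + M)%N)
  (beE : (be + cc)%N = (N + N)%N)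
  (miE : (mi + i)%N = m) (mjE : (mj + j)%N = m) (niE : (ni + i)%N = n) (njE : (nj + j)%N = n)
  (PE : (Pt + tt)%N = (mi + ni)%N) (QE : (Qt + tt)%N = (mj + nj)%N) (DE : (al + be)%N = (Pt + Qt)%N).

Notation iota1 := (@iota1 k cc al be).
Notation iota2 := (@iota2 k K K' M N).
Notation proj := (@proj k i j mi mj ni nj tt Pt Qt).
Notation projd := (@projd k i j mi mj ni nj tt Pt Qt).
Notation P := (mi + ni)%N.
Notation Q := (mj + nj)%N.
Notation D := (al + be)%N.

(** The discrepancy between the full polarizations in [proj] and the substitutions in steps (4) and
    (5). *)
Definition polFact := (mi`! * ni`! * mj`! * nj`! * Pt`! * Qt`!)%N.

Lemma iota2E (g : {mpoly k[14]}) : iota2 g = bracket k vp vq ^+ K * bracket k vu vv ^+ K' *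
  iter M (polarize vp vx) (iter M (polarize vq vx) (iter N (polarize vu vy) (iter N (polarize vv vy) g))).
Proof.
rewrite /iota2 /Eop; set h := iter N _ (iter N _ g).
rewrite (iter_polarize_mul M K' (s := vq)) ?(iter_polarize_mul M K' (s := vp)) ?mulrA //;
  by rewrite polarize_bracket //= !mul0r addr0.
Qed.

(** The three h factors are those of steps (4) and (5). In the denominator, the factorials of D, 2M
    and 2N come from steps (1) and (2), and [polFact] from replacing substitutions by
    polarizations. *)
Lemma toZ_xi a b r (f : {mpoly k[2]}) : K = (2 * a + 1)%N -> K' = (2 * b + 1)%N -> r = (cc + K + K')%N ->
  (tt + i + j)%N = r -> f \is (al + be).-homog ->
  toZ (xi m n r a b i j f) =
  (hcoef k m n i * hcoef k m n j * hcoef k (mi + ni) (mj + nj) tt /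
   ((al + be)`! * ((M + M)`! * (N + N)`!) * polFact)%:R) *: proj (iota2 (iota1 (toZ f))).
Proof.
move=> Ka Kb rE tE fD.
have dF := mh_iota2 mE nE (mh_iota1 alE beE (mh_toZ fD)).
have s1 : xiStep1 m n r a b f = (al + be)`!%:R^-1 *: iota1 (toZ f).
  rewrite /xiStep1 /iota1 /Eop.
  have -> : (2 * m + 2 * n - 2 * r = al + be)%N by lia.
  have -> : (r - 2 * a - 2 * b - 2 = cc)%N by lia.
  have -> : (2 * m - 2 * a + 2 * b - r = al)%N by lia.
  by have -> : (2 * n + 2 * a - 2 * b - r = be)%N by lia.
have s2 g : xiStep3 (xiStep2 m n a b g) = ((M + M)`! * (N + N)`!)%:R^-1 *: iota2 g.
  rewrite /xiStep3 /xiStep2 iota2E Ka Kb.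
  have -> : (2 * m - 4 * a - 2 = M + M)%N by lia.
  have -> : (2 * n - 4 * b - 2 = N + N)%N by lia.
  have -> : (m - 2 * a - 1 = M)%N by lia.
  have -> : (n - 2 * b - 1 = N)%N by lia.
  rewrite -scalerAr; congr (_ *: _); rewrite !addn1 !exprS; move: (iter M _ _) => h; ring.
rewrite /xi s1 s2 (islinZ _ _ (islin_iota2 _ _ _ _)) /xiStep4 /xiStep5.
set F := iota2 _ in dF *.
have PE' : (m + n - 2 * i = mi + ni)%N by lia.
have QE' : (m + n - 2 * j = mj + nj)%N by lia.
have tE' : (r - i - j = tt)%N by lia.
rewrite PE' QE' tE'.
have lP : islin (fun G : {mpoly k[14]} => substXY (iter i (Omega vp vu) (iter j (Omega vq vv) G))).
  exact: islin_comp (@islin_substXY k) (islin_comp (islin_iter _ (islin_Omega _ _)) (islin_iter _ (islin_Omega _ _))).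
have lT : islin (fun G : {mpoly k[14]} => substZ (iter tt (Omega vx vy) G)).
  exact: islin_comp (@islin_substZ k) (islin_iter _ (islin_Omega _ _)).
rewrite !(islinZ _ _ lP) !(islinZ _ _ lT) !(islinZ _ _ (@islin_toZ k)).
rewrite (subst_proj k_char0 miE mjE niE njE PE QE dF) -/polFact /substZZ !scalerA; congr (_ *: _).
have fn x : x`!%:R != 0 :> k by apply: natk_neq0; rewrite // fact_gt0.
by rewrite !natrM; field; rewrite !fn.
Qed.

Lemma proj_iota_lowest : exists x : k, proj (iota2 (iota1 (zmon k (al + be) 0))) = x *: zmon k (al + be) 0.
Proof.
have dF := mh_iota2 mE nE (mh_iota1 alE beE (@mh_zmon k _ _ (leq0n (al + be)))).
have := lowest_weight k_char0 (mh_proj miE mjE niE njE PE QE dF).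
case=> [s sv sz||x ->].
- by move: s sv sz; apply: vpairP; split; [ | | |split] => // /eqP.
- by rewrite sl2op_proj sl2op_iota2 sl2op_iota1 sl2op_zmon0 (islin0 (islin_iota1 _ _ _)) (islin0 (islin_iota2 _ _ _ _)) (islin0 (islin_proj _ _ _ _ _ _ _ _ _)).
by exists x; rewrite deg7E DE /zmon subn0 expr0 mul1r.
Qed.

Lemma proj_iota_scalar (x : k) : proj (iota2 (iota1 (zmon k (al + be) 0))) = x *: zmon k (al + be) 0 ->
  forall f : {mpoly k[2]}, f \is (al + be).-homog -> proj (iota2 (iota1 (toZ f))) = x *: toZ f.
Proof.
move=> xE f fD.
apply: (sl2_ext k_char0 (L1 := fun f => proj (iota2 (iota1 f))) (L2 := fun f => x *: f)
  (E := sl2op true) _ _ (islin_sl2op _) _ _ xE fD).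
- exact: islin_comp (islin_proj _ _ _ _ _ _ _ _ _) (islin_comp (islin_iota2 _ _ _ _) (islin_iota1 _ _ _)).
- by move=> a u v; rewrite scalerDr !scalerA mulrC.
- by move=> g; rewrite sl2op_proj sl2op_iota2 sl2op_iota1.
by move=> g; rewrite (islinZ _ _ (islin_sl2op _)).
Qed.
Hypothesis tE : (tt + i + j)%N = (cc + K + K')%N.

Lemma projd_low : projd (zmon k (al + be) 0) =
  (al + be)`!%:R *: \sum_(z < tt.+1) ((-1) ^+ (tt - z) * 'C(tt, z)%:R) *:
    (Eop vp vu vx i mi ni (mon2 vx z (P - z)) * Eop vq vv vy j mj nj (mon2 vy (tt - z) (Q - (tt - z)))).
Proof.
clear - PE QE DE; rewrite DE /projd /zmon subn0 -[_ * _]/(mon2 vz 0 (Pt + Qt)) Eop_low // bracket_low.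
have lE := @islin_Eop k.
rewrite !(islinZ _ _ (lE _ _ _ _ _ _)) !(islin_sum _ _ _ (lE _ _ _ _ _ _)); congr (_ *: _).
apply: eq_bigr => z _; rewrite !(islinZ _ _ (lE _ _ _ _ _ _)); congr (_ *: _).
have zt : (z <= tt)%N by rewrite -ltnS.
rewrite [mon2 vx _ _ * _]mulrC (Eop_mulr _ _ _ _ _ _ (w := vy)); last by apply: free_mon2.
rewrite [_ * mon2 vx _ _]mulrC (Eop_mulr _ _ _ _ _ _ (w := vx)); last by apply: free_Eop => //; apply: free_mon2.
by rewrite PE (_ : Qt + z = Q - (tt - z))%N // -QE; lia.
Qed.

Lemma iota2_low : iota2 (mon2 vx cc al * mon2 vy 0 (N + N)) =
  (N + N)`!%:R *: \sum_(l < K'.+1) ((-1) ^+ (K' - l) * 'C(K', l)%:R) *: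
     (mon2 vu l (n - l) * (mon2 vv (K' - l) (n - (K' - l)) * Eop vp vq vx K M M (mon2 vx cc al))).
Proof.
clear - nE.
have lE := @islin_Eop k.
rewrite /iota2 mulrC (Eop_mulr _ _ _ _ _ _ (w := vy)); last by apply: free_mon2.
rewrite Eop_low // mulrC (Eop_mulr _ _ _ _ _ _ (w := vx)); last first.
  apply: freeZ; apply: freeM; first by apply: freeX; apply: free_bracket.
  by apply: freeM; apply: free_mon2.
rewrite -scalerAr bracket_low mulr_sumr; congr (_ *: _); apply: eq_bigr => l _.
have lK : (l <= K')%N by rewrite -ltnS.
have -> : (N + K' - l = n - l)%N by lia.
have -> : (N + l = n - (K' - l))%N by lia.
rewrite -scalerAr.
by congr (_ *: _); ring.
Qed.

(** The monomials in u and v extract one component from each of the two embeddings on the left. What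
    remains is a monomial in p and q, paired with the third embedding through its adjoint. *)
Lemma lambda_pair z l : (z <= tt)%N -> (l <= K')%N ->
  fp (Eop vp vu vx i mi ni (mon2 vx z (P - z)) * Eop vq vv vy j mj nj (mon2 vy (tt - z) (Q - (tt - z))))
     (mon2 vu l (n - l) * (mon2 vv (K' - l) (n - (K' - l)) * Eop vp vq vx K M M (mon2 vx cc al))) =
  (-1) ^+ (K' + K) * ((mi`! * i`!) * (mj`! * j`!) * (M`! * M`!) * (cc`! * al`!))%:R *
   (trv k ni P n z (n - l) * trv k nj Q n (tt - z) (N + l)
     * trv k K m m (z + i - l) (tt - z + j + l - K')).
Proof.
clear DE => zt lK.
have ln : (l <= n)%N by lia.
have ln' : (K' - l <= n)%N by lia.
have zP : (z <= P)%N by lia.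
have zQ : (tt - z <= Q)%N by lia.
rewrite fpC fp_mon2l fp_mon2l fpC.
have c1 := @contract k vp vu vx i mi ni m n P z l isT isT isT isT isT isT miE niE erefl zP ln.
have c2 := @contract k vq vv vy j mj nj m n Q (tt - z) (K' - l) isT isT isT isT isT isT mjE njE erefl zQ ln'.
rewrite (dm_mulr (s := vu)); last by apply: free_Eop => //; apply: free_mon2.
rewrite c1 -scalerAl (islinZ _ _ (islin_dm vv _ _)) [mon2 vp _ _ * _]mulrC (dm_mulr (s := vv)); last by apply: free_mon2.
rewrite c2 -scalerAl scalerA.
have -> : (n - (K' - l) = N + l)%N by lia.
have [A0|/trv_supp[g [g1 g2 g3 g4 g5]]] := eqVneq (trv k ni P n z (n - l)) 0.
  by rewrite A0 !(mulr0, mul0r) scale0r fp0l.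
have [B0|/trv_supp[h [h1 h2 h3 h4 h5]]] := eqVneq (trv k nj Q n (tt - z) (N + l)) 0.
  by rewrite B0 !(mulr0, mul0r) scale0r fp0l.
have -> : (tt - z + j - (K' - l) = tt - z + j + l - K')%N by clear - lK; lia.
rewrite [mon2 vq _ _ * _]mulrC !fpZl fpC fp_Eop fpC.
have xE : (z + i - l + (tt - z + j + l - K') = cc + K)%N by clear - tE zt lK g1 g2 g4 h1 h2 h4 niE njE nE; lia.
have xm : (z + i - l <= m)%N by clear - miE niE g1 g2 g3 g4 g5 zP ln; lia.
have ym : (tt - z + j + l - K' <= m)%N by clear - mjE njE h1 h2 h3 h4 h5 zQ ln' nE lK; lia.
rewrite (@Lop_mon2 k vp vq vx K M m cc al _ _ isT isT isT isT isT isT mE alE xE xm ym).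
rewrite !fpZl fp_mon2_self //.
have -> : (-1) ^+ (K' + K) = (-1) ^+ l * (-1) ^+ (K' - l) * (-1) ^+ K :> k by rewrite -!exprD subnKC.
rewrite !natrM; ring.
Qed.

Lemma lambda0 : fp (projd (zmon k (al + be) 0)) (iota2 (mon2 vx cc al * mon2 vy 0 (N + N))) =
  (-1) ^+ (tt + K) * ((al + be)`! * (N + N)`! *
     ((mi`! * i`!) * (mj`! * j`!) * (M`! * M`!) * (cc`! * al`!)))%:R
   * ninej_sum k m n i j K K' N P Q tt ni nj.
Proof.
rewrite projd_low iota2_low fpZl fpZr fp_suml /ninej_sum !mulr_sumr; apply: eq_bigr => z _.
rewrite fpZl fp_sumr !mulr_sumr; apply: eq_bigr => l _.
have zt : (z <= tt)%N by rewrite -ltnS.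
have lK : (l <= K')%N by rewrite -ltnS.
rewrite fpZr lambda_pair //.
have e1 : (-1) ^+ (tt + K) = (-1) ^+ (tt - z) * (-1) ^+ z * (-1) ^+ K :> k by rewrite -!exprD subnK.
have e2 : (-1) ^+ (K' + K) = (-1) ^+ (K' - l) * (-1) ^+ l * (-1) ^+ K :> k by rewrite -!exprD subnK.
have e3 : (-1) ^+ (K' - l) * (-1) ^+ (K' - l) = 1 :> k by rewrite -expr2 sqrr_sign.
have e4 : (-1) ^+ z * (-1) ^+ z = 1 :> k by rewrite -expr2 sqrr_sign.
rewrite e1 e2 exprD !natrM.
move: e3 e4; move: ((-1) ^+ (K' - l)) ((-1) ^+ z) ((-1) ^+ (tt - z)) ((-1) ^+ l) ((-1) ^+ K) => u v w x y e3 e4.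
move: (trv _ _ _ _ _ _) (trv _ _ _ _ _ _) (trv _ _ _ _ _ _) => t1 t2 t3.
transitivity ((u * u) * ((al + be)`!%:R * (N + N)`!%:R * (w * 'C(tt, z)%:R * ('C(K', l)%:R * (x * y *
   (mi`!%:R * i`!%:R * (mj`!%:R * j`!%:R) * (M`!%:R * M`!%:R) * (cc`!%:R * al`!%:R)) * (t1 * t2 * t3))))) : k); first by ring.
transitivity ((v * v) * ((al + be)`!%:R * (N + N)`!%:R * (w * 'C(tt, z)%:R * ('C(K', l)%:R * (x * y *
   (mi`!%:R * i`!%:R * (mj`!%:R * j`!%:R) * (M`!%:R * M`!%:R) * (cc`!%:R * al`!%:R)) * (t1 * t2 * t3))))) : k); last by ring.
by rewrite e3 e4.
Qed.

(* The contributions of the terms of (x y)^cc = (x_1 y_2 - x_2 y_1)^cc. *)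
Definition lam (e : nat) : k := fp (projd (zmon k (al + be) 0))
   (iota2 (mon2 vx (cc - e) (al + e) * mon2 vy e (be + cc - e))).

(** The lowering operator kills [projd] of z_2^D, which is therefore orthogonal to the image of the
    raising operator. Raising a monomial in x and y of the weight just below gives two neighbouring
    terms. *)
Lemma lam_rec e : (e < cc)%N -> (al + e.+1)%:R * lam e + (be + cc - e)%:R * lam e.+1 = 0.
Proof.
move=> ec.
have : fp (projd (zmon k (al + be) 0))
   (iota2 (sl2op true (mon2 vx (cc - e.+1) (al + e.+1) * mon2 vy e (be + cc - e)))) = 0.
  rewrite -sl2op_iota2 -[true]/(~~ false) -fp_sl2op sl2op_projd sl2op_zmon0.
  by rewrite (islin0 (islin_projd _ _ _ _ _ _ _ _ _)) fp0l.
rewrite sl2opM !sl2op_mon2 // -scalerAl -scalerAr (islinD _ _ (islin_iota2 _ _ _ _)) !(islinZ _ _ (islin_iota2 _ _ _ _)).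
rewrite fpDr !fpZr /lam.
have -> : (cc - e.+1).+1 = (cc - e)%N by lia.
have -> : (al + e.+1).-1 = (al + e)%N by lia.
by have -> : (be + cc - e).-1 = (be + cc - e.+1)%N by lia.
Qed.

Lemma lam_ffact e : (e <= cc)%N -> lam e * ((be + cc) ^_ e)%:R = (-1) ^+ e * ((al + e) ^_ e)%:R * lam 0.
Proof.
elim: e => [|e IH] ec; first by rewrite !ffactn0 !mulr1 mul1r.
have := lam_rec ec; have IHe := IH (ltnW ec) => rec.
rewrite ffactnSr natrM addnS ffactSS natrM exprS.
have -> : lam e.+1 * (((be + cc) ^_ e)%:R * (be + cc - e)%:R) =
  - (al + e.+1)%:R * (lam e * ((be + cc) ^_ e)%:R).
  transitivity (((be + cc) ^_ e)%:R * ((be + cc - e)%:R * lam e.+1)); first by ring.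
  have -> : (be + cc - e)%:R * lam e.+1 = - ((al + e.+1)%:R * lam e).
    by apply/eqP; rewrite -subr_eq0 opprK addrC rec.
  ring.
by rewrite IHe addnS; ring.
Qed.

(** By [lam_ffact] all signs cancel and the ratios of falling factorials form the convolution
    [sum_bin_conv]. This is the origin of (2m+2n-r-2a-2b-1)! = (D+cc+1)! in [N1]. *)
Lemma lam_sum : \sum_(e < cc.+1) (-1) ^+ e * 'C(cc, e)%:R * lam e =
  lam 0 * ((al + be + cc + 1)`! * be`!)%:R / ((be + cc)`! * (al + be + 1)`!)%:R.
Proof.
have fn x : x`!%:R != 0 :> k by apply: natk_neq0; rewrite // fact_gt0.
transitivity (lam 0 * ((cc`! * be`!)%:R / (be + cc)`!%:R) *
   (\sum_(e < cc.+1) 'C(al + e, e) * 'C(be + (cc - e), cc - e))%:R).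
  rewrite natr_sum mulr_sumr; apply: eq_bigr => e _.
  have ec : (e <= cc)%N by rewrite -ltnS.
  have le := lam_ffact ec.
  have f0 : ((be + cc) ^_ e)%:R != 0 :> k by apply: natk_neq0; rewrite // ffact_gt0; lia.
  apply: (mulIf f0); rewrite -[LHS]mulrA le.
  have -> : (-1) ^+ e * 'C(cc, e)%:R * ((-1) ^+ e * ((al + e) ^_ e)%:R * lam 0) =
     ((-1) ^+ e * (-1) ^+ e) * (lam 0 * ('C(cc, e) * (al + e) ^_ e)%:R) by rewrite natrM; ring.
  rewrite -expr2 sqrr_sign mul1r.
  have n1 : ((cc`! * be`!) * ('C(al + e, e) * 'C(be + (cc - e), cc - e)) * (be + cc) ^_ e =
      ('C(cc, e) * (al + e) ^_ e) * (be + cc)`!)%N.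
    rewrite -[in RHS](@ffact_fact (be + cc) e); last by lia.
    have e1 := @bin_ffact (al + e) e.
    have e2 := @bin_fact cc e ec.
    have e3 := @bin_fact (be + (cc - e)) (cc - e) (leq_addl _ _).
    rewrite addnK in e3; rewrite (_ : be + cc - e = be + (cc - e))%N; last by lia.
    by rewrite -e1 -e2 -e3; ring.
  have n2 := congr1 (fun x : nat => x%:R : k) n1; rewrite /= !natrM in n2.
  rewrite !natrM; apply: (mulIf (fn (be + cc)%N)).
  transitivity (lam 0 * ('C(cc, e)%:R * ((al + e) ^_ e)%:R * (be + cc)`!%:R)); first by ring.
  by rewrite -n2; field; rewrite fn.
rewrite sum_bin_conv.
have := @bin_fact (al + be + cc + 1) cc; rewrite (_ : al + be + cc + 1 - cc = al + be + 1)%N; last by lia.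
move=> /(_ ltac:(lia)) <-; rewrite !natrM; field.
by rewrite !fn.
Qed.
Lemma iota1_low : iota1 (zmon k D 0) =
  D`!%:R *: \sum_(e < cc.+1) ((-1) ^+ e * 'C(cc, e)%:R) *:
     (mon2 vx (cc - e) (al + e) * mon2 vy e (be + cc - e)).
Proof.
rewrite /iota1 /zmon subn0 -[_ * _]/(mon2 vz 0 D) Eop_low // bracket_low; congr (_ *: _).
rewrite (reindex_inj rev_ord_inj); apply: eq_bigr => e _ /=.
have ec : (e <= cc)%N by rewrite -ltnS.
rewrite subSS bin_sub // subKn // (_ : al + cc - (cc - e) = al + e)%N; last by clear - ec; lia.
by rewrite (_ : be + (cc - e) = be + cc - e)%N //; clear - ec; lia.
Qed.

(** Pair both sides with z_2^D. Its squared norm D! cancels the D! produced by the polarizations in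
    [iota1]. *)
Lemma proj_scalar x : proj (iota2 (iota1 (zmon k D 0))) = x *: zmon k D 0 ->
  x = lam 0 * ((D + cc + 1)`! * be`!)%:R / ((be + cc)`! * (D + 1)`!)%:R.
Proof.
move=> xE; rewrite -lam_sum.
have Dn : D`!%:R != 0 :> k by apply: natk_neq0; rewrite // fact_gt0.
have ZZ : fp (zmon k D 0) (zmon k D 0) = D`!%:R.
  by rewrite /zmon subn0 -[_ * _]/(mon2 vz 0 D) fp_mon2_self // mul1n.
apply: (mulIf Dn); rewrite -{1}ZZ -fpZr -xE -fp_projd iota1_low.
rewrite (islinZ _ _ (islin_iota2 _ _ _ _)) fpZr mulrC; congr (_ * _).
rewrite (islin_sum _ _ _ (islin_iota2 _ _ _ _)) fp_sumr; apply: eq_bigr => e _.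
by rewrite (islinZ _ _ (islin_iota2 _ _ _ _)) fpZr.
Qed.

Lemma kappa_value a b r x : K = (2 * a + 1)%N -> K' = (2 * b + 1)%N -> r = (cc + K + K')%N ->
  (r <= m)%N -> (r <= n)%N ->
  proj (iota2 (iota1 (zmon k D 0))) = x *: zmon k D 0 ->
  hcoef k m n i * hcoef k m n j * hcoef k P Q tt /
   (D`! * ((M + M)`! * (N + N)`!) * polFact)%:R * x = kappaFormula k m n r a b i j.
Proof.
move=> Ka Kb rE rm rn /proj_scalar->.
have fn q : q`!%:R != 0 :> k by apply: natk_neq0; rewrite // fact_gt0.
have -> : lam 0 = (-1) ^+ (tt + K) * ((al + be)`! * (N + N)`! *
     ((mi`! * i`!) * (mj`! * j`!) * (M`! * M`!) * (cc`! * al`!)))%:R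
   * ninej_sum k m n i j K K' N P Q tt ni nj.
  rewrite -lambda0 /lam !subn0 addn0.
  by rewrite beE.
rewrite (@ninej_sumE k k_char0 m n i j K K' M N P Q tt cc mi mj ni nj mE nE erefl erefl miE mjE niE njE tE); first last.
- by rewrite -rE.
- by rewrite -rE.
have ab : inPi r a b by clear - Ka Kb rE; rewrite /inPi; lia.
have ijr : (i + j <= r)%N by clear - tE rE; lia.
have := ninej_term_Gamma k_char0 rm rn ab ijr; rewrite /= -Ka -Kb.
have -> : (n - i = ni)%N by clear - niE; lia.
have -> : (n - j = nj)%N by clear - njE; lia.
have -> : (m - i = mi)%N by clear - miE; lia.
have -> : (m - j = mj)%N by clear - mjE; lia.
have -> : (n - 2 * b - 1 = N)%N by clear - nE Kb; lia.
have -> : (m - 2 * a - 1 = M)%N by clear - mE Ka; lia.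
have -> : (r - i - j = tt)%N by clear - tE rE; lia.
have -> : (m + n - 2 * i = P)%N by clear - miE niE; lia.
have -> : (m + n - 2 * j = Q)%N by clear - mjE njE; lia.
have -> : (r - 2 * a - 2 * b - 2 = cc)%N by clear - rE Ka Kb; lia.
move=> ->.
rewrite /kappaFormula /N1 /N2 /hcoef /polFact.
have -> : (m + n - 2 * i + 1 = P + 1)%N by clear - miE niE; lia.
have -> : (m + n - 2 * j + 1 = Q + 1)%N by clear - mjE njE; lia.
have -> : (2 * m - 2 * a = M + m + 1)%N by clear - mE Ka; lia.
have -> : (m - 2 * a - 1 = M)%N by clear - mE Ka; lia.
have -> : (n - 2 * b - 1 = N)%N by clear - nE Kb; lia.
have -> : (2 * m - r - 2 * a + 2 * b = al)%N by clear - mE Ka Kb rE alE rm; lia.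
have -> : (2 * n - r + 2 * a - 2 * b = be)%N by clear - nE Ka Kb rE beE rn; lia.
have -> : (2 * m + 2 * n - r - 2 * a - 2 * b - 1 = D + cc + 1)%N by clear - mE nE Ka Kb rE alE beE rm rn; lia.
have -> : (m - i = mi)%N by clear - miE; lia.
have -> : (m - j = mj)%N by clear - mjE; lia.
have -> : (m + n - j + 1 = mj + n + 1)%N by clear - mjE; lia.
have -> : (m + n - i + 1 = mi + n + 1)%N by clear - miE; lia.
have -> : (m + n - r + i - j = Qt)%N by clear - mjE njE QE tE rE rm rn; lia.
have -> : (m + n - r - i + j = Pt)%N by clear - miE niE PE tE rE rm rn; lia.
have -> : (P + Q - 2 * tt + 1 = D + 1)%N by clear - PE QE DE; lia.
have -> : (P + Q - tt + 1 = D + tt + 1)%N by clear - PE QE DE; lia.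
have -> : (2 * m + 2 * n - r - i - j + 1 = D + tt + 1)%N by clear - tE rE PE QE DE miE mjE niE njE; lia.
have -> : (2 * m - 4 * a - 2 = M + M)%N by clear - mE Ka; lia.
have -> : (2 * n - 4 * b - 2 = N + N)%N by clear - nE Kb; lia.
rewrite -Ka beE.
(* This sign cancels the minus sign of [ninej_term_Gamma]. *)
have eK : (-1) ^+ K = -1 :> k by rewrite Ka addn1 exprS exprM sqrrN expr1n expr1n mulr1.
have e1 : (-1) ^+ tt * (-1) ^+ tt = 1 :> k by rewrite -expr2 sqrr_sign.
have e2 : (-1) ^+ nj * (-1) ^+ nj = 1 :> k by rewrite -expr2 sqrr_sign.
rewrite !exprD eK.
move: (Gamma _ _ _ _ _ _ _ _) => G.
move: ((-1) ^+ tt) ((-1) ^+ nj) e1 e2 => u v e1 e2.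
transitivity ((u * u) * (v * v) * (((P + 1)`! * (Q + 1)`! * (M + m + 1)`! * K`! * M`! * N`! * al`! * be`! * (D + cc + 1)`!)%:R /
   (j`! * mi`! * mj`! * (mj + n + 1)`! * Qt`! * Pt`! * (D + tt + 1)`! * (M + M)`! * (N + N)`!)%:R * G)); last first.
  by rewrite e1 e2 !mul1r; congr (_%:R / _ * _); ring.
rewrite !natrM; field.
by rewrite !fn.
Qed.

End KappaValue.

Section XiScalar.
Variable k : fieldType.
Hypothesis k_char0 : [pchar k] =i pred0.

Lemma xi_scalar m n r a b i j : (r <= m)%N -> (r <= n)%N -> inPi r a b -> (i + j <= r)%N ->
  unique (actsByScalar (2 * (m + n - r)) (@xi k m n r a b i j)) (kappaFormula k m n r a b i j).
Proof.
move=> rm rn; rewrite /inPi => ab ijr.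
(* Every difference gets a name and an additive equation; all of them are genuine because of r <= m,
   r <= n, p in Pi and i + j <= r. *)
have [K Ka] : exists K, K = (2 * a + 1)%N by exists (2 * a + 1)%N.
have [K' Kb] : exists K', K' = (2 * b + 1)%N by exists (2 * b + 1)%N.
have [M mE] : exists M, (M + K = m)%N by exists (m - K)%N; lia.
have [N nE] : exists N, (N + K' = n)%N by exists (n - K')%N; lia.
have [cc rE] : exists cc, (r = cc + K + K')%N by exists (r - K - K')%N; lia.
have [al alE] : exists al, (al + cc = M + M)%N by exists (M + M - cc)%N; lia.
have [be beE] : exists be, (be + cc = N + N)%N by exists (N + N - cc)%N; lia.
have [mi miE] : exists mi, (mi + i = m)%N by exists (m - i)%N; lia.
have [mj mjE] : exists mj, (mj + j = m)%N by exists (m - j)%N; lia.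
have [ni niE] : exists ni, (ni + i = n)%N by exists (n - i)%N; lia.
have [nj njE] : exists nj, (nj + j = n)%N by exists (n - j)%N; lia.
have [tt tE] : exists tt, (tt + i + j = r)%N by exists (r - i - j)%N; lia.
have [Pt PE] : exists Pt, (Pt + tt = mi + ni)%N by exists (mi + ni - tt)%N; lia.
have [Qt QE] : exists Qt, (Qt + tt = mj + nj)%N by exists (mj + nj - tt)%N; lia.
have DE : (al + be = Pt + Qt)%N by lia.
have DD : (2 * (m + n - r) = al + be)%N by lia.
rewrite DD.
have tE' := tE; rewrite rE in tE'.
have [x xE] := proj_iota_lowest k_char0 mE nE alE beE miE mjE niE njE PE QE DE.
have kv := kappa_value k_char0 mE nE alE beE miE mjE niE njE PE QE DE tE' Ka Kb rE rm rn xE.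
have act : actsByScalar (al + be) (@xi k m n r a b i j) (kappaFormula k m n r a b i j).
  move=> f fD; apply: (can_inj (@toZK k)).
  rewrite (toZ_xi k_char0 mE nE alE beE miE mjE niE njE PE QE DE Ka Kb rE tE fD).
  by rewrite (proj_iota_scalar k_char0 xE fD) (islinZ _ _ (@islin_toZ k)) scalerA kv.
split=> [|c cact]; first by exact: act.
(* For uniqueness, compare the two scalars on a nonzero form. *)
have fD : ('X_z2 ^+ (al + be) : {mpoly k[2]}) \is (al + be).-homog.
  by rewrite mpolyXn dhomogX /= mdegMn mdeg1 mul1n.
have := act _ fD; rewrite (cact _ fD) => /eqP; rewrite -subr_eq0 -scalerBl scaler_eq0 subr_eq0.
by rewrite mpolyXn -msupp_eq0 msuppX orbF => /eqP ->.
Qed.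

End XiScalar.

Section NonZero.
Variable k : fieldType.
Hypothesis k_char0 : [pchar k] =i pred0.

(** Lambda is the single point (n-r, 1, 0): for x < n-r the range of y is empty, at x = n-r it is y
    = 1, and r-i-j = 0 forces z = 0. No cancellation can occur. *)
Lemma kappaFormula_neq0 m n r : (2 <= r)%N -> (r <= m)%N -> (r <= n)%N ->
  kappaFormula k m n r 0 0 0 r != 0.
Proof.
move=> r2 rm rn; rewrite /kappaFormula.
have NN (x : nat) : (0 < x)%N -> x%:R != 0 :> k by exact: natk_neq0.
apply: mulf_neq0; first by apply: mulf_neq0; rewrite ?invr_neq0 // NN // ?/N1 ?/N2 !muln_gt0 !fact_gt0.
rewrite /Gamma !muln0 !subn0 !addn0 add0n; apply: mulf_neq0; first by rewrite signr_eq0.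
have -> : minn (n - 1) (n - r) = (n - r)%N by lia.
have -> : (minn 1 (2 * n - r)).+1 = 2%N by lia.
rewrite subnn minn0.
rewrite big_nat_recr //= big_nat big1 ?add0r; last first.
  by move=> x xr; rewrite big_geq //; lia.
have -> : (n - r + 1 - (n - r) = 1)%N by lia.
have -> : (r - m - (n - r) = 0)%N by lia.
rewrite big_nat1 min0n big_nat1; apply: mulf_neq0; first by rewrite signr_eq0.
by apply: mulf_neq0; rewrite ?invr_neq0 // NN // ?/T1 ?/T2 !muln_gt0 !fact_gt0.
Qed.

End NonZero.

(** * The syzygies over a field *)

Section RawTransvectant.
Variable R : comNzRingType.
Implicit Types A B F G : {mpoly R[2]}.

(** The transvectant without its rational prefactor, hence compatible with any morphism of
    coefficient rings. *)
Definition rawTransv s F G : {mpoly R[2]} := \sum_(l < s.+1) ((-1) ^+ l * 'C(s, l)%:R) *: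
  (F^`M(z1, (s - l)%N)^`M(z2, l) * G^`M(z1, l)^`M(z2, (s - l)%N)).

Lemma rawTransv_sym s F G : rawTransv s F G = (-1) ^+ s *: rawTransv s G F.
Proof.
rewrite /rawTransv (reindex_inj rev_ord_inj) scaler_sumr; apply: eq_bigr => l _ /=.
have ls : (l <= s)%N by rewrite -ltnS.
have e : (-1) ^+ s * (-1) ^+ l = (-1) ^+ (s - l) :> R.
  have -> : (-1) ^+ s = (-1) ^+ (s - l) * (-1) ^+ l :> R by rewrite -exprD subnK.
  by rewrite -mulrA -expr2 sqrr_sign mulr1.
by rewrite subSS bin_sub // subKn // scalerA mulrA e; congr (_ *: _); exact: mulrC.
Qed.

Lemma dhomog_mderivn i q d A : A \is (d + q).-homog -> A^`M(i, q) \is d.-homog.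
Proof.
elim: q d => [|q IH] d; first by rewrite addn0 mderivn0.
rewrite addnS -addSn => /IH; rewrite mderivnS => /dhomogP hA.
apply/dhomogP => m; rewrite mcoeff_msupp mcoeff_mderiv => nz.
have : (m + U_(i))%MM \in msupp (A^`M(i, q)).
  by rewrite mcoeff_msupp; apply: contraNneq nz => ->; rewrite mul0rn.
by move/hA; rewrite /= mdegD mdeg1 addn1 => -[].
Qed.

Lemma dhomog_mderivn2 q l d A : (l <= q)%N -> A \is (d + q).-homog ->
  A^`M(z1, (q - l)%N)^`M(z2, l) \is d.-homog.
Proof. by move=> lq hA; do 2! apply: dhomog_mderivn; rewrite -addnA subnKC. Qed.

Lemma dhomog_rawTransv q a b A B : A \is (a + q).-homog -> B \is (b + q).-homog -> rawTransv q A B \is (a + b).-homog.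
Proof.
move=> hA hB; apply: rpred_sum => l _; have lq : (l <= q)%N by rewrite -ltnS.
apply: rpredZ; apply: dhomogM; first exact: dhomog_mderivn2.
by do 2! apply: dhomog_mderivn; rewrite -addnA subnK.
Qed.
End RawTransvectant.

Lemma rawTransv_self_odd (k : fieldType) (k0 : [pchar k] =i pred0) s (A : {mpoly k[2]}) : odd s -> rawTransv s A A = 0.
Proof.
move=> os; have := rawTransv_sym s A A; rewrite -signr_odd os expr1 scaleN1r => /eqP.
rewrite -addr_eq0 -mulr2n -scaler_nat scaler_eq0 => /orP[|/eqP //].
by rewrite (negbTE (natk_neq0 k0 _)).
Qed.

(** * From coupling operators to transvectants of forms *)

Section Link.
Variable k : fieldType.
Hypothesis k_char0 : [pchar k] =i pred0.
Implicit Types (f g h : {mpoly k[14]}) (s t w : varPair) (A B : {mpoly k[2]}).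
Notation mon2 := (@mon2 k).

Definition toS s A : {mpoly k[14]} := A \mPo [tuple 'X_(s.1); 'X_(s.2)].

Lemma islin_toS s : islin (toS s).
Proof. by move=> x u v; rewrite /toS comp_mpolyD comp_mpolyZ. Qed.

Lemma toSM s A B : toS s (A * B) = toS s A * toS s B.
Proof. by rewrite /toS rmorphM. Qed.

Lemma toS_mon s m : toS s 'X_[m] = mon2 s (m z1) (m z2).
Proof.
rewrite /toS comp_mpolyX big_ord_recl big_ord1 /mon2 !(tnth_nth 0) /=.
by congr (_ ^+ m _ * _ ^+ m _); apply: val_inj.
Qed.

Lemma toS_ind (Q : {mpoly k[2]} -> Prop) A :
  (forall m, m \in msupp A -> Q 'X_[m]) -> Q 0 -> (forall (c : k) u v, Q u -> Q v -> Q (c *: u + v)) -> Q A.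
Proof.
move=> Qm Q0 Qlin; rewrite [A]mpolyE big_seq; elim/big_rec: _ => // m x mA Qx.
exact: Qlin (Qm m mA) Qx.
Qed.

Lemma toS_free c s A : vpair c -> vpair s -> c != s -> freeOf c (toS s A).
Proof.
move=> cv sv cs; apply: (toS_ind (Q := fun A => freeOf c (toS s A))) => [m _||x u v fu fv].
- by rewrite toS_mon; apply: free_mon2.
- by rewrite (islin0 (islin_toS s)); split; rewrite mderiv0.
by rewrite islin_toS; apply: freeD => //; apply: freeZ.
Qed.

Lemma dm_toS s a b A : vpair s -> dm s a b (toS s A) = toS s (A^`M(z1, a)^`M(z2, b)).
Proof.
move=> sv; apply: (toS_ind (Q := fun A => dm s a b (toS s A) = toS s (A^`M(z1, a)^`M(z2, b)))) => [m _||x u v eu ev].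
- rewrite toS_mon dm_mon2 // mderivnX mderivn_iter.
  rewrite (islinZ _ _ (islin_iter _ (islin_mderiv _))) -mderivn_iter mderivnX scalerA -natrM.
  rewrite (islinZ _ _ (islin_toS s)) toS_mon.
  have e1 : (m - U_(z1) *+ a - U_(z2) *+ b)%MM z1 = (m z1 - a)%N.
    by rewrite !mnmBE !mulmnE !mnm1E /= mul1n mul0n subn0.
  have e2 : (m - U_(z1) *+ a - U_(z2) *+ b)%MM z2 = (m z2 - b)%N.
    by rewrite !mnmBE !mulmnE !mnm1E /= mul1n mul0n subn0.
  have e3 : (m - U_(z1) *+ a)%MM z2 = m z2 by rewrite !mnmBE !mulmnE !mnm1E /= mul0n subn0.
  by rewrite e1 e2 e3.
- rewrite !mderivn_iter !(iter0 _ (islin_mderiv _)) (islin0 (islin_toS s)) (islin0 (islin_dm s a b)) //.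
rewrite islin_toS islin_dm eu ev !mderivn_iter (islin_iter _ (islin_mderiv _)) (islin_iter _ (islin_mderiv _)).
by rewrite islin_toS.
Qed.

Lemma polarize_toS d s w A : vpair s -> vpair w -> w != s -> A \is d.-homog ->
  iter d (polarize w s) (toS s A) = d`!%:R *: toS w A.
Proof.
move=> sv wv ws /dhomogP hA.
have lin := islin_iter d (islin_polarize (k := k) w s).
apply: (toS_ind (Q := fun A => iter d (polarize w s) (toS s A) = d`!%:R *: toS w A)) => [m mA||x u v eu ev].
- have := hA m mA; rewrite /= mdegE big_ord_recl big_ord1 => ma.
  rewrite !toS_mon polarize_full // -ma; congr (m _ + m _)%N; exact: val_inj.
- by rewrite !(islin0 (islin_toS _)) (islin0 lin) scaler0.
by rewrite !islin_toS lin eu ev scalerDr !scalerA mulrC.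
Qed.

(** On a product of forms in s and in t, Omega^q expands into the sum defining the transvectant, and
    polarization renames s and t to w. The factor h carries the other pairs as spectators, so the
    lemma can be applied repeatedly. *)
Lemma Lop_toS s t w q a b A B h : vpair s -> vpair t -> vpair w -> s != t -> s != w -> t != w ->
  freeOf s h -> freeOf t h -> A \is (a + q).-homog -> B \is (b + q).-homog ->
  Lop s t w q a b (toS s A * toS t B * h) = (a`! * b`!)%:R *: (toS w (rawTransv q A B) * h).
Proof.
move=> sv tv wv st sw tw sh th hA hB.
have ts : t != s by rewrite eq_sym.
have ws : w != s by rewrite eq_sym.
have wt : w != t by rewrite eq_sym.
rewrite /Lop (Omega_expand q _ sv tv ts) !(islin_sum _ _ _ (islin_iter _ (islin_polarize _ _))).
rewrite /rawTransv (islin_sum _ _ _ (islin_toS w)) [X in _ = _ *: X]mulr_suml scaler_sumr; apply: eq_bigr => g _.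
have gq : (g <= q)%N by rewrite -ltnS.
rewrite !(islinZ _ _ (islin_iter _ (islin_polarize _ _))) (islinZ _ _ (islin_toS w)) -scalerAl.
move: ((-1) ^+ g * 'C(q, g)%:R) => c; rewrite [RHS]scalerA [_ * c]mulrC -scalerA; congr (_ *: _).
have -> : toS s A * toS t B * h = toS t B * (toS s A * h) by ring.
rewrite (dm_mulr (s := t)); last by apply: freeM => //; apply: toS_free.
have -> : dm t g (q - g) (toS t B) * (toS s A * h) = toS s A * (dm t g (q - g) (toS t B) * h) by ring.
have fB : freeOf s (dm t g (q - g) (toS t B)) by rewrite dm_toS //; apply: toS_free.
rewrite (dm_mulr (s := s)); last by apply: freeM.
rewrite !dm_toS // iter_polarize_mulr; last by apply: freeM => //; apply: toS_free.
rewrite polarize_toS //; last exact: dhomog_mderivn2.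
have fA : freeOf t (toS w (A^`M(z1, (q - g)%N)^`M(z2, g))) by apply: toS_free.
rewrite -scalerAl (islinZ _ _ (islin_iter _ (islin_polarize _ _))).
set A1 := toS w _ in fA *; set B1 := toS t _.
have -> : A1 * (B1 * h) = B1 * (A1 * h) by ring.
rewrite iter_polarize_mulr; last exact: freeM.
rewrite polarize_toS //; last by do 2! apply: dhomog_mderivn; rewrite -addnA subnK.
by rewrite -scalerAl scalerA -natrM toSM; congr (_ *: _); rewrite /A1; ring.
Qed.
End Link.

Section LowestWeight.
Variable k : fieldType.
Hypothesis k_char0 : [pchar k] =i pred0.
Implicit Types (f g h F : {mpoly k[14]}).

(* On lowest weight vectors this is minus the weight. *)
Definition lowraise f : {mpoly k[14]} := sl2op false (sl2op true f).

Lemma islin_lowraise : islin lowraise.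
Proof. exact: islin_comp (islin_sl2op _) (islin_sl2op _). Qed.

Lemma lowraise_zmon D : lowraise (zmon k D 0) = D%:R *: zmon k D 0.
Proof.
rewrite /lowraise; case: D => [|D].
  rewrite scale0r (_ : sl2op true _ = 0) ?(islin0 (islin_sl2op _)) //.
  by rewrite -[zmon k 0 0]/(mon2 k vz 0 0) sl2op_mon2 // scale0r.
rewrite sl2op_zmon // subn0 (islinZ _ _ (islin_sl2op _)); congr (_ *: _).
rewrite sl2op_vz; last by move=> s sv sz; apply: zmon_free.
rewrite /co /zmon mderivM !mderivX_exp !mderivXU /= mulr0n mulr1n mulr1 expr0 scale1r mul1r.
by rewrite mulr0 scaler0 mulr0 addr0 subSS !subn0 mul1r -exprS.
Qed.

(** A lowest weight vector of order d has eigenvalue d under [lowraise]; two different eigenvalues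
    leave only 0. *)
Lemma lowest_weight0 d D f : mh (deg7 0 0 d 0 0 0 0) f -> sl2op false f = 0 ->
  lowraise f = D%:R *: f -> d != D -> f = 0.
Proof.
move=> df f0 fD dD.
have [|x fx] := lowest_weight k_char0 df _ f0.
  by move=> s sv sz; move: s sv sz; apply: vpairP; split; [ | | |split] => // /eqP.
have {fx} fx : f = x *: zmon k d 0 by rewrite fx deg7E /zmon subn0 expr0 mul1r.
move: fD; rewrite {1}fx (islinZ _ _ islin_lowraise) lowraise_zmon scalerA mulrC -scalerA -fx => /eqP.
rewrite -subr_eq0 -scalerBl scaler_eq0 subr_eq0 => /orP[/eqP/(natk_inj k_char0) e|/eqP //].
by rewrite e eqxx in dD.
Qed.

Lemma mdeg2 (m : 'X_{1..2}) : mdeg m = (m z1 + m z2)%N.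
Proof. by rewrite mdegE big_ord_recl big_ord1; congr (m _ + m _)%N; apply: val_inj. Qed.

(** Monomials of the same order are orthogonal, with squared norms that are products of factorials
    and hence nonzero. *)
Lemma fp_toZ_nondeg D S : S \is D.-homog ->
  (forall f : {mpoly k[2]}, f \is D.-homog -> fp (toZ f) (toZ S) = 0) -> S = 0.
Proof.
move=> SD H; apply/mpolyP => m; rewrite mcoeff0; apply/eqP; apply: contraT => Sm.
have mS : m \in msupp S by rewrite mcoeff_msupp.
have dm' := homog_mdeg SD mS.
have XD : ('X_[m] : {mpoly k[2]}) \is D.-homog by rewrite dhomogX /= dm'.
have := H _ XD; rewrite -[toZ 'X_[m]]/(toS vz 'X_[m]) toS_mon -[toZ S]/(toS vz S).
rewrite [in X in fp _ X](mpolyE S) (islin_sum _ _ _ (islin_toS vz)) fp_sumr (bigD1_seq m) //=.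
rewrite (islinZ _ _ (islin_toS vz)) toS_mon fpZr fp_mon2_self // big_seq_cond big1 ?addr0.
  move=> /eqP; rewrite mulf_eq0 (negbTE Sm) orFb => /eqP e0.
  by have := natk_neq0 k_char0 (_ : (0 < (m z1)`! * (m z2)`!)%N); rewrite e0 eqxx muln_gt0 !fact_gt0 => /(_ isT).
move=> m' /andP[m'S mm']; rewrite (islinZ _ _ (islin_toS vz)) toS_mon fpZr.
suff -> : fp (mon2 k vz (m z1) (m z2)) (mon2 k vz (m' z1) (m' z2)) = 0 by rewrite mulr0.
rewrite -[X in fp X _]mulr1 fp_mon2l dm_mon2 //.
suff -> : ((m' z1) ^_ (m z1) * (m' z2) ^_ (m z2) = 0)%N by rewrite scale0r fp0r.
have := homog_mdeg SD m'S; rewrite -dm' !mdeg2 => e.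
have [h|h] := ltnP (m' z1) (m z1); first by rewrite ffact_small.
rewrite [(m' z2 ^_ _)%N]ffact_small ?muln0 //.
have ne : m' z1 != m z1.
  apply: contra mm' => /eqP e1; apply/eqP/mnmP => -[[|[|l]] hl] //.
    by have -> : Ordinal hl = z1 by apply: val_inj.
  have -> : Ordinal hl = z2 by apply: val_inj.
  by clear - e e1; lia.
by clear - e ne h; lia.
Qed.

Lemma trv_sym q A a b : trv k q A A a b = (-1) ^+ q * trv k q A A b a.
Proof.
rewrite /trv (reindex_inj rev_ord_inj) mulr_sumr; apply: eq_bigr => g _ /=.
have gq : (g <= q)%N by rewrite -ltnS.
have e : (-1) ^+ q * (-1) ^+ g = (-1) ^+ (q - g) :> k.
  have -> : (-1) ^+ q = (-1) ^+ (q - g) * (-1) ^+ g :> k by rewrite -exprD subnK.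
  by rewrite -mulrA -expr2 sqrr_sign mulr1.
rewrite subSS bin_sub // subKn // mulrA e; congr (_ * (_ * _)%:R); ring.
Qed.

(** Reversing z and l exchanges the first two transvectants and swaps the arguments of the third.
    The signs are (-1)^t from z, (-1)^K' from l and (-1)^K from the third transvectant; the last two
    cancel. *)
Lemma ninej_sum_sym m n i j K K' N P Q t ni nj : (K' <= n)%N -> (N + K' = n)%N -> odd K -> odd K' ->
  ninej_sum k m n j i K K' N Q P t nj ni = (-1) ^+ t * ninej_sum k m n i j K K' N P Q t ni nj.
Proof.
move=> Kn NE oK oK'; rewrite /ninej_sum (reindex_inj rev_ord_inj) mulr_sumr; apply: eq_bigr => z _ /=.
have zt : (z <= t)%N by rewrite -ltnS.
rewrite (reindex_inj rev_ord_inj) mulr_sumr; apply: eq_bigr => l _ /=.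
have lK : (l <= K')%N by rewrite -ltnS.
rewrite !subSS !bin_sub // !subKn // trv_sym.
have -> : (n - (K' - l) = N + l)%N by clear - NE lK; lia.
have -> : (N + (K' - l) = n - l)%N by clear - NE lK; lia.
have -> : (z + i + (K' - l) - K' = z + i - l)%N by clear - lK; lia.
have -> : (t - z + j - (K' - l) = t - z + j + l - K')%N by clear - lK; lia.
have -> : (-1) ^+ (t - z + (K' - l)) = (-1) ^+ t * (-1) ^+ K' * (-1) ^+ (z + l) :> k.
  have -> : (-1) ^+ t = (-1) ^+ (t - z) * (-1) ^+ z :> k by rewrite -exprD subnK.
  have -> : (-1) ^+ K' = (-1) ^+ (K' - l) * (-1) ^+ l :> k by rewrite -exprD subnK.
  rewrite !exprD.
  have e1 : (-1) ^+ z * (-1) ^+ z = 1 :> k by rewrite -expr2 sqrr_sign.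
  have e2 : (-1) ^+ l * (-1) ^+ l = 1 :> k by rewrite -expr2 sqrr_sign.
  move: ((-1) ^+ z) ((-1) ^+ l) e1 e2 ((-1) ^+ (t - z)) ((-1) ^+ (K' - l)) => u v e1 e2 x y.
  by transitivity ((u * u) * (v * v) * (x * y)); [rewrite e1 e2 !mul1r | ring].
rewrite -[(-1) ^+ K']signr_odd -[(-1) ^+ K]signr_odd oK oK' expr1.
ring.
Qed.

Lemma network_params m n r a b : (r <= m)%N -> (r <= n)%N -> inPi r a b ->
  exists K K' M N cc al be,
  [/\ K = (2 * a + 1)%N, K' = (2 * b + 1)%N, (M + K = m)%N & (N + K' = n)%N] /\
  [/\ (al + cc = M + M)%N, (be + cc = N + N)%N & r = (cc + K + K')%N].
Proof.
rewrite /inPi => rm rn ab.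
exists (2 * a + 1)%N, (2 * b + 1)%N, (m - (2 * a + 1))%N, (n - (2 * b + 1))%N, (r - (2 * a + 1) - (2 * b + 1))%N.
exists (m - (2 * a + 1) + (m - (2 * a + 1)) - (r - (2 * a + 1) - (2 * b + 1)))%N.
exists (n - (2 * b + 1) + (n - (2 * b + 1)) - (r - (2 * a + 1) - (2 * b + 1)))%N.
by split; split=> //; lia.
Qed.

(** The meaning of h(p,q;s): it inverts the norm of the Clebsch-Gordan embedding, up to the
    factorials created by polarization. *)
Lemma cgNorm_hcoef p q s a b : (a + s = p)%N -> (b + s = q)%N ->
  (cgNorm s a b)%:R * hcoef k p q s = (a`! * b`! * (a + b)`!)%:R.
Proof.
move=> <- <-; rewrite /cgNorm /hcoef.
have -> : (a + s + (b + s) - s + 1 = a + b + s + 1)%N by lia.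
have -> : (a + s + (b + s) - 2 * s + 1 = a + b + 1)%N by lia.
have <- : ((a + b + s + 1) ^_ s * (a + b + 1)`! = (a + b + s + 1)`!)%N.
  by rewrite -(@ffact_fact (a + b + s + 1) s); [congr (_ * _`!)%N|]; lia.
rewrite !natrM; field.
by rewrite !factf_neq0 // natk_neq0 // ffact_gt0; lia.
Qed.

End LowestWeight.

(** * The Clebsch-Gordan expansion and the syzygy *)

Section Syzygy.
Variable k : fieldType.
Hypothesis k_char0 : [pchar k] =i pred0.
Implicit Types (f g h F : {mpoly k[14]}).

Variables m n r K K' M N cc al be : nat.
Hypotheses (mE : (M + K)%N = m) (nE : (N + K')%N = n) (alE : (al + cc)%N = (M + M)%N)
  (beE : (be + cc)%N = (N + N)%N) (rE : r = (cc + K + K')%N) (rm : (r <= m)%N) (rn : (r <= n)%N).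

Notation iota1 := (@iota1 k cc al be).
Notation iota2 := (@iota2 k K K' M N).
Notation D := (al + be)%N.
Notation Z := (zmon k D 0).

(** The last two parameters are (m+n-2i) - (r-i-j) and (m+n-2j) - (r-i-j), with the subtractions
    collected. *)
Definition pj i j := @proj k i j (m - i) (m - j) (n - i) (n - j) (r - i - j) (m + n + j - r - i) (m + n + i - r - j).
Definition pjd i j := @projd k i j (m - i) (m - j) (n - i) (n - j) (r - i - j) (m + n + j - r - i) (m + n + i - r - j).

(** Three applications of [Lop_inj] reduce the claim to all triples (i, j, q). For i+j+q = r the
    component is zero by hypothesis. Otherwise it is a lowest weight vector of order 2(m+n-i-j-q),
    which differs from D, so its [lowraise] eigenvalue excludes it. *)
Lemma proj_joint_inj F : mh (deg7 0 0 0 m m n n) F -> sl2op false F = 0 -> lowraise F = D%:R *: F ->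
  (forall i j, (i + j <= r)%N -> pj i j F = 0) -> F = 0.
Proof.
move=> dF F0 FD pF.
apply: (Lop_inj k_char0 (s := vp) (t := vu) (w := vx) (d := deg7 0 0 0 m m n n)) => // i; rewrite !deg7E => hi.
have dFi : mh (deg7 (m - i + (n - i)) 0 0 0 m 0 n) (Lop vp vu vx i (m - i) (n - i) F).
  by apply: mh_Lop dF => //; vpairs.
apply: (Lop_inj k_char0 (s := vq) (t := vv) (w := vy) (d := deg7 (m - i + (n - i)) 0 0 0 m 0 n)) => // j; rewrite !deg7E => hj.
set R := Lop vq _ _ _ _ _ _.
have dR : mh (deg7 (m - i + (n - i)) (m - j + (n - j)) 0 0 0 0 0) R by apply: mh_Lop dFi => //; vpairs.
apply: (Lop_inj k_char0 (s := vx) (t := vy) (w := vz) (d := deg7 (m - i + (n - i)) (m - j + (n - j)) 0 0 0 0 0)) => // q; rewrite !deg7E => hq.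
have [ijq|ijq] := eqVneq (i + j + q)%N r.
  have ij : (i + j <= r)%N by clear - ijq; lia.
  have := pF i j ij; rewrite /pj /proj -/R.
  have -> : (r - i - j = q)%N by clear - ijq; lia.
  have -> : (m + n + j - r - i = m - i + (n - i) - q)%N by clear - ijq hi hj rm rn; lia.
  by have -> : (m + n + i - r - j = m - j + (n - j) - q)%N by clear - ijq hi hj rm rn; lia.
apply: (@lowest_weight0 k k_char0 (m - i + (n - i) - q + (m - j + (n - j) - q)) D).
- by apply: mh_Lop dR => //; clear - hq; vpairs.
- by rewrite /R !sl2op_Lop // F0 !(islin0 (islin_Lop _ _ _ _ _ _)).
- by rewrite /R /lowraise !sl2op_Lop // -/(lowraise F) FD !(islinZ _ _ (islin_Lop _ _ _ _ _ _)).
by apply: contra ijq => /eqP; clear - hi hj hq rm rn mE nE alE beE rE => e; apply/eqP; lia.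
Qed.

Definition cgNorm3 i j := (cgNorm (r - i - j) (m + n + j - r - i) (m + n + i - r - j) *
   (cgNorm j (m - j) (n - j) * cgNorm i (m - i) (n - i)))%N.

Lemma pj_pjd i j i' j' f : (i + j <= r)%N -> (i' + j' <= r)%N -> mh (deg7 0 0 D 0 0 0 0) f ->
  pj i j (pjd i' j' f) = (if (i == i') && (j == j') then (cgNorm3 i j)%:R else 0) *: f.
Proof.
move=> ij ij' df; rewrite /pj /pjd /proj /projd.
set Y := Eop vx vy vz _ _ _ f.
have dY : mh (deg7 (m - i' + (n - i')) (m - j' + (n - j')) 0 0 0 0 0) Y.
  by apply: mh_Eop df => //; clear - ij' rm rn mE nE alE beE rE; vpairs.
set X := Eop vq vv vy _ _ _ Y.
have dX : mh (deg7 (m - i' + (n - i')) 0 0 0 m 0 n) X.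
  by apply: mh_Eop dY => //; clear - ij' rm rn; vpairs.
have [ii|ii] := eqVneq i i'; last first.
  rewrite (Lop_Eop_neq k_char0 (w := vx) _ _ _ _ _ _ dX) ?deg7E // 1?eq_sym //; try (clear - ij ij' rm rn; lia).
  by rewrite !(islin0 (islin_Lop _ _ _ _ _ _)) scale0r.
rewrite ii (Lop_Eop k_char0 (w := vx) _ _ _ _ _ _ _ dX) ?deg7E // !(islinZ _ _ (islin_Lop _ _ _ _ _ _)).
have [jj|jj] := eqVneq j j'; last first.
  rewrite (Lop_Eop_neq k_char0 (w := vy) _ _ _ _ _ _ dY) ?deg7E // 1?eq_sym //; try (clear - ij ij' rm rn; lia).
  by rewrite !(islin0 (islin_Lop _ _ _ _ _ _)) scale0r scaler0.
rewrite jj (Lop_Eop k_char0 (w := vy) _ _ _ _ _ _ _ dY) ?deg7E // !(islinZ _ _ (islin_Lop _ _ _ _ _ _)).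
rewrite (Lop_Eop k_char0 (w := vz) _ _ _ _ _ _ _ df) ?deg7E //; last by clear - ij' rm rn mE nE alE beE rE; lia.
by rewrite !scalerA -!natrM /=; congr (_%:R *: _); rewrite /cgNorm3; ring.
Qed.

Lemma islin_pjd i j : islin (pjd i j). Proof. exact: islin_projd. Qed.

Lemma islin_pj i j : islin (pj i j). Proof. exact: islin_proj. Qed.

Lemma mh_pjd i j f : (i + j <= r)%N -> mh (deg7 0 0 D 0 0 0 0) f -> mh (deg7 0 0 0 m m n n) (pjd i j f).
Proof.
move=> ij df; apply: mh_projd; try by clear - ij rm rn; lia.
by have <- : (al + be = m + n + j - r - i + (m + n + i - r - j))%N by clear - ij rm rn mE nE alE beE rE; lia.
Qed.

(** Orthogonality of the [pjd] forces the coefficients. The difference of the two sides is a lowest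
    weight vector killed by every [pj], hence zero by [proj_joint_inj]. *)
Lemma iota_expand_low (x : nat -> nat -> k) :
  (forall i j, (i + j <= r)%N -> pj i j (iota2 (iota1 Z)) = x i j *: Z) ->
  iota2 (iota1 Z) = \sum_(i < r.+1) \sum_(j < r.+1 | (i + j <= r)%N) (x i j / (cgNorm3 i j)%:R) *: pjd i j Z.
Proof.
move=> xE; apply/eqP; rewrite -subr_eq0; apply/eqP.
have dZ := @mh_zmon k D 0 (leq0n _).
have Z0 := sl2op_zmon0 k (al + be).
have ZD := lowraise_zmon k (al + be).
set S := \sum_(i < _) _; set G := iota2 _.
have cn i j : (cgNorm3 i j)%:R != 0 :> k.
  by apply: natk_neq0; rewrite // /cgNorm3 /cgNorm !muln_gt0 !fact_gt0 !ffact_gt0 /=; clear; lia.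
apply: proj_joint_inj.
- rewrite -[- S]scaleN1r; apply: mhD.
    rewrite /G. have Q1 := mh_iota1 alE beE dZ. have Q2 := mh_iota2 mE nE Q1. exact: Q2.
  by apply: mhZ; apply: mh_sum => i _; apply: mh_sum => j ij; apply: mhZ; apply: mh_pjd.
- rewrite (islinB _ _ (islin_sl2op _)) /G sl2op_iota2 sl2op_iota1 Z0 (islin0 (islin_iota1 _ _ _)) (islin0 (islin_iota2 _ _ _ _)).
  rewrite /S (islin_sum _ _ _ (islin_sl2op _)) big1 ?subr0 // => i _.
  rewrite (islin_sum _ _ _ (islin_sl2op _)) big1 // => j _.
  by rewrite (islinZ _ _ (islin_sl2op _)) /pjd sl2op_projd Z0 (islin0 (islin_projd _ _ _ _ _ _ _ _ _)) scaler0.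
- rewrite (islinB _ _ (@islin_lowraise k)) scalerBr; congr (_ - _).
    by rewrite /G /lowraise !sl2op_iota2 !sl2op_iota1 -/(lowraise Z) ZD (islinZ _ _ (islin_iota1 _ _ _)) (islinZ _ _ (islin_iota2 _ _ _ _)).
  rewrite /S (islin_sum _ _ _ (@islin_lowraise k)) scaler_sumr; apply: eq_bigr => i _.
  rewrite (islin_sum _ _ _ (@islin_lowraise k)) scaler_sumr; apply: eq_bigr => j _.
  rewrite (islinZ _ _ (@islin_lowraise k)) /lowraise /pjd !sl2op_projd -/(lowraise Z) ZD.
  by rewrite (islinZ _ _ (islin_projd _ _ _ _ _ _ _ _ _)) !scalerA mulrC.
move=> i j ij; rewrite (islinB _ _ (islin_pj _ _)) xE //.
rewrite /S (islin_sum _ _ _ (islin_pj _ _)).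
have ir : (i < r.+1)%N by clear - ij; lia.
have jr : (j < r.+1)%N by clear - ij; lia.
rewrite (bigD1 (Ordinal ir)) //= [X in _ - (_ + X)]big1 ?addr0; last first.
  move=> i' ii; rewrite (islin_sum _ _ _ (islin_pj _ _)) big1 // => j' ij'.
  rewrite (islinZ _ _ (islin_pj _ _)) (pj_pjd ij ij' dZ).
  by move: ii; rewrite -val_eqE /= eq_sym => /negbTE ->; rewrite scale0r scaler0.
rewrite (islin_sum _ _ _ (islin_pj _ _)) (bigD1 (Ordinal jr)) //= [X in _ - (_ + X)]big1 ?addr0; last first.
  move=> j' /andP[ij' jj].
  rewrite (islinZ _ _ (islin_pj _ _)) (pj_pjd ij ij' dZ).
  by move: jj; rewrite -val_eqE /= eq_sym => /negbTE ->; rewrite andbF scale0r scaler0.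
rewrite (islinZ _ _ (islin_pj _ _)) (pj_pjd ij ij dZ) !eqxx /=.
by rewrite scalerA mulfVK // subrr.
Qed.

Lemma iota_expand (x : nat -> nat -> k) :
  (forall i j, (i + j <= r)%N -> pj i j (iota2 (iota1 Z)) = x i j *: Z) ->
  forall f : {mpoly k[2]}, f \is D.-homog ->
  iota2 (iota1 (toZ f)) = \sum_(i < r.+1) \sum_(j < r.+1 | (i + j <= r)%N) (x i j / (cgNorm3 i j)%:R) *: pjd i j (toZ f).
Proof.
move=> xE f fD.
pose L2 g := \sum_(i < r.+1) \sum_(j < r.+1 | (i + j <= r)%N) (x i j / (cgNorm3 i j)%:R) *: pjd i j g.
apply: (sl2_ext k_char0 (L1 := fun g => iota2 (iota1 g)) (L2 := L2) (E := sl2op true) _ _ (islin_sl2op _) _ _ _ fD).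
- exact: islin_comp (islin_iota2 _ _ _ _) (islin_iota1 _ _ _).
- move=> a u v; rewrite /L2 scaler_sumr -big_split; apply: eq_bigr => i _ /=.
  rewrite scaler_sumr -big_split; apply: eq_bigr => j _ /=.
  by rewrite (islin_pjd i j) scalerDr !scalerA [a * _]mulrC.
- by move=> g; rewrite sl2op_iota2 sl2op_iota1.
- move=> g; rewrite /L2 (islin_sum _ _ _ (islin_sl2op _)); apply: eq_bigr => i _.
  rewrite (islin_sum _ _ _ (islin_sl2op _)); apply: eq_bigr => j _.
  by rewrite (islinZ _ _ (islin_sl2op _)) /pjd sl2op_projd.
exact: iota_expand_low.
Qed.

Definition polFactAt i j := polFact (m - i) (m - j) (n - i) (n - j) (m + n + j - r - i) (m + n + i - r - j).

Variables a b : nat.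
Hypotheses (Ka : K = (2 * a + 1)%N) (Kb : K' = (2 * b + 1)%N).
Notation kappa := (kappaFormula k m n r a b).

(** The constant by which xi differs from the composition of [pj], [iota2] and [iota1]. *)
Definition kfac i j : k := hcoef k m n i * hcoef k m n j * hcoef k (m - i + (n - i)) (m - j + (n - j)) (r - i - j)
  / (D`! * ((M + M)`! * (N + N)`!) * polFactAt i j)%:R.

Lemma kfac_neq0 i j : kfac i j != 0.
Proof.
rewrite /kfac /hcoef /polFactAt /polFact !natrM.
by rewrite !(mulf_neq0, invr_neq0, factf_neq0).
Qed.

(** The second half keeps kappa in terms of the double sum, in which the exchange of i and j can be
    followed. *)
Lemma kappa_pj i j : (i + j <= r)%N ->
  pj i j (iota2 (iota1 Z)) = (kappa i j / kfac i j) *: Z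
  /\ kappa i j = kfac i j * ((-1) ^+ (r - i - j + K) * (D`! * (N + N)`! *
     (((m - i)`! * i`!) * ((m - j)`! * j`!) * (M`! * M`!) * (cc`! * al`!)))%:R
   * ninej_sum k m n i j K K' N (m - i + (n - i)) (m - j + (n - j)) (r - i - j) (n - i) (n - j)
   * ((al + be + cc + 1)`! * be`!)%:R / ((be + cc)`! * (al + be + 1)`!)%:R).
Proof.
move=> ij.
have miE : (m - i + i = m)%N by clear - ij rm; lia.
have mjE : (m - j + j = m)%N by clear - ij rm; lia.
have niE : (n - i + i = n)%N by clear - ij rn; lia.
have njE : (n - j + j = n)%N by clear - ij rn; lia.
have PE : (m + n + j - r - i + (r - i - j) = m - i + (n - i))%N by clear - ij rm rn; lia.
have QE : (m + n + i - r - j + (r - i - j) = m - j + (n - j))%N by clear - ij rm rn; lia.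
have DE : (al + be = m + n + j - r - i + (m + n + i - r - j))%N by clear - ij rm rn mE nE alE beE rE; lia.
have tE : (r - i - j + i + j = cc + K + K')%N by clear - ij rE; lia.
have [x xE] := proj_iota_lowest k_char0 mE nE alE beE miE mjE niE njE PE QE DE.
have kv := kappa_value k_char0 mE nE alE beE miE mjE niE njE PE QE DE tE Ka Kb rE rm rn xE.
have kv' : kfac i j * x = kappa i j := kv.
rewrite -kv'; split; first by rewrite mulrC mulKf ?kfac_neq0.
rewrite (proj_scalar k_char0 mE nE alE beE miE mjE niE njE PE QE DE tE xE).
rewrite -(lambda0 k mE nE alE beE miE mjE niE njE PE QE DE tE) /lam !subn0 addn0.
by rewrite beE.
Qed.

(** In the double-sum expression every other factor is symmetric, so the sign is that of
    [ninej_sum_sym]. *)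
Lemma kappa_sym i j : (i + j <= r)%N -> kappa j i = (-1) ^+ (r - i - j) * kappa i j.
Proof.
move=> ij; have ji : (j + i <= r)%N by rewrite addnC.
have [_ ->] := kappa_pj ij; have [_ ->] := kappa_pj ji.
have -> : kfac j i = kfac i j.
  rewrite /kfac; have -> : polFactAt j i = polFactAt i j by rewrite /polFactAt /polFact; ring.
  rewrite [hcoef k m n j * _]mulrC; congr (_ * _ / _).
  rewrite (_ : r - j - i = r - i - j)%N; last by clear; lia.
  by rewrite /hcoef [(m - j + (n - j) + _)%N]addnC.
have -> : (r - j - i = r - i - j)%N by clear; lia.
rewrite [in LHS]ninej_sum_sym //; first last.
- by rewrite Kb addn1 /= mul2n odd_double.
- by rewrite Ka addn1 /= mul2n odd_double.
- by clear - nE; lia.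
rewrite !natrM; ring.
Qed.

(** The product of the prefactors of (A,B)_i, of (A,B)_j and of the outer transvectant. *)
Definition tcoef i j : k :=
  ((m + n - 2 * i - (r - i - j))`! * (m + n - 2 * j - (r - i - j))`!)%:R / ((m + n - 2 * i)`! * (m + n - 2 * j)`!)%:R
  * (((m - i)`! * (n - i)`!)%:R / (m`! * n`!)%:R * (((m - j)`! * (n - j)`!)%:R / (m`! * n`!)%:R)).

(** The normalization h in xi is what makes the constant on the right independent of i and j, so
    that it can be divided out of the syzygy. *)
Lemma kappa_tcoef i j : (i + j <= r)%N ->
  kappa i j / kfac i j / (cgNorm3 i j)%:R * (polFactAt i j)%:R =
  ((m`! * n`!) ^ 2 * ((M + M)`! * (N + N)`!))%:R * (kappa i j * tcoef i j).
Proof.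
move=> ij; move: (kappa i j) => x.
have h1 : (cgNorm i (m - i) (n - i))%:R * hcoef k m n i = ((m - i)`! * (n - i)`! * (m - i + (n - i))`!)%:R.
  by apply: (cgNorm_hcoef k_char0); clear - ij rm rn; lia.
have h2 : (cgNorm j (m - j) (n - j))%:R * hcoef k m n j = ((m - j)`! * (n - j)`! * (m - j + (n - j))`!)%:R.
  by apply: (cgNorm_hcoef k_char0); clear - ij rm rn; lia.
have h3 : (cgNorm (r - i - j) (m + n + j - r - i) (m + n + i - r - j))%:R *
   hcoef k (m - i + (n - i)) (m - j + (n - j)) (r - i - j) =
   ((m + n + j - r - i)`! * (m + n + i - r - j)`! * (m + n + j - r - i + (m + n + i - r - j))`!)%:R.
  by apply: (cgNorm_hcoef k_char0); clear - ij rm rn; lia.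
have DE : (al + be = m + n + j - r - i + (m + n + i - r - j))%N by clear - ij rm rn mE nE alE beE rE; lia.
rewrite -DE in h3.
have e1 : (m + n - 2 * i = m - i + (n - i))%N by clear - ij rm rn; lia.
have e2 : (m + n - 2 * j = m - j + (n - j))%N by clear - ij rm rn; lia.
have e3 : (m - i + (n - i) - (r - i - j) = m + n + j - r - i)%N by clear - ij rm rn; lia.
have e4 : (m - j + (n - j) - (r - i - j) = m + n + i - r - j)%N by clear - ij rm rn; lia.
have hn p q s : hcoef k p q s != 0 by rewrite /hcoef !natrM !(mulf_neq0, invr_neq0, factf_neq0).
have hV p q s c y : c * hcoef k p q s = y -> c^-1 = hcoef k p q s / y.
  move=> <-; have [->|cn] := eqVneq c 0; first by rewrite !(mul0r, invr0) mulr0.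
  by field; rewrite cn hn.
rewrite /tcoef e1 e2 e3 e4 /kfac /cgNorm3 /polFactAt /polFact.
have v1 := hV _ _ _ _ _ h1; have v2 := hV _ _ _ _ _ h2; have v3 := hV _ _ _ _ _ h3.
have n1 := hn m n i; have n2 := hn m n j; have n3 := hn (m - i + (n - i))%N (m - j + (n - j))%N (r - i - j)%N.
move: (hcoef k m n i) (hcoef k m n j) (hcoef k (m - i + (n - i)) _ _) v1 v2 v3 n1 n2 n3 => H1 H2 H3 v1 v2 v3 n1 n2 n3.
rewrite [(cgNorm _ _ _ * _)%:R]natrM [(cgNorm j _ _ * _)%:R]natrM !invfM v1 v2 v3 !natrM.
by field; rewrite n1 n2 n3 !factf_neq0 ?oner_neq0.
Qed.

Variables A B : {mpoly k[2]}.
Hypotheses (Am : A \is m.-homog) (Bn : B \is n.-homog).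

Definition pair4 : {mpoly k[14]} := toS vp A * toS vq A * (toS vu B * toS vv B).

Lemma fp_iota2_pair4 g : fp (iota2 g) pair4 = 0.
Proof.
have oddK : odd K by rewrite Ka addn1 /= mul2n odd_double.
rewrite /iota2 fp_Eop /pair4 Lop_toS //.
- rewrite (rawTransv_self_odd k_char0) // (islin0 (islin_toS _)) mul0r scaler0 fp0r //.
- by apply: freeM; apply: toS_free.
- by apply: freeM; apply: toS_free.
- by rewrite mE.
by rewrite mE.
Qed.

Lemma dhomog_u i : (i <= r)%N -> rawTransv i A B \is (m - i + (n - i)).-homog.
Proof.
by move=> ir; apply: dhomog_rawTransv; rewrite subnK //; clear - ir rm rn; lia.
Qed.

Lemma dhomog_uu i j : (i + j <= r)%N ->
  rawTransv (r - i - j) (rawTransv i A B) (rawTransv j A B) \is D.-homog.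
Proof.
move=> ij.
have -> : (al + be = m + n + j - r - i + (m + n + i - r - j))%N by clear - ij mE nE alE beE rE rm rn; lia.
apply: dhomog_rawTransv.
  have -> : (m + n + j - r - i + (r - i - j) = m - i + (n - i))%N by clear - ij rm rn; lia.
  by apply: dhomog_u; clear - ij; lia.
have -> : (m + n + i - r - j + (r - i - j) = m - j + (n - j))%N by clear - ij rm rn; lia.
by apply: dhomog_u; clear - ij; lia.
Qed.

Lemma pj_pair4 i j : (i + j <= r)%N ->
  pj i j pair4 = (polFactAt i j)%:R *: toZ (rawTransv (r - i - j) (rawTransv i A B) (rawTransv j A B)).
Proof.
move=> ij; rewrite /pj /proj.
have ir : (i <= r)%N by clear - ij; lia.
have jr : (j <= r)%N by clear - ij; lia.
have im : (m - i + i = m)%N by clear - ir rm; lia.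
have in_ : (n - i + i = n)%N by clear - ir rn; lia.
have jm : (m - j + j = m)%N by clear - jr rm; lia.
have jn : (n - j + j = n)%N by clear - jr rn; lia.
have lL := @islin_Lop k.
have -> : pair4 = toS vp A * toS vu B * (toS vq A * toS vv B).
  by rewrite /pair4; move: (toS vp A) (toS vq A) (toS vu B) (toS vv B) => e1 e2 e3 e4; ring.
rewrite Lop_toS ?im ?in_ //; try by apply: freeM; apply: toS_free.
rewrite !(islinZ _ _ (lL _ _ _ _ _ _)) mulrC.
rewrite Lop_toS ?jm ?jn //; try by apply: toS_free.
rewrite !(islinZ _ _ (lL _ _ _ _ _ _)) [toS vy _ * _]mulrC -[toS vx _ * _]mulr1.
rewrite Lop_toS //; try exact: free1.
- by rewrite mulr1 !scalerA -!natrM; congr (_%:R *: _); rewrite /polFactAt /polFact; ring.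
- have -> : (m + n + j - r - i + (r - i - j) = m - i + (n - i))%N by clear - ij rm rn; lia.
  exact: dhomog_u.
have -> : (m + n + i - r - j + (r - i - j) = m - j + (n - j))%N by clear - ij rm rn; lia.
exact: dhomog_u.
Qed.

Lemma field_syzygy (x : nat -> nat -> k) :
  (forall i j, (i + j <= r)%N -> pj i j (iota2 (iota1 Z)) = x i j *: Z) ->
  \sum_(i < r.+1) \sum_(j < r.+1 | (i + j <= r)%N) (x i j / (cgNorm3 i j)%:R * (polFactAt i j)%:R) *:
    rawTransv (r - i - j) (rawTransv i A B) (rawTransv j A B) = 0.
Proof.
move=> xE; apply: (@fp_toZ_nondeg k k_char0 D).
  by apply: rpred_sum => i _; apply: rpred_sum => j ij; apply: rpredZ; apply: dhomog_uu.
move=> f fD; rewrite -(fp_iota2_pair4 (iota1 (toZ f))).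
rewrite (iota_expand xE fD).
rewrite [RHS]fp_suml [in LHS](islin_sum _ _ _ (@islin_toZ k)) [LHS]fp_sumr; apply: eq_bigr => i _.
rewrite [RHS]fp_suml [in LHS](islin_sum _ _ _ (@islin_toZ k)) [LHS]fp_sumr; apply: eq_bigr => j ij.
rewrite [RHS]fpZl fp_projd -/(pj i j pair4) pj_pair4 // (islinZ _ _ (@islin_toZ k)) !fpZr mulrA.
by [].
Qed.

Lemma kappa_syzygy :
  \sum_(i < r.+1) \sum_(j < r.+1 | (i + j <= r)%N) (kappa i j * tcoef i j) *:
    rawTransv (r - i - j) (rawTransv i A B) (rawTransv j A B) = 0.
Proof.
have Cn : ((m`! * n`!) ^ 2 * ((M + M)`! * (N + N)`!))%:R != 0 :> k.
  by rewrite !natrM !(mulf_neq0, factf_neq0).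
have FS := field_syzygy (x := fun i j => kappa i j / kfac i j)
  (fun i j ij => (kappa_pj ij).1).
apply: (scalerI Cn); rewrite scaler0 -[RHS]FS scaler_sumr; apply: eq_bigr => i _.
by rewrite scaler_sumr; apply: eq_bigr => j ij; rewrite scalerA kappa_tcoef.
Qed.

End Syzygy.

(** * Generic forms *)

Section BaseChange.
Variables (R S : comNzRingType) (phi : {rmorphism R -> S}).
Implicit Types F G : {mpoly R[2]}.

Lemma map_mderiv i F : map_mpoly phi F^`M(i) = (map_mpoly phi F)^`M(i).
Proof.
apply/mpolyP => m; rewrite mcoeff_map_mpoly !mcoeff_mderiv mcoeff_map_mpoly. exact: raddfMn.
Qed.

Lemma map_mderivn i q F : map_mpoly phi F^`M(i, q) = (map_mpoly phi F)^`M(i, q).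
Proof. by elim: q F => [|q IH] F; rewrite ?mderivn0 // !mderivSn IH map_mderiv. Qed.

Lemma map_rawTransv s F G : map_mpoly phi (rawTransv s F G) = rawTransv s (map_mpoly phi F) (map_mpoly phi G).
Proof.
rewrite /rawTransv rmorph_sum; apply: eq_bigr => l _ /=.
by rewrite map_mpolyZ [map_mpoly phi (_ * _)]rmorphM /= !map_mderivn rmorphM rmorphXn rmorphN1 rmorph_nat.
Qed.

Lemma map_mpoly_inj : injective phi -> injective (map_mpoly (n := 2) phi).
Proof.
move=> ip F G /mpolyP e; apply/mpolyP => m; apply: ip.
by have := e m; rewrite !mcoeff_map_mpoly.
Qed.

Lemma dhomog_map d F : F \is d.-homog -> map_mpoly phi F \is d.-homog.
Proof.
move/dhomogP => h; apply/dhomogP => m; rewrite mcoeff_msupp mcoeff_map_mpoly => nz.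
by apply: h; rewrite mcoeff_msupp; apply: contraNneq nz => ->; rewrite raddf0.
Qed.
End BaseChange.

Lemma rawTransvZ (R : comNzRingType) s (c d : R) F G : rawTransv s (c *: F) (d *: G) = (c * d) *: rawTransv s F G.
Proof.
rewrite /rawTransv scaler_sumr; apply: eq_bigr => l _.
have H i q (e : R) (P : {mpoly R[2]}) : (e *: P)^`M(i, q) = e *: P^`M(i, q).
  by elim: q P => [|q IH] P; rewrite ?mderivn0 // !mderivSn mderivZ IH.
by rewrite !H -scalerAl -scalerAr !scalerA; congr (_ *: _); ring.
Qed.

(** * Compatibility with field extensions *)

Section FieldMorphism.
Variables (k F : fieldType) (phi : {rmorphism k -> F}).

(** The closed formula is built from integers by field operations only, so the scalars over k and
    over an extension agree. *)
Lemma kappaFormula_morph m n r a b i j :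
  phi (kappaFormula k m n r a b i j) = kappaFormula F m n r a b i j.
Proof.
rewrite /kappaFormula rmorphM fmorph_div !rmorph_nat; congr (_ * _).
rewrite /Gamma rmorphM rmorphXn rmorphN1; congr (_ * _).
rewrite rmorph_sum; apply: eq_bigr => x _; rewrite rmorph_sum; apply: eq_bigr => y _.
rewrite rmorph_sum; apply: eq_bigr => z _.
by rewrite rmorphM rmorphXn rmorphN1 fmorph_div !rmorph_nat.
Qed.

Lemma tcoef_morph m n r i j : phi (tcoef k m n r i j) = tcoef F m n r i j.
Proof. by rewrite /tcoef !rmorphM /= !fmorphV !rmorphM /= !rmorph_nat. Qed.
End FieldMorphism.

Lemma sum_triangle_sym (V : nmodType) r (g : nat -> nat -> V) :
  (forall i j, (i + j <= r)%N -> g j i = g i j) ->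
  \sum_(i < r.+1) \sum_(j < r.+1 | (i + j <= r)%N) g i j =
  \sum_(i < r.+1) \sum_(j < r.+1 | ((i <= j) && (i + j <= r))%N) (if i == j :> nat then g i j else g i j *+ 2).
Proof.
move=> gs.
transitivity (\sum_(i < r.+1) \sum_(j < r.+1 | ((i <= j) && (i + j <= r))%N) g i j +
   \sum_(i < r.+1) \sum_(j < r.+1 | ((i < j) && (i + j <= r))%N) g i j).
  have -> : \sum_(i < r.+1) \sum_(j < r.+1 | ((i < j) && (i + j <= r))%N) g i j =
     \sum_(i < r.+1) \sum_(j < r.+1 | ((j < i) && (i + j <= r))%N) g i j.
    rewrite [RHS](exchange_big_dep predT) //=; apply: eq_bigr => i _.
    apply: eq_big => [j|j /andP[_ ij]]; first by rewrite addnC.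
    by rewrite (gs i j ij).
  rewrite -big_split; apply: eq_bigr => i _ /=.
  rewrite (bigID (fun j : 'I_r.+1 => i <= j)%N) /=; congr (_ + _).
    by apply: eq_bigl => j; rewrite andbC.
  by apply: eq_bigl => j; rewrite andbC -ltnNge.
rewrite -big_split; apply: eq_bigr => i _ /=.
rewrite big_mkcond [X in _ + X]big_mkcond [RHS]big_mkcond -big_split; apply: eq_bigr => j _ /=.
by case: ltngtP => _ /=; rewrite ?addr0 //; case: ifP => _; rewrite ?addr0 ?mulr2n.
Qed.

Section Final.
Variable k : fieldType.
Hypothesis k_char0 : [pchar k] =i pred0.
Variables m n : nat.
Notation R := (coefRing k m n).
Notation A := (genericA k m n).
Notation B := (genericB k m n).

Lemma homog_mon2 d i : (i <= d)%N -> ('X_z1 ^+ (d - i) * 'X_z2 ^+ i : {mpoly R[2]}) \is d.-homog.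
Proof.
move=> id; have : ('X_z1 ^+ (d - i) * 'X_z2 ^+ i : {mpoly R[2]}) \is (d - i + i).-homog.
  by apply: dhomogM; rewrite mpolyXn dhomogX /= mdegMn mdeg1 mul1n.
by rewrite subnK.
Qed.

Lemma homog_genericA : A \is m.-homog.
Proof.
apply: rpred_sum => i _; apply: rpredZ.
have im : (i <= m)%N by rewrite -ltnS.
exact: homog_mon2.
Qed.

Lemma homog_genericB : B \is n.-homog.
Proof.
apply: rpred_sum => i _; apply: rpredZ.
have im : (i <= n)%N by rewrite -ltnS.
exact: homog_mon2.
Qed.

Lemma transvectant_rawTransv p q s (F G : {mpoly R[2]}) : transvectant p q s F G =
  ((((p - s)`! * (q - s)`!)%:R / (p`! * q`!)%:R : k)%:A : R) *: rawTransv s F G.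
Proof. by []. Qed.

Variables r a b : nat.
Hypotheses (rm : (r <= m)%N) (rn : (r <= n)%N) (ab : inPi r a b).
Notation kappa := (kappaFormula k m n r a b).

(* Base change to the fraction field of the coefficient ring. *)
Lemma generic_kappa_syzygy :
  \sum_(i < r.+1) \sum_(j < r.+1 | (i + j <= r)%N) ((kappa i j * tcoef k m n r i j)%:A : R) *:
     rawTransv (r - i - j) (rawTransv i A B) (rawTransv j A B) = 0.
Proof.
pose F : fieldType := {fraction R}.
pose phi : {rmorphism R -> F} := @tofrac R.
have iphi : injective phi by move=> x y /eqP; rewrite tofrac_eq => /eqP.
pose psi : {rmorphism k -> F} := phi \o in_alg R.
have F_char0 : [pchar F] =i pred0.
  apply/pcharf0P => q; rewrite -(rmorph_nat psi) fmorph_eq0.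
  exact: (pcharf0P k).1 k_char0 q.
have [K [K' [M [N [cc [al [be [[Ka Kb mE nE] [alE beE rE]]]]]]]]] := network_params rm rn ab.
have := kappa_syzygy F_char0 mE nE alE beE rE rm rn Ka Kb (dhomog_map phi homog_genericA) (dhomog_map phi homog_genericB).
move=> KS; apply: (map_mpoly_inj iphi); rewrite rmorph0 -[RHS]KS.
rewrite rmorph_sum; apply: eq_bigr => i _; rewrite rmorph_sum; apply: eq_bigr => j ij /=.
rewrite map_mpolyZ !map_rawTransv; congr (_ *: _).
by rewrite -(kappaFormula_morph psi) -(tcoef_morph psi) -rmorphM.
Qed.

Lemma tcoef_sym i j : tcoef k m n r j i = tcoef k m n r i j.
Proof.
rewrite /tcoef (_ : r - j - i = r - i - j)%N; last by lia.
by rewrite ![((m + n - 2 * j - _)`! * _)%N]mulnC ![((m + n - 2 * j)`! * _)%N]mulnC; congr (_ * _); rewrite mulrC.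
Qed.

(** Exchanging i and j multiplies both kappa and the outer transvectant by (-1)^(r-i-j), so the
    terms are symmetric. Folding the triangle i + j <= r along its diagonal produces the factor 2 in
    theta. *)
Lemma theta_syzygy : \sum_(i < r.+1) \sum_(j < r.+1 | ((i <= j) && (i + j <= r))%N)
   ((theta (fun a b i j => kappaFormula k m n r a b i j) a b i j)%:A : R) *:
      transvectant (m + n - 2 * i) (m + n - 2 * j) (r - i - j)
        (genericTransvectant k m n i) (genericTransvectant k m n j) = 0.
Proof.
pose g i j := ((kappa i j * tcoef k m n r i j)%:A : R) *: rawTransv (r - i - j) (rawTransv i A B) (rawTransv j A B).
have gs i j : (i + j <= r)%N -> g j i = g i j.
  move=> ij; have [K [K' [M [N [cc [al [be [[Ka Kb mE nE] [alE beE rE]]]]]]]]] := network_params rm rn ab.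
  rewrite /g (kappa_sym k_char0 mE nE alE beE rE rm rn Ka Kb ij) tcoef_sym.
  rewrite (_ : r - j - i = r - i - j)%N; last by lia.
  rewrite [rawTransv _ (rawTransv j _ _) _]rawTransv_sym scalerA; congr (_ *: _).
  rewrite -mulrA; move: (kappa i j * _) => c.
  rewrite -!in_algE rmorphM rmorphXn rmorphN1 mulrAC -expr2 sqrr_sign mul1r.
  by [].
rewrite -[RHS]generic_kappa_syzygy -/(g _ _) (sum_triangle_sym gs).
apply: eq_bigr => i _; apply: eq_bigr => j /andP[_ ij].
rewrite /genericTransvectant !transvectant_rawTransv rawTransvZ !scalerA /theta.
rewrite -!in_algE -!rmorphM -mulrA -/(tcoef k m n r i j) /g -!in_algE.
case: ifP => _ //.
by rewrite -mulrA rmorphM rmorph_nat -scalerA scaler_nat.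
Qed.
End Final.

Theorem mainTheorem3 (k : fieldType) (k_char0 : [pchar k] =i pred0)
    (m n r : nat) (r_ge2 : (2 <= r)%N) (r_le : (r <= minn m n)%N) :
  exists kappa : nat -> nat -> nat -> nat -> k,
    [/\ forall a b i j : nat, inPi r a b -> (i + j <= r)%N ->
          unique (actsByScalar (2 * (m + n - r)) (@xi k m n r a b i j))
                 (kappa a b i j),
        forall a b i j : nat, inPi r a b -> (i + j <= r)%N ->
          kappa a b i j = kappaFormula k m n r a b i j,
        forall a b : nat, inPi r a b ->
          \sum_(i < r.+1) \sum_(j < r.+1 | ((i <= j) && (i + j <= r))%N)
            ((theta kappa a b i j)%:A : coefRing k m n) *:
              transvectant (m + n - 2 * i) (m + n - 2 * j) (r - i - j)
                (genericTransvectant k m n i) (genericTransvectant k m n j)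
          = 0
      & theta kappa 0 0 0 r != 0].
Proof.
have [rm rn] : (r <= m)%N /\ (r <= n)%N by lia.
exists (fun a b i j => kappaFormula k m n r a b i j); split=> //.
- by move=> a b i j; apply: xi_scalar.
- by move=> a b; apply: theta_syzygy.
rewrite /theta ifN; last by lia.
by rewrite mulf_neq0 ?natk_neq0 ?kappaFormula_neq0.
Qed.
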